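(* Let $\mathcal H=\mathcal H(E)$ be an infinite-dimensional de Branges space, and let $\mathfrak m:i[1,\infty)\to[0,\infty)$ be given by $\mathfrak m(z):=\frac{|E(z)|}{|z+i|}$. Denote $\Theta:=E^{-1}E^\#$, and let $(w_n)_{n\in\mathbb N}$ be the sequence of zeros of $\Theta$ in $\mathbb C^+$ listed according to their multiplicities. Consider the conditions: (i) $\operatorname{mt}\Theta<0$ or $\limsup_{n\to\infty}\operatorname{Im}w_n>0$. (ii) There exists $\delta>0$ such that $$\liminf_{|z|\to\infty,\ \operatorname{Im}z\ge\delta}|\Theta(z)|=0.$$ (iii) There exists a bicontinuous embedding of $\langle\ell^\infty,\|\cdot\|_\infty\rangle$ into $\langle R_{\mathfrak m}(\mathcal H),\|\cdot\|_{\mathfrak m}\rangle$; in particular, $R_{\mathfrak m}(\mathcal H)$ (with the norm $\|\cdot\|_{\mathfrak m}$) is neither separable nor reflexive. Then (i) implies (ii), and (ii) implies (iii).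
   Context: $\mathbb C^+$ is the open upper half-plane, $F^\#(z):=\overline{F(\bar z)}$. A Hermite–Biehler function is an entire function $E$ with $|E(\bar z)|<|E(z)|$ for all $z\in\mathbb C^+$. The de Branges space $\mathcal H(E)$ is the Hilbert space $\{F\text{ entire}:\ F/E,\ F^\#/E\in H^2(\mathbb C^+)\}$ with norm $\|F\|_{\mathcal H}=(\int_{\mathbb R}|F(t)/E(t)|^2\,dt)^{1/2}$. Standing assumptions: for every $x\in\mathbb R$ there is $F\in\mathcal H$ with $F(x)\neq0$ (equivalently $E$ has no real zeros), and $\dim\mathcal H=\infty$. For a function $\mathfrak m:D\to[0,\infty)$, $D\subseteq\mathbb C^+\cup\mathbb R$, $$R_{\mathfrak m}(\mathcal H):=\{F\in\mathcal H:\ \exists\,C>0:\ |F(z)|,|F^\#(z)|\le C\,\mathfrak m(z)\ \forall z\in D\},$$ $$\|F\|_{\mathfrak m}:=\max\big\{\|F\|_{\mathcal H},\ \min\{C\ge0:\ |F(z)|,|F^\#(z)|\le C\,\mathfrak m(z),\ z\in D\}\big\};$$ here $\langle R_{\mathfrak m}(\mathcal H),\|\cdot\|_{\mathfrak m}\rangle$ is a Banach space. The mean type is $\operatorname{mt}\Theta:=\limsup_{y\to+\infty}\frac1y\log|\Theta(iy)|$. The sequence $(w_n)$ may be finite or empty; in that case the second alternative in (i) is understood not to hold. A bicontinuous embedding is a bounded linear map that is bounded below, i.e. a linear homeomorphism onto its range. *)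

(* Defs.v *)
From mathcomp Require Import all_boot all_order all_algebra.
From mathcomp Require Import all_classical all_reals all_analysis.
From mathcomp Require Export complex.

Set Implicit Arguments.
Unset Strict Implicit.
Unset Printing Implicit Defensive.

Import Order.TTheory GRing.Theory Num.Theory.
Import numFieldNormedType.Exports.

Local Open Scope classical_set_scope.
Local Open Scope ring_scope.
Local Open Scope complex_scope.

(* The regular-module alias [^o] carries the topology and the normed module
   structure of the complex numbers over themselves. *)
Notation Cplx R := (R[i]^o).

(* The real-valued modulus; the library's [`|z|] is an element of [R[i]]. *)
Definition cabs (R : realType) (z : Cplx R) : R := ComplexField.Normc.normc z.

Section DeBranges.
Variable R : realType.
Local Notation C := (Cplx R).
Local Notation mu := (@lebesgue_measure R).
Implicit Types (E F f g : C -> C) (z u : C) (D : set C).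

Definition upper_half_plane : set C := [set z | 0 < complex.Im z].

Definition holomorphic_on D f := forall z, D z -> derivable f z 1.

Definition entire f := holomorphic_on setT f.

Definition sharp F : C -> C := fun z => (F (z^*))^*.

Definition hermite_biehler E :=
  entire E /\ forall z, upper_half_plane z -> cabs (E (z^*)) < cabs (E z).

Definition hardy2 f :=
  holomorphic_on upper_half_plane f /\
  (ereal_sup [set (\int[mu]_x ((cabs (f (x +i* y))) ^+ 2)%:E)%E
             | y in [set y : R | (0 < y)%R]] < +oo)%E.

Definition deBranges E : set (C -> C) :=
  [set F | [/\ entire F, hardy2 (fun z => F z / E z) &
               hardy2 (fun z => sharp F z / E z)]].

Definition deBranges_norm E F : R :=
  Num.sqrt (\int[mu]_t (cabs (F (t%:C) / E (t%:C))) ^+ 2)%R.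

Definition infinite_dim (V : lmodType R[i]) (A : set V) :=
  forall n : nat, exists v : 'I_n -> V,
    (forall j, A (v j)) /\
    forall c : 'I_n -> R[i],
      \sum_(j < n) c j *: v j = 0 -> forall j, c j = 0.

Definition majorized D (m : C -> R) F (c : R) :=
  forall z, D z -> cabs (F z) <= c * m z /\ cabs (sharp F z) <= c * m z.

Definition majorant_subspace E D (m : C -> R) : set (C -> C) :=
  [set F | deBranges E F /\ exists2 c : R, 0 < c & majorized D m F c].

(* The infimum is a minimum: the conditions on [c] are closed. *)
Definition majorant_norm E D (m : C -> R) F : R :=
  Num.max (deBranges_norm E F) (inf [set c : R | 0 <= c /\ majorized D m F c]).

Definition mean_type f : \bar R :=
  limf_esup (fun y : R => ((y^-1)%:E * lne (cabs (f (0 +i* y)))%:E)%E) +oo.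

(* [f] has a zero of order exactly [k] at [z] ([k = 0]: no zero). *)
Definition zero_order f z (k : nat) :=
  exists g, [/\ \forall u \near z, derivable g u 1, g z != 0 &
                \forall u \near z, f u = (u - z) ^+ k * g u].

(* [w] is an infinite listing of the zeros of [f] in the upper half-plane,
   each repeated according to its multiplicity; there is no such [w] when the
   number of zeros is finite. *)
Definition zeros_listing f (w : nat -> C) :=
  (forall n, upper_half_plane (w n)) /\
  forall z, upper_half_plane z ->
    exists k, zero_order f z k /\ ([set n | w n = z] #= `I_k)%card.

(* The filter of neighbourhoods of infinity in the complex plane. *)
Definition cinfty_nbhs : set_system C :=
  filter_from setT (fun M : R => [set z | M < cabs z]).

End DeBranges.

(* A complex normed space given as a linear subspace [ns_set] of an ambient
   vector space, with a norm [ns_norm] that is meaningful on [ns_set] only.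
   The vector space and norm axioms are not part of the record. *)
Record nspace (R : realType) := NSpace {
  ns_amb : lmodType R[i];
  ns_set : set ns_amb;
  ns_norm : ns_amb -> R }.

Section NormedSpaces.
Variable R : realType.
Local Notation C := (Cplx R).
Implicit Types X Y : nspace R.

Definition scalars : nspace R := @NSpace R C setT (@cabs R).

Definition linear_map X Y (T : ns_amb X -> ns_amb Y) :=
  (forall x, ns_set x -> ns_set (T x)) /\
  forall (a : R[i]) x y, ns_set x -> ns_set y -> T (a *: x + y) = a *: T x + T y.

Definition bounded_linear X Y (T : ns_amb X -> ns_amb Y) :=
  linear_map T /\
  exists K : R, forall x, ns_set x -> ns_norm (T x) <= K * ns_norm x.

Definition bounded_below X Y (T : ns_amb X -> ns_amb Y) :=
  exists2 c : R, 0 < c & forall x, ns_set x -> c * ns_norm x <= ns_norm (T x).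

Definition bicontinuous_embedding X Y (T : ns_amb X -> ns_amb Y) :=
  bounded_linear T /\ bounded_below T.

Definition separable X :=
  exists S : set (ns_amb X),
    [/\ countable S, S `<=` @ns_set R X &
        forall x, ns_set x -> forall e : R, 0 < e ->
          exists2 s, S s & ns_norm (x - s) < e].

(* Functionals are total functions on the ambient space, and only their
   restrictions to [ns_set] matter: two functionals with the same restriction
   differ by one of dual norm 0, so no bounded functional on [dual X]
   distinguishes them. *)
Definition dual X : nspace R :=
  @NSpace R (ns_amb X -> C)
    [set phi | @bounded_linear X scalars phi]
    (fun phi => sup [set cabs (phi x)
                    | x in [set x | ns_set x /\ ns_norm x <= 1]]).

Definition reflexive_space X :=
  forall L : ns_amb (dual (dual X)), ns_set L ->
    exists2 x : ns_amb X, ns_set x &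
      forall phi : ns_amb (dual X), ns_set phi -> L phi = phi x.

Definition linfty : nspace R :=
  @NSpace R (nat -> C)
    [set a | exists M : R, forall n, cabs (a n) <= M]
    (fun a => sup (range (fun n => cabs (a n)))).

Definition majorant_space (E : C -> C) (D : set C) (m : C -> R) : nspace R :=
  @NSpace R (C -> C) (majorant_subspace E D m) (majorant_norm E D m).

End NormedSpaces.

(* Main.v *)
Require Import Defs.
From mathcomp Require Import all_boot all_order all_algebra.
From mathcomp Require Import all_classical all_reals all_analysis.
From mathcomp Require Import measurable_realfun complex ring lra zify.

(** Write [Theta = sharp E / E], so that [|Theta| <= 1] on the closed upper half-plane.

If the mean type is negative, then [Theta (i y)] tends to 0.  If [Theta] has zeros [w n]
with [Im (w n) >= delta] infinitely often, these zeros leave every compact set, because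
an accumulation point would lie in the open half-plane, where zeros are isolated and have
finite multiplicity.  Either way [Theta] is small at points of a half-plane
[Im z >= delta] that tend to infinity ([mean_type_small], [zeros_small]).

For the other implication take a sequence [w n] with [Im (w n) >= delta], [Theta (w n)]
tiny and [|w n|] growing as fast as desired ([exists_lacunary]), and the reproducing
kernels, normalized as
  [rkern w z = (E z - conj (Theta w) * sharp E z) / (z - conj w)].
On the imaginary axis [(z + i) * rkern (w n) z / E z] is close to 1 when [|z|] is much
larger than [|w n|] and close to 0 when it is much smaller, so that a series
[\sum c n * rkern (w n)], multiplied by [(z + i) / E z], takes at height [y] roughly the
value of the partial sum of [c] over the [n] with [|w n| < y].  The weight [m] asks
precisely that these values be bounded.  Hence, to embed a bounded sequence [a], the
partial sums of the coefficients are made to travel along tents of height [a k / 2],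
the tent number [k] being spread over about [2 ^ k] indices ([tent_coef]).  The spreading
makes the coefficients [O (1 / n)], hence square-summable, while the kernels are almost
orthogonal in L2 by lacunarity, each of norm [O (1 / sqrt delta)]; this bounds the norm of
the sum in the de Branges space ([weighted_sum_sq], [integral_lorentz_sum]).  Without the
spreading, kernels with bounded [Im (w n)] would have too large a norm.

The resulting operator [T] comes with evaluation functionals [psi k] of norm at most 1 on
the majorant space for which [psi k (T a)] is within [sup |a| / 16] of [a k / 2]
([exists_synthesis]).  This makes [T] bounded below, a diagonal argument against the
[psi k] excludes a countable dense set, and limits along an ultrafilter produce an element
of the bidual that is no evaluation ([T_embedding], [T_nonseparable], [T_nonreflexive]).

The kernels are quotients, and so is the bound of [sharp (rkern w)] near [w]; both need
that the difference quotient of a holomorphic function is holomorphic, without any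
assumption beyond complex differentiability.  Goursat's theorem for rectangles gives it:
Cauchy's formula on squares yields the removable singularity theorem [removable] and the
estimate [cauchy_bound], and from the latter follows the convergence theorem [weierstrass]
for series of entire functions. *)

Set Implicit Arguments.
Unset Strict Implicit.
Unset Printing Implicit Defensive.

Import Order.TTheory GRing.Theory Num.Theory.
Import numFieldNormedType.Exports.

Local Open Scope classical_set_scope.
Local Open Scope ring_scope.
Local Open Scope complex_scope.

(** * The complex modulus and epsilon-delta calculus *)

Section Cabs.
Variable R : realType.
Local Notation C := (Cplx R).
Implicit Types (z w : C).

Lemma normE_cabs z : `|z| = (cabs z)%:C.
Proof. by case: z. Qed.

Lemma cabs_ge0 z : 0 <= cabs z.
Proof. by case: z => a b; exact: sqrtr_ge0. Qed.

Lemma cabs0 : cabs (0 : C) = 0.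
Proof. exact: ComplexField.Normc.normc0. Qed.

Lemma cabs1 : cabs (1 : C) = 1.
Proof. exact: ComplexField.Normc.normc1. Qed.

Lemma cabsM z w : cabs (z * w) = cabs z * cabs w.
Proof. exact: ComplexField.Normc.normcM. Qed.

Lemma cabsV z : cabs (z^-1) = (cabs z)^-1.
Proof. exact: ComplexField.Normc.normcV. Qed.

Lemma cabsN z : cabs (- z) = cabs z.
Proof. exact: normcN. Qed.

Lemma cabsD z w : cabs (z + w) <= cabs z + cabs w.
Proof. exact: le_normcD. Qed.

Lemma cabsB z w : cabs (z - w) <= cabs z + cabs w.
Proof. by rewrite -(cabsN w) cabsD. Qed.

Lemma cabs_distC z w : cabs (z - w) = cabs (w - z).
Proof. by rewrite -cabsN opprB. Qed.

Lemma cabs_eq0 z : (cabs z == 0) = (z == 0).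
Proof.
apply/eqP/eqP => [|->]; last exact: cabs0.
exact: ComplexField.Normc.eq0_normc.
Qed.

Lemma cabs_gt0 z : (0 < cabs z) = (z != 0).
Proof. by rewrite lt_neqAle cabs_ge0 andbT eq_sym cabs_eq0. Qed.

Lemma cabsJ z : cabs (z^*%C) = cabs z.
Proof. by case: z => a b; rewrite /cabs /= sqrrN. Qed.

Lemma cabs_real (x : R) : cabs (x%:C : C) = `|x|.
Proof. by rewrite /cabs /= expr0n /= addr0 sqrtr_sqr. Qed.

Lemma cabs_imag (x : R) : cabs (0 +i* x : C) = `|x|.
Proof. by rewrite /cabs /= expr0n /= add0r sqrtr_sqr. Qed.

Lemma cabsE z : cabs z = Num.sqrt (complex.Re z ^+ 2 + complex.Im z ^+ 2).
Proof. by case: z. Qed.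

Lemma cabs_sqr z : cabs z ^+ 2 = complex.Re z ^+ 2 + complex.Im z ^+ 2.
Proof. by rewrite cabsE sqr_sqrtr // addr_ge0 // sqr_ge0. Qed.

Lemma cabs_Re z : `|complex.Re z| <= cabs z.
Proof. by rewrite cabsE -[leLHS]sqrtr_sqr ler_wsqrtr // lerDl sqr_ge0. Qed.

Lemma cabs_Im z : `|complex.Im z| <= cabs z.
Proof. by rewrite cabsE -[leLHS]sqrtr_sqr ler_wsqrtr // lerDr sqr_ge0. Qed.

Lemma cabs_le z : cabs z <= `|complex.Re z| + `|complex.Im z|.
Proof.
rewrite -(@ler_pXn2r R 2) ?nnegrE ?cabs_ge0 ?addr_ge0 //.
rewrite cabs_sqr /= sqrrD !real_normK ?num_real // lerD2r lerDl.
by rewrite mulrn_wge0 // mulr_ge0.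
Qed.

Lemma cabs_lb z w : cabs z - cabs w <= cabs (z - w).
Proof. by rewrite lerBlDr -{1}(subrK w z) cabsD. Qed.

Lemma cabsI : cabs ('i%C : C) = 1.
Proof. by rewrite cabs_imag normr1. Qed.

Lemma cReD z w : complex.Re (z + w : C) = complex.Re z + complex.Re w.
Proof. by case: z; case: w. Qed.
Lemma cImD z w : complex.Im (z + w : C) = complex.Im z + complex.Im w.
Proof. by case: z; case: w. Qed.
Lemma cReB z w : complex.Re (z - w : C) = complex.Re z - complex.Re w.
Proof. by case: z; case: w. Qed.
Lemma cImB z w : complex.Im (z - w : C) = complex.Im z - complex.Im w.
Proof. by case: z; case: w. Qed.
Lemma cReM z w : complex.Re (z * w : C) =
  complex.Re z * complex.Re w - complex.Im z * complex.Im w.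
Proof. by case: z; case: w. Qed.
Lemma cImM z w : complex.Im (z * w : C) =
  complex.Re z * complex.Im w + complex.Im z * complex.Re w.
Proof. by case: z => a b; case: w. Qed.
Lemma cReJ z : complex.Re (z^*%C : C) = complex.Re z. Proof. by case: z. Qed.
Lemma cImJ z : complex.Im (z^*%C : C) = - complex.Im z. Proof. by case: z. Qed.

Lemma complex_eq z w : complex.Re z = complex.Re w ->
  complex.Im z = complex.Im w -> z = w.
Proof. by case: z => a b; case: w => c d /= -> ->. Qed.

Lemma near_cabsP (P : C -> Prop) z :
  (\forall u \near z, P u) <->
  exists2 d : R, 0 < d & forall u, cabs (u - z) < d -> P u.
Proof.
split.
  move=> /nbhs_normP[e /= e0 h].
  have ee : e = (complex.Re e)%:C by case: e e0 {h} => a b; rewrite ltcE => /= /andP[/eqP -> _].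
  exists (complex.Re e); first by rewrite -ltcR -ee.
  move=> u hu; apply: h => /=; rewrite distrC normE_cabs ee ltcR //.
move=> [d d0 h]; apply/nbhs_normP; exists d%:C => /=; first by rewrite /= ltcR.
move=> u /=; rewrite distrC normE_cabs ltcR; exact: h.
Qed.

(** Continuity is kept in this elementary form because unfolding the filter of
    neighbourhoods of a complex point during unification is very slow. *)
Definition cont_at (f : C -> C) z := forall e : R, 0 < e ->
  exists2 d : R, 0 < d & forall u, cabs (u - z) < d -> cabs (f u - f z) < e.

Lemma continuous_cabsP (f : C -> C) z : {for z, continuous f} <-> cont_at f z.
Proof.
split=> [cf e e0|h].
  apply/near_cabsP; apply: (cf [set v | cabs (v - f z) < e]).
  by apply/near_cabsP; exists e.
move=> A /near_cabsP[e e0 hA]; have [d d0 hd] := h e e0.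
by apply/near_cabsP; exists d => // u /hd; exact: hA.
Qed.

(** The first-order expansion with the actual derivative, for difference quotients that
    are completed by the derivative at the centre. *)
Lemma derive_cabsP (f : C -> C) z : derivable f z 1 -> forall e : R, 0 < e ->
  exists2 d : R, 0 < d &
    forall h : C, cabs h < d -> cabs (f (z + h) - f z - 'D_1 f z * h) <= e * cabs h.
Proof.
move=> hl e e0.
have : \forall h \near (0 : C), h != 0 ->
    cabs (h^-1 *: (f (h *: 1 + z) - f z) - 'D_1 f z) < e.
  have := hl [set v | cabs (v - 'D_1 f z) < e].
  by apply; apply/near_cabsP; exists e.
move/near_cabsP=> [d d0 hd]; exists d => // h hh.
have [->|h0] := eqVneq h 0; first by rewrite addr0 mulr0 subrr subr0 cabs0 mulr0.
have := hd h; rewrite subr0 => /(_ hh h0) /ltW.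
have -> : h^-1 *: (f (h *: 1 + z) - f z) - 'D_1 f z =
    h^-1 * (f (z + h) - f z - 'D_1 f z * h).
  rewrite mulrBr (mulrC _ h) mulKf //.
  by congr (_ * (f _ - _) - _); rewrite addrC; congr (_ + _); rewrite [LHS]mulr1.
by rewrite cabsM cabsV mulrC ler_pdivrMr ?cabs_gt0.
Qed.

Lemma derivable_cabsP (f : C -> C) z :
  derivable f z 1 <-> exists l : C, forall e : R, 0 < e ->
  exists2 d : R, 0 < d &
    forall h : C, cabs h < d -> cabs (f (z + h) - f z - l * h) <= e * cabs h.
Proof.
split.
  by move=> /derive_cabsP h; exists ('D_1 f z).
move=> [l hl]; apply/cvg_ex; exists l => A /near_cabsP[e e0 hA].
have e20 : 0 < e / 2 by rewrite divr_gt0.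
have [d d0 hd] := hl _ e20.
apply/near_cabsP; exists d => // h; rewrite subr0 => hh h0.
apply: hA => /=.
have -> : h^-1 *: (f (h *: 1 + z) - f z) - l = h^-1 * (f (z + h) - f z - l * h).
  rewrite mulrBr (mulrC l h) mulKf //.
  by congr (_ * (f _ - _) - _); rewrite addrC; congr (_ + _); rewrite [LHS]mulr1.
rewrite cabsM cabsV mulrC ltr_pdivrMr ?cabs_gt0 //.
apply: le_lt_trans (hd _ hh) _; rewrite ltr_pM2r ?cabs_gt0 //.
by rewrite ltr_pdivrMr // ltr_pMr // ltr1n.
Qed.

Lemma derivable_continuous (f : C -> C) z : derivable f z 1 -> cont_at f z.
Proof. by move=> /derivable1_diffP /differentiable_continuous /continuous_cabsP. Qed.

Lemma cont_atD (f g : C -> C) z : cont_at f z -> cont_at g z ->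
  cont_at (fun u => f u + g u) z.
Proof.
move=> /continuous_cabsP cf /continuous_cabsP cg.
by apply/continuous_cabsP; exact: (continuousD cf cg).
Qed.

Lemma cont_atB (f g : C -> C) z : cont_at f z -> cont_at g z ->
  cont_at (fun u => f u - g u) z.
Proof.
move=> /continuous_cabsP cf /continuous_cabsP cg.
by apply/continuous_cabsP; exact: (continuousB cf cg).
Qed.

Lemma cont_atM (f g : C -> C) z : cont_at f z -> cont_at g z ->
  cont_at (fun u => f u * g u) z.
Proof.
move=> /continuous_cabsP cf /continuous_cabsP cg.
by apply/continuous_cabsP; exact: (continuousM cf cg).
Qed.

Lemma cont_atV (f : C -> C) z : f z != 0 -> cont_at f z ->
  cont_at (fun u => (f u)^-1) z.
Proof. by move=> f0 /continuous_cabsP cf; apply/continuous_cabsP; exact: (continuousV f0 cf). Qed.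

Lemma cont_at_cst (k : C) z : cont_at (fun=> k : C) z.
Proof. apply: derivable_continuous; exact: derivable_cst. Qed.

Lemma cont_at_id z : cont_at (fun u : C => u) z.
Proof. apply: derivable_continuous; exact: derivable_id. Qed.

Lemma cont_at_eq (f g : C -> C) z (d : R) : 0 < d ->
  (forall u, cabs (u - z) < d -> f u = g u) ->
  cont_at f z -> cont_at g z.
Proof.
move=> d0 fg cf e e0.
have [d1 d10 h] := cf e e0; exists (Num.min d d1); first by rewrite lt_min d0.
move=> u; rewrite lt_min => /andP[ud ud1].
by rewrite -!fg ?subrr ?cabs0 //; exact: h.
Qed.

Lemma derivable_near_eq (f g : C -> C) z (d : R) : 0 < d ->
  (forall u, cabs (u - z) < d -> f u = g u) ->
  derivable f z 1 -> derivable g z 1.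
Proof.
move=> d0 fg /derivable_cabsP[l hl]; apply/derivable_cabsP; exists l => e e0.
have [d1 d10 h] := hl e e0; exists (Num.min d d1); first by rewrite lt_min d0.
move=> u; rewrite lt_min => /andP[ud ud1].
rewrite -!fg ?subrr ?cabs0 //; first exact: h.
by rewrite addrAC subrr add0r.
Qed.

Lemma derD (f g : C -> C) z : derivable f z 1 -> derivable g z 1 ->
  derivable (fun u => f u + g u) z 1.
Proof. move=> df dg; exact: (derivableD df dg). Qed.

Lemma derB (f g : C -> C) z : derivable f z 1 -> derivable g z 1 ->
  derivable (fun u => f u - g u) z 1.
Proof. move=> df dg; exact: (derivableB df dg). Qed.

Lemma derM (f g : C -> C) z : derivable f z 1 -> derivable g z 1 ->
  derivable (fun u => f u * g u) z 1.
Proof. move=> df dg; exact: (derivableM df dg). Qed.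

Lemma derV (f : C -> C) z : f z != 0 -> derivable f z 1 ->
  derivable (fun u => (f u)^-1) z 1.
Proof. move=> f0 df; exact: (derivableV f0 df). Qed.

Lemma derBc (f : C -> C) (k : C) z : derivable f z 1 -> derivable (fun u => f u - k) z 1.
Proof. move=> df; apply: (derB df); exact: derivable_cst. Qed.

Lemma derivable_invB (w z : C) : z != w -> derivable (fun u : C => (u - w)^-1) z 1.
Proof.
move=> zw; apply: derV; first by rewrite subr_eq0.
by apply: derBc; exact: derivable_id.
Qed.

End Cabs.

#[local] Opaque derivable.

(** * Integrals of complex functions over a segment *)

Section CInt.
Variable R : realType.
Local Notation C := (Cplx R).
Local Notation mu := (@lebesgue_measure R).
Implicit Types (g h : R -> C) (a b m : R).

(** The Lebesgue integrals of the two real components. *)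
Definition cint a b g : C :=
  (\int[mu]_(x in `[a, b]) complex.Re (g x)) +i*
  (\int[mu]_(x in `[a, b]) complex.Im (g x)).

(** Two-sided continuity at each point of the segment, end points included: this spares
    one-sided notions and holds wherever the segment lies in an open domain. *)
Definition ccont a b g := forall x, a <= x <= b -> forall e : R, 0 < e ->
  exists2 d : R, 0 < d & forall u, `|u - x| < d -> cabs (g u - g x) < e.

Lemma ccont_integrable_aux a b (f : R -> R) :
  (forall x, a <= x <= b -> {for x, continuous f}) ->
  mu.-integrable `[a, b] (EFin \o f).
Proof.
move=> cf; apply: continuous_compact_integrable; first exact: segment_compact.
apply: continuous_in_subspaceT => x; rewrite inE /= in_itv /=; exact: cf.
Qed.

Lemma ccont_Re a b g : ccont a b g ->
  mu.-integrable `[a, b] (EFin \o (fun x => complex.Re (g x))).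
Proof.
move=> cg; apply: ccont_integrable_aux => x xab; apply/cvgrPdist_lt => e e0.
have [d d0 hd] := cg x xab e e0.
apply/nbhs_normP; exists d => //= u /=; rewrite distrC => /hd; apply: le_lt_trans.
by rewrite distrC -cReB cabs_Re.
Qed.

Lemma ccont_Im a b g : ccont a b g ->
  mu.-integrable `[a, b] (EFin \o (fun x => complex.Im (g x))).
Proof.
move=> cg; apply: ccont_integrable_aux => x xab; apply/cvgrPdist_lt => e e0.
have [d d0 hd] := cg x xab e e0.
apply/nbhs_normP; exists d => //= u /=; rewrite distrC => /hd; apply: le_lt_trans.
by rewrite distrC -cImB cabs_Im.
Qed.

Lemma eq_cint a b g h : (forall x, a <= x <= b -> g x = h x) ->
  cint a b g = cint a b h.
Proof.
move=> gh; rewrite /cint; congr (_ +i* _);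
  by apply: eq_Rintegral => x; rewrite inE /= in_itv /= => /gh ->.
Qed.

Lemma cintD a b g h : ccont a b g -> ccont a b h ->
  cint a b (fun x => g x + h x) = cint a b g + cint a b h.
Proof.
move=> cg ch; apply: complex_eq; rewrite ?cReD ?cImD /=.
  rewrite -RintegralD //; [|exact: ccont_Re|exact: ccont_Re].
  by apply: eq_Rintegral => x _; rewrite cReD.
rewrite -RintegralD //; [|exact: ccont_Im|exact: ccont_Im].
by apply: eq_Rintegral => x _; rewrite cImD.
Qed.

Lemma integrableZ a b (c : R) (f : R -> R) : mu.-integrable `[a, b] (EFin \o f) ->
  mu.-integrable `[a, b] (EFin \o (fun x => c * f x)).
Proof.
move=> h; have := @integrableZl _ _ _ mu _ (measurable_itv `[a,b]) c _ h.
by apply: eq_integrable => // x _ /=; rewrite EFinM.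
Qed.

Lemma cintZ a b (k : C) g : ccont a b g ->
  cint a b (fun x => k * g x) = k * cint a b g.
Proof.
move=> cg; have iR := ccont_Re cg; have iI := ccont_Im cg.
apply: complex_eq; rewrite ?cReM ?cImM /=.
  rewrite -!RintegralZl // -RintegralB //; [|exact: integrableZ|exact: integrableZ].
  by apply: eq_Rintegral => x _; rewrite cReM.
rewrite -!RintegralZl // -RintegralD //; [|exact: integrableZ|exact: integrableZ].
by apply: eq_Rintegral => x _; rewrite cImM.
Qed.

Lemma cint_split a m b g : a <= m -> m <= b -> ccont a b g ->
  cint a b g = cint a m g + cint m b g.
Proof.
move=> am mb cg.
have H (f : R -> R) : mu.-integrable `[a, b] (EFin \o f) ->
    \int[mu]_(x in `[a, b]) f x =
    \int[mu]_(x in `[a, m]) f x + \int[mu]_(x in `[m, b]) f x.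
  move=> hf; have := @Rintegral_itvB R f (BLeft a) (BRight b) m hf.
  rewrite !bnd_simp => /(_ am mb) /eqP; rewrite subr_eq addrC => /eqP ->.
  congr (_ + _); apply: Rintegral_itv_obnd_cbnd.
  by apply: integrableS hf => //; apply: subset_itvr; rewrite bnd_simp.
by apply: complex_eq; rewrite ?cReD ?cImD /= H //; [exact: ccont_Re | exact: ccont_Im].
Qed.

(** The factor 2 comes from bounding the two components separately; constants are
    irrelevant in all uses. *)
Lemma cint_le a b (M : R) g : a <= b -> ccont a b g ->
  (forall x, a <= x <= b -> cabs (g x) <= M) ->
  cabs (cint a b g) <= 2 * M * (b - a).
Proof.
move=> ab cg hM.
have H (f : R -> R) : mu.-integrable `[a, b] (EFin \o f) ->
    (forall x, a <= x <= b -> `|f x| <= M) ->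
    `|\int[mu]_(x in `[a, b]) f x| <= M * (b - a).
  move=> hf fM; apply: le_trans (le_normr_Rintegral _ hf) _ => //.
  have <- : \int[mu]_(x in `[a, b]) M = M * (b - a).
    rewrite Rintegral_cst //= lebesgue_measure_itv /= lte_fin.
    by case: ltgtP ab => //= ->; rewrite subrr.
  apply: le_Rintegral => //.
  - exact: (@integrable_norm _ _ _ mu).
  - apply: (@ccont_integrable_aux _ _ (cst M)) => x _; exact: cvg_cst.
apply: le_trans (cabs_le _) _ => /=.
rewrite -mulrA mulr_natl mulr2n lerD //.
  apply: H (ccont_Re cg) _ => x /hM; exact: le_trans (cabs_Re _).
apply: H (ccont_Im cg) _ => x /hM; exact: le_trans (cabs_Im _).
Qed.

Lemma cint_id a b : a <= b ->
  cint a b (fun x => x%:C) = ((b ^+ 2 - a ^+ 2) / 2)%:C.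
Proof.
move=> ab; apply: complex_eq => /=; last first.
  by rewrite Rintegral_cst // mul0r.
move: ab; rewrite le_eqVlt => /predU1P[<-|ab].
  by rewrite set_itv1 Rintegral_set1 subrr mul0r.
rewrite /Rintegral (@continuous_FTC2 _ (fun x => x) (fun x => x ^+ 2 / 2) _ _ ab) //.
- by rewrite -EFinB /= mulrBl.
- by apply: continuous_in_subspaceT => x _; exact: cvg_id.
- split.
  + move=> x _; apply: derivableM => //; exact: exprn_derivable.
  + by apply: cvg_at_right_filter; apply: cvgM; [exact: exprn_continuous|exact: cvg_cst].
  + by apply: cvg_at_left_filter; apply: cvgM; [exact: exprn_continuous|exact: cvg_cst].
- move=> x _; rewrite derive1Mr; last exact: exprn_derivable.
  by rewrite exp_derive1 /= expr1 -mulr_natl mulrAC mulfV ?mul1r.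
Qed.

Lemma cint_cst a b (k : C) : a <= b -> cint a b (fun=> k) = k * (b - a)%:C.
Proof.
move=> ab; have L : fine (lebesgue_measure (`[a, b]%classic : set R)) = b - a.
  by rewrite lebesgue_measure_itv /= lte_fin; case: ltgtP ab => //= ->; rewrite subrr.
by apply: complex_eq; rewrite ?cReM ?cImM /= Rintegral_cst // L mulr0 ?subr0 ?addr0 ?add0r.
Qed.

End CInt.

(** * Integrals along the boundary of a rectangle *)

Section Rect.
Variable R : realType.
Local Notation C := (Cplx R).
Implicit Types (f g : C -> C) (a b c d m : R).

Definition inrect a b c d : set C :=
  [set z | (a <= complex.Re z <= b) && (c <= complex.Im z <= d)].

(** The integral of [f z dz] along the positively oriented boundary. *)
Definition rect_int f a b c d : C :=
  cint a b (fun x => f (x +i* c)) + 'i%C * cint c d (fun y => f (b +i* y))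
  - cint a b (fun x => f (x +i* d)) - 'i%C * cint c d (fun y => f (a +i* y)).

Lemma ccont_horiz f a b y :
  (forall x, a <= x <= b -> cont_at f (x +i* y)) ->
  ccont a b (fun x => f (x +i* y)).
Proof.
move=> cf x /cf h e e0; have [d d0 hd] := h e e0.
exists d => // u ux; apply: hd.
by rewrite /cabs /= subrr expr0n addr0 sqrtr_sqr.
Qed.

Lemma ccont_vert f a b x :
  (forall y, a <= y <= b -> cont_at f (x +i* y)) ->
  ccont a b (fun y => f (x +i* y)).
Proof.
move=> cf y /cf h e e0; have [d d0 hd] := h e e0.
exists d => // u ux; apply: hd.
by rewrite /cabs /= subrr expr0n add0r sqrtr_sqr.
Qed.

Definition rect_edge a b c d : set C :=
  [set z | [/\ inrect a b c d z & (complex.Re z == a) || (complex.Re z == b)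
                               || (complex.Im z == c) || (complex.Im z == d)]].

Lemma ccont_edges f a b c d : a <= b -> c <= d ->
  (forall z, rect_edge a b c d z -> cont_at f z) ->
  [/\ ccont a b (fun x => f (x +i* c)), ccont c d (fun y => f (b +i* y)),
      ccont a b (fun x => f (x +i* d)) & ccont c d (fun y => f (a +i* y))].
Proof.
move=> ab cd cf; split; (apply: ccont_horiz || apply: ccont_vert) => x hx;
  apply: cf; by rewrite /rect_edge/= /inrect/= hx ?lexx ?ab ?cd ?eqxx ?orbT.
Qed.

Lemma eq_rect_int f g a b c d : a <= b -> c <= d ->
  (forall z, rect_edge a b c d z -> f z = g z) ->
  rect_int f a b c d = rect_int g a b c d.
Proof.
move=> ab cd fg; rewrite /rect_int.
congr (_ + 'i%C * _ - _ - 'i%C * _); apply: eq_cint => x hx; apply: fg;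
  by rewrite /rect_edge/= /inrect/= hx ?lexx ?ab ?cd ?eqxx ?orbT.
Qed.

Lemma rect_intD f g a b c d : a <= b -> c <= d ->
  (forall z, rect_edge a b c d z -> cont_at f z) ->
  (forall z, rect_edge a b c d z -> cont_at g z) ->
  rect_int (fun z => f z + g z) a b c d = rect_int f a b c d + rect_int g a b c d.
Proof.
move=> ab cd /(ccont_edges ab cd)[f1 f2 f3 f4] /(ccont_edges ab cd)[g1 g2 g3 g4].
by rewrite /rect_int !cintD //; ring.
Qed.

Lemma rect_intZ f (k : C) a b c d : a <= b -> c <= d ->
  (forall z, rect_edge a b c d z -> cont_at f z) ->
  rect_int (fun z => k * f z) a b c d = k * rect_int f a b c d.
Proof.
move=> ab cd /(ccont_edges ab cd)[f1 f2 f3 f4].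
by rewrite /rect_int !cintZ //; ring.
Qed.

Lemma rect_int_le f (M : R) a b c d : a <= b -> c <= d ->
  (forall z, rect_edge a b c d z -> cont_at f z) ->
  (forall z, rect_edge a b c d z -> cabs (f z) <= M) ->
  cabs (rect_int f a b c d) <= 4 * M * ((b - a) + (d - c)).
Proof.
move=> ab cd /(ccont_edges ab cd)[f1 f2 f3 f4] fM.
have E : 4 * M * ((b - a) + (d - c)) =
  2 * M * (b - a) + 2 * M * (d - c) + 2 * M * (b - a) + 2 * M * (d - c) by ring.
rewrite E /rect_int.
have B1 : cabs (cint a b (fun x => f (x +i* c))) <= 2 * M * (b - a).
  by apply: cint_le => // x hx; apply: fM;
    rewrite /rect_edge/= /inrect/= hx ?lexx ?ab ?cd ?eqxx ?orbT.
have B2 : cabs (cint c d (fun y => f (b +i* y))) <= 2 * M * (d - c).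
  by apply: cint_le => // x hx; apply: fM;
    rewrite /rect_edge/= /inrect/= hx ?lexx ?ab ?cd ?eqxx ?orbT.
have B3 : cabs (cint a b (fun x => f (x +i* d))) <= 2 * M * (b - a).
  by apply: cint_le => // x hx; apply: fM;
    rewrite /rect_edge/= /inrect/= hx ?lexx ?ab ?cd ?eqxx ?orbT.
have B4 : cabs (cint c d (fun y => f (a +i* y))) <= 2 * M * (d - c).
  by apply: cint_le => // x hx; apply: fM;
    rewrite /rect_edge/= /inrect/= hx ?lexx ?ab ?cd ?eqxx ?orbT.
apply: le_trans (cabsB _ _) _; apply: lerD; last by rewrite cabsM cabsI mul1r.
apply: le_trans (cabsB _ _) _; apply: lerD => //.
apply: le_trans (cabsD _ _) _; apply: lerD => //.
by rewrite cabsM cabsI mul1r.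
Qed.

Lemma rect_int_splitx f a m b c d : a <= m -> m <= b -> c <= d ->
  (forall z, rect_edge a b c d z -> cont_at f z) ->
  rect_int f a b c d = rect_int f a m c d + rect_int f m b c d.
Proof.
move=> am mb cd /(ccont_edges (le_trans am mb) cd)[f1 f2 f3 f4].
by rewrite /rect_int (cint_split am mb f1) (cint_split am mb f3); ring.
Qed.

Lemma rect_int_splity f a b c m d : a <= b -> c <= m -> m <= d ->
  (forall z, rect_edge a b c d z -> cont_at f z) ->
  rect_int f a b c d = rect_int f a b c m + rect_int f a b m d.
Proof.
move=> ab cm md /(ccont_edges ab (le_trans cm md))[f1 f2 f3 f4].
by rewrite /rect_int (cint_split cm md f2) (cint_split cm md f4); ring.
Qed.

Lemma ccont_real a b : ccont a b (fun x => x%:C : C).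
Proof.
move=> x _ e e0; exists e => // u; rewrite -[X in cabs X]rmorphB.
by rewrite cabs_real.
Qed.

Lemma ccont_cst a b (k : C) : ccont a b (fun=> k).
Proof. by move=> x _ e e0; exists 1 => // u _; rewrite subrr cabs0. Qed.

Lemma ccontZ a b (k : C) (g : R -> C) : ccont a b g -> ccont a b (fun x => k * g x).
Proof.
move=> cg x hx e e0.
have k0 : 0 < cabs k + 1 by rewrite ltr_wpDl // cabs_ge0.
have [d d0 hd] := cg x hx (e / (cabs k + 1)) (divr_gt0 e0 k0).
exists d => // u /hd; rewrite -mulrBr cabsM ltr_pdivlMr // mulrC.
apply: le_lt_trans; by rewrite ler_wpM2r ?cabs_ge0 // lerDl.
Qed.

Lemma cint_affine a b (k l : C) : a <= b ->
  cint a b (fun x => k + l * x%:C) = k * (b - a)%:C + l * ((b ^+ 2 - a ^+ 2) / 2)%:C.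
Proof.
move=> ab; rewrite cintD; [|exact: ccont_cst|by apply: ccontZ; exact: ccont_real].
by rewrite cintZ ?cint_cst ?cint_id //; exact: ccont_real.
Qed.

(** Affine functions are what remains of a differentiable function at small scale, so
    this is the only explicit case that Goursat's argument needs. *)
Lemma rect_int_affine (k l : C) a b c d : a <= b -> c <= d ->
  rect_int (fun z => k + l * z) a b c d = 0.
Proof.
move=> ab cd.
have H y : cint a b (fun x => k + l * (x +i* y)) =
   (k + l * 'i%C * y%:C) * (b - a)%:C + l * ((b ^+ 2 - a ^+ 2) / 2)%:C.
  rewrite -cint_affine //; apply: eq_cint => x _.
  by rewrite [x +i* y]complexE /=; ring.
have V x : cint c d (fun y => k + l * (x +i* y)) =
   (k + l * x%:C) * (d - c)%:C + l * 'i%C * ((d ^+ 2 - c ^+ 2) / 2)%:C.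
  rewrite -cint_affine //; apply: eq_cint => y _.
  by rewrite [x +i* y]complexE /=; ring.
rewrite /rect_int !H !V.
set X := (_ / 2)%:C; set Y := (_ / 2)%:C.
have rB (x y : R) : (x - y)%:C = x%:C - y%:C :> C by rewrite -rmorphB.
by rewrite (rB b a) (rB d c); ring.
Qed.

End Rect.

(** * Goursat's theorem *)

Section Goursat.
Variable R : realType.
Local Notation C := (Cplx R).
Implicit Types (f g : C -> C) (a b c d m : R).

Lemma nested_point (u v : nat -> R) :
  (forall n, u n <= u n.+1) -> (forall n, v n.+1 <= v n) ->
  (forall n, u n <= v n) -> exists x, forall n, u n <= x <= v n.
Proof.
move=> hu hv uv.
have mu' := homo_leq (@lexx _ R) (fun y x z => @le_trans _ R y x z) hu.
have mv' := homo_leq (r := fun x y : R => y <= x) (@lexx _ R)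
   (fun (y x z : R) xy yz => le_trans yz xy) hv.
have uv' n k : u n <= v k.
  apply: (le_trans (mu' _ _ (leq_addr k n))).
  apply: (le_trans (uv (n + k)%N)); exact: mv' (leq_addl _ _).
exists (sup (range u)) => n; apply/andP; split.
  apply: ub_le_sup; last by exists n.
  by exists (v 0%N) => _ [k _ <-].
by apply: ge_sup => [|_ [k _ <-]//]; exists (u 0%N); exists 0%N.
Qed.

Lemma small_pow2 (s e : R) : 0 < e -> exists n, s / 2 ^+ n < e.
Proof.
move=> e0; have [n hn] : exists n : nat, `|s / e| < n%:R.
  by exists (Num.bound `|s / e|); exact: archi_boundP.
exists n; rewrite ltr_pdivrMr ?exprn_gt0 // mulrC -ltr_pdivrMr //.
apply: le_lt_trans (ler_norm _) _; apply: lt_trans hn _.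
by rewrite -natrX ltr_nat ltn_expl.
Qed.

Let quad := (R * R * R * R)%type.
Let qint f (q : quad) := let: (a, b, c, d) := q in rect_int f a b c d.
Let subq (q' q : quad) := let: (a, b, c, d) := q in let: (a', b', c', d') := q' in
  [/\ a <= a', b' <= b, c <= c', d' <= d & (b' - a' = (b - a) / 2) /\ (d' - c' = (d - c) / 2)].

Let bisect f (q : quad) : (let: (a, b, c, d) := q in [/\ a <= b, c <= d &
    forall z, inrect a b c d z -> cont_at f z]) ->
  exists q', subq q' q /\ cabs (qint f q) <= 4 * cabs (qint f q').
Proof.
case: q => [[[a b] c] d] [ab cd cf].
pose m := (a + b) / 2; pose n := (c + d) / 2.
have [am mb cn nd] : [/\ a <= m, m <= b, c <= n & n <= d] by rewrite /m /n; split; lra.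
have ce a' b' c' d' : a <= a' -> b' <= b -> c <= c' -> d' <= d ->
    forall z, rect_edge a' b' c' d' z -> cont_at f z.
  move=> h1 h2 h3 h4 z [/andP[/andP[z1 z2] /andP[z3 z4]] _]; apply: cf.
  by apply/andP; split; apply/andP; split; apply: le_trans; eassumption.
have E : qint f (a, b, c, d) = qint f (a, m, c, n) + qint f (a, m, n, d) +
    (qint f (m, b, c, n) + qint f (m, b, n, d)).
  rewrite /= (rect_int_splitx am mb cd); last exact: ce.
  rewrite (rect_int_splity am cn nd); last exact: ce.
  by rewrite (rect_int_splity mb cn nd) //; exact: ce.
apply: contrapT => /forallNP H.
have lt4 q' : subq q' (a, b, c, d) -> 4 * cabs (qint f q') < cabs (qint f (a, b, c, d)).
  by move=> hs; rewrite ltNge; apply/negP => h; apply: (H q').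
have h1 : 4 * cabs (qint f (a, m, c, n)) < cabs (qint f (a, b, c, d)).
  by apply: lt4; split=> //; split; rewrite /m /n; field.
have h2 : 4 * cabs (qint f (a, m, n, d)) < cabs (qint f (a, b, c, d)).
  by apply: lt4; split=> //; split; rewrite /m /n; field.
have h3 : 4 * cabs (qint f (m, b, c, n)) < cabs (qint f (a, b, c, d)).
  by apply: lt4; split=> //; split; rewrite /m /n; field.
have h4 : 4 * cabs (qint f (m, b, n, d)) < cabs (qint f (a, b, c, d)).
  by apply: lt4; split=> //; split; rewrite /m /n; field.
have : cabs (qint f (a, b, c, d)) <= cabs (qint f (a, m, c, n)) + cabs (qint f (a, m, n, d)) +
    (cabs (qint f (m, b, c, n)) + cabs (qint f (m, b, n, d))).
  rewrite E; apply: le_trans (cabsD _ _) _.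
  by apply: lerD; exact: cabsD.
move: h1 h2 h3 h4; clear; lra.
Qed.

(** Quartering: if the integral over the boundary is not 0, one of four half-size
    rectangles carries at least a quarter of it, and so on.  The nested rectangles shrink
    to a point, near which [f] differs from an affine function by [o] of the diameter, so
    the integrals decrease faster than [4 ^ -n]. *)
Theorem goursat f a b c d : a <= b -> c <= d ->
  (forall z, inrect a b c d z -> derivable f z 1) -> rect_int f a b c d = 0.
Proof.
move=> ab cd hf.
have cf z : inrect a b c d z -> cont_at f z.
  by move=> /hf; exact: derivable_continuous.
pose inq (q : quad) := let: (a', b', c', d') := q in
  [/\ a <= a', b' <= b, c <= c' & d' <= d] /\ (a' <= b' /\ c' <= d').
have [nx hnx] : {nx : quad -> quad & forall q, inq q ->
   subq (nx q) q /\ cabs (qint f q) <= 4 * cabs (qint f (nx q))}.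
  apply: (@choice quad quad (fun q q' => inq q -> subq q' q /\
     cabs (qint f q) <= 4 * cabs (qint f q'))) => q.
  case: (pselect (inq q)) => [|nq]; last by exists q.
  case: q => [[[a' b'] c'] d'] [[h1 h2 h3 h4] [h5 h6]].
  have [|q' hq'] := @bisect f (a', b', c', d'); last by exists q'.
  split=> // z /andP[/andP[z1 z2] /andP[z3 z4]]; apply: cf.
  by apply/andP; split; apply/andP; split; apply: le_trans; eassumption.
pose Q n := iter n nx (a, b, c, d).
have inQ n : inq (Q n).
  elim: n => [|n IH]; first by rewrite /= !lexx.
  have [hs _] := hnx _ IH; rewrite /Q iterS -/(Q n).
  move: IH hs; case: (Q n) => [[[a' b'] c'] d']; case: (nx _) => [[[a1 b1] c1] d1].
  move=> [[h1 h2 h3 h4] [h5 h6]] [k1 k2 k3 k4 [k5 k6]].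
  split; first by split; apply: le_trans; eassumption.
  split; [rewrite -subr_ge0 k5|rewrite -subr_ge0 k6]; rewrite divr_ge0 // subr_ge0 //.
pose qa n : R := (Q n).1.1.1; pose qb n : R := (Q n).1.1.2.
pose qc n : R := (Q n).1.2; pose qd n : R := (Q n).2.
have QE n : Q n = (qa n, qb n, qc n, qd n).
  by rewrite /qa /qb /qc /qd; case: (Q n) => [[[? ?] ?] ?].
have sQ n : subq (Q n.+1) (Q n) by case: (hnx _ (inQ n)).
have bd n : qb n - qa n = (b - a) / 2 ^+ n /\ qd n - qc n = (d - c) / 2 ^+ n.
  elim: n => [|n [IH1 IH2]]; first by rewrite expr0 !divr1.
  have := sQ n; rewrite !QE => -[_ _ _ _ [-> ->]].
  by rewrite IH1 IH2 exprS invfM mulrAC mulrA [in X in _ /\ X]mulrAC mulrA.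
have I n : cabs (rect_int f a b c d) <= 4 ^+ n * cabs (qint f (Q n)).
  elim: n => [|n IH]; first by rewrite expr0 mul1r.
  apply: le_trans IH _; rewrite exprSr -mulrA ler_wpM2l ?exprn_ge0 //.
  by case: (hnx _ (inQ n)).
have [x0 hx0] : exists x, forall n, qa n <= x <= qb n.
  apply: nested_point => n.
  - by have := sQ n; rewrite !QE => -[].
  - by have := sQ n; rewrite !QE => -[].
  - by have := inQ n; rewrite QE => -[_ []].
have [y0 hy0] : exists x, forall n, qc n <= x <= qd n.
  apply: nested_point => n.
  - by have := sQ n; rewrite !QE => -[].
  - by have := sQ n; rewrite !QE => -[].
  - by have := inQ n; rewrite QE => -[_ []].
pose z0 : C := x0 +i* y0.
have z0in : inrect a b c d z0 by rewrite /inrect/= (hx0 0%N) (hy0 0%N).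
have /derivable_cabsP[l hl] := hf _ z0in.
pose s := (b - a) + (d - c).
have s0 : 0 <= s by rewrite addr_ge0 // subr_ge0.
(* The factor [4 ^+ n] of the quartering is cancelled by perimeter times diameter. *)
have key e : 0 < e -> cabs (rect_int f a b c d) <= 4 * e * s ^+ 2.
  move=> e0; have [dl dl0 hdl] := hl e e0.
  have [n hn] := small_pow2 s dl0.
  apply: le_trans (I n) _.
  have [[k1 k2 k3 k4] [k5 k6]] : inq (qa n, qb n, qc n, qd n) by rewrite -QE.
  have edge_in z : rect_edge (qa n) (qb n) (qc n) (qd n) z -> inrect a b c d z.
    move=> [/andP[/andP[z1 z2] /andP[z3 z4]] _].
    by apply/andP; split; apply/andP; split; apply: le_trans; eassumption.
  pose g z := f z + ((l * z0 - f z0) + (- l) * z).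
  have cl z : cont_at (fun z : C => (l * z0 - f z0) + (- l) * z) z.
    apply: cont_atD; first exact: cont_at_cst.
    by apply: cont_atM; [exact: cont_at_cst|exact: cont_at_id].
  have -> : qint f (Q n) = rect_int g (qa n) (qb n) (qc n) (qd n).
    have ce z : rect_edge (qa n) (qb n) (qc n) (qd n) z -> cont_at f z.
      by move=> /edge_in; exact: cf.
    by rewrite (rect_intD k5 k6 ce (fun z _ => cl z)) rect_int_affine // addr0 QE.
  have [e1 e2] := bd n.
  have sz : (qb n - qa n) + (qd n - qc n) = s / 2 ^+ n by rewrite e1 e2 -mulrDl.
  have -> : 4 * e * s ^+ 2 = 4 ^+ n * (4 * (e * (s / 2 ^+ n)) * (s / 2 ^+ n)).
    rewrite (_ : 4 ^+ n = (2 ^+ n) ^+ 2); last first.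
      by rewrite -exprM mulnC exprM; congr (_ ^+ _); rewrite -natrX.
    by field; rewrite expf_neq0.
  rewrite ler_wpM2l ?exprn_ge0 // -[X in _ * X]sz.
  apply: rect_int_le => // z hz.
    by apply: cont_atD; [exact: (cf z (edge_in z hz))|exact: cl].
  have hzz : cabs (z - z0) <= s / 2 ^+ n.
    rewrite -sz; apply: le_trans (cabs_le _) _; rewrite cReB cImB /=.
    case: hz => /andP[/andP[z1 z2] /andP[z3 z4]] _.
    have /andP[x1 x2] := hx0 n; have /andP[y1 y2] := hy0 n.
    by rewrite lerD // ler_norml; apply/andP; split; lra.
  have := hdl (z - z0) (le_lt_trans hzz hn).
  have -> : f (z0 + (z - z0)) - f z0 - l * (z - z0) = g z.
    by rewrite addrCA subrr addr0 /g; ring.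
  by move=> /le_trans -> //; rewrite ler_pM2l.
apply/eqP; rewrite -cabs_eq0 eq_le cabs_ge0 andbT leNgt; apply/negP => h.
have p0 : 0 < 8 * (s ^+ 2 + 1) by rewrite mulr_gt0 // ltr_wpDl ?sqr_ge0.
have := key (cabs (rect_int f a b c d) / (8 * (s ^+ 2 + 1))) (divr_gt0 h p0).
set J := cabs _ in h *.
rewrite -[4 * _]mulrC -!mulrA ler_pMr // leNgt => /negP; apply.
rewrite mulrC -ltr_pdivlMr ?mul1r ?invr_gt0 //  invrK.
have := sqr_ge0 s; lra.
Qed.

End Goursat.

(** * Exceptional points in Cauchy's theorem *)

Section Cauchy.
Variable R : realType.
Local Notation C := (Cplx R).
Implicit Types (f g : C -> C) (a b c d m h r : R) (z w p : C).

Lemma rect_int_degx f a c d : rect_int f a a c d = 0.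
Proof.
have Z (g : R -> C) : cint a a g = 0 by rewrite /cint set_itv1 !Rintegral_set1.
by rewrite /rect_int !Z; ring.
Qed.

Lemma rect_int_degy f a b c : rect_int f a b c c = 0.
Proof.
have Z (g : R -> C) : cint c c g = 0 by rewrite /cint set_itv1 !Rintegral_set1.
by rewrite /rect_int !Z; ring.
Qed.

Lemma inrect_sub a b c d a' b' c' d' z :
  a <= a' -> b' <= b -> c <= c' -> d' <= d ->
  inrect a' b' c' d' z -> inrect a b c d z.
Proof.
move=> h1 h2 h3 h4 /andP[/andP[z1 z2] /andP[z3 z4]].
by apply/andP; split; apply/andP; split; apply: le_trans; eassumption.
Qed.

Lemma edge_inrect a b c d z : rect_edge a b c d z -> inrect a b c d z.
Proof. by case. Qed.

(** A hereditary form of vanishing integrals, stable under removing one point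
    from [S] at a time. *)
Definition vanish_off (S : set C) f a b c d := forall a' b' c' d',
  a <= a' -> a' <= b' -> b' <= b -> c <= c' -> c' <= d' -> d' <= d ->
  (forall z, inrect a' b' c' d' z -> ~ S z) -> rect_int f a' b' c' d' = 0.

(** A point of continuity is negligible: cut the rectangle into two vertical strips that
    miss [p], two rectangles above and below it, and a small square around it, whose
    perimeter tends to 0 while [f] stays bounded. *)
Lemma vanish_off_point (S : set C) p f a b c d :
  (forall z, inrect a b c d z -> cont_at f z) ->
  vanish_off (S `|` [set p]) f a b c d -> vanish_off S f a b c d.
Proof.
move=> cf hv a' b' c' d' aa ab bb cc cd dd hS.
have [pin|pout] := pselect (inrect a' b' c' d' p); last first.
  apply: hv => // z zin [|zp]; first exact: hS.
  by apply: pout; rewrite -zp.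
have cf' a1 b1 c1 d1 : a' <= a1 -> b1 <= b' -> c' <= c1 -> d1 <= d' ->
    forall z, rect_edge a1 b1 c1 d1 z -> cont_at f z.
  move=> h1 h2 h3 h4 z /edge_inrect hz; apply: cf.
  by apply: inrect_sub hz; apply: le_trans; eassumption.
have pin' : inrect a b c d p by apply: inrect_sub pin.
have [dl dl0 hdl] := cf p pin' 1 ltr01.
case: (p) pin => p1 p2 /andP[/= /andP[p1a p1b] /andP[p2c p2d]] in pin' hv hdl *.
pose M := cabs (f (p1 +i* p2)) + 1.
have M0 : 0 < M by rewrite ltr_wpDl // cabs_ge0.
have key e : 0 < e -> e < dl / 4 -> cabs (rect_int f a' b' c' d') <= 16 * M * e.
  move=> e0 edl.
  pose xl := Num.max a' (p1 - e); pose xr := Num.min b' (p1 + e).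
  pose yl := Num.max c' (p2 - e); pose yr := Num.min d' (p2 + e).
  have [xl1 xl2 xl3] : [/\ a' <= xl, xl <= p1 & p1 - e <= xl].
    by rewrite /xl; split;
      [rewrite le_max lexx|rewrite ge_max p1a gerBl ltW|rewrite le_max lexx orbT].
  have [xr1 xr2 xr3] : [/\ xr <= b', p1 <= xr & xr <= p1 + e].
    by rewrite /xr; split;
      [rewrite ge_min lexx|rewrite le_min p1b lerDl ltW|rewrite ge_min lexx orbT].
  have [yl1 yl2 yl3] : [/\ c' <= yl, yl <= p2 & p2 - e <= yl].
    by rewrite /yl; split;
      [rewrite le_max lexx|rewrite ge_max p2c gerBl ltW|rewrite le_max lexx orbT].
  have [yr1 yr2 yr3] : [/\ yr <= d', p2 <= yr & yr <= p2 + e].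
    by rewrite /yr; split;
      [rewrite ge_min lexx|rewrite le_min p2d lerDl ltW|rewrite ge_min lexx orbT].
  have xlr := le_trans xl2 xr2; have ylr := le_trans yl2 yr2.
  have xlb := le_trans xlr xr1; have ylb := le_trans ylr yr1.
  have nS a1 b1 c1 d1 : a' <= a1 -> b1 <= b' -> c' <= c1 -> d1 <= d' ->
      ~ inrect a1 b1 c1 d1 (p1 +i* p2) ->
      forall z, inrect a1 b1 c1 d1 z -> ~ (S `|` [set p1 +i* p2]) z.
    move=> h1 h2 h3 h4 hp z hz [|zp]; last by apply: hp; rewrite -zp.
    by apply: hS; apply: inrect_sub hz.
  have L : rect_int f a' xl c' d' = 0.
    have [E|ne] := eqVneq xl a'; first by rewrite E rect_int_degx.
    apply: hv => //; first exact: le_trans xlb bb.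
    apply: nS => //; rewrite /inrect /= => /andP[/andP[_ h] _].
    move: ne h; rewrite /xl maxEle; case: ifP; last by rewrite eqxx.
    move=> _ _; lra.
  have Rr : rect_int f xr b' c' d' = 0.
    have [E|ne] := eqVneq xr b'; first by rewrite E rect_int_degx.
    apply: hv => //; first by apply: le_trans aa _; apply: le_trans p1a xr2.
    apply: nS => //; first exact: le_trans p1a xr2.
    rewrite /inrect /= => /andP[/andP[h _] _].
    move: ne h; rewrite /xr minEle; case: ifP; first by rewrite eqxx.
    move=> _ _; lra.
  have B : rect_int f xl xr c' yl = 0.
    have [E|ne] := eqVneq yl c'; first by rewrite E rect_int_degy.
    apply: hv => //; [exact: le_trans aa xl1|exact: le_trans xr1 bb|exact: le_trans ylb dd|].
    apply: nS => //; rewrite /inrect /= => /andP[_ /andP[_ h]].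
    move: ne h; rewrite /yl maxEle; case: ifP; last by rewrite eqxx.
    move=> _ _; lra.
  have T : rect_int f xl xr yr d' = 0.
    have [E|ne] := eqVneq yr d'; first by rewrite E rect_int_degy.
    apply: hv => //; [exact: le_trans aa xl1|exact: le_trans xr1 bb| |].
      by apply: le_trans cc _; apply: le_trans p2c yr2.
    apply: nS => //; first exact: le_trans p2c yr2.
    rewrite /inrect /= => /andP[_ /andP[h _]].
    move: ne h; rewrite /yr minEle; case: ifP; first by rewrite eqxx.
    move=> _ _; lra.
  rewrite (rect_int_splitx xl1 xlb cd); last exact: cf'.
  rewrite (rect_int_splitx xlr xr1 cd) ?L ?Rr; last exact: cf'.
  rewrite (rect_int_splity xlr yl1 ylb) ?B; last exact: cf'.
  rewrite (rect_int_splity xlr ylr yr1) ?T; last exact: cf'.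
  rewrite !add0r !addr0.
  apply: le_trans (rect_int_le (M := M) xlr ylr _ _) _.
  - by apply: cf' => //; apply: le_trans; eassumption.
  - move=> [z1 z2] /edge_inrect /andP[/= /andP[k1 k2] /andP[k3 k4]].
    have /hdl : cabs ((z1 +i* z2) - (p1 +i* p2) : C) < dl.
      apply: le_lt_trans (cabs_le _) _ => /=.
      have : `|z1 - p1| <= e by rewrite ler_norml; apply/andP; split; lra.
      have : `|z2 - p2| <= e by rewrite ler_norml; apply/andP; split; lra.
      lra.
    have := cabs_lb (f (z1 +i* z2)) (f (p1 +i* p2)); rewrite /M; lra.
  - have -> : 16 * M * e = 4 * M * (4 * e) by ring.
    rewrite ler_wpM2l //; last lra.
    by rewrite mulr_ge0 // ltW.
apply/eqP; rewrite -cabs_eq0 eq_le cabs_ge0 andbT leNgt; apply/negP => J0.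
set J := cabs _ in key J0.
pose e := Num.min (dl / 8) (J / (32 * M)).
have e0 : 0 < e by rewrite lt_min !divr_gt0 // mulr_gt0.
have e1 : e <= dl / 8 by rewrite ge_min lexx.
have e2 : e <= J / (32 * M) by rewrite ge_min lexx orbT.
have := key e e0; move: e2; rewrite ler_pdivlMr ?mulr_gt0 // => e2 /(_ _) h.
have {}h : J <= 16 * M * e by apply: h; lra.
have E1 : 16 * M * e = e * (32 * M) / 2 by field.
lra.
Qed.

Theorem cauchy_goursat f p q a b c d : a <= b -> c <= d ->
  (forall z, inrect a b c d z -> cont_at f z) ->
  (forall z, inrect a b c d z -> z <> p -> z <> q -> derivable f z 1) ->
  rect_int f a b c d = 0.
Proof.
move=> ab cd cf df.
suff H : vanish_off set0 f a b c d.
  exact: H (lexx _) ab (lexx _) (lexx _) cd (lexx _) (fun _ _ (F : False) => F).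
apply: (vanish_off_point (p := p) cf); apply: (vanish_off_point (p := q) cf).
move=> a' b' c' d' aa ab' bb cc cd' dd hS; apply: goursat => // z hz.
apply: df; first exact: inrect_sub hz.
  by move=> zp; apply: (hS z hz); left; right.
by move=> zp; apply: (hS z hz); right.
Qed.

Definition sq_int f w h := rect_int f (complex.Re w - h) (complex.Re w + h)
  (complex.Im w - h) (complex.Im w + h).
Definition in_sq w h := inrect (complex.Re w - h) (complex.Re w + h)
  (complex.Im w - h) (complex.Im w + h).
Definition sq_edge w h := rect_edge (complex.Re w - h) (complex.Re w + h)
  (complex.Im w - h) (complex.Im w + h).

Lemma in_sqE w h z : in_sq w h z <->
  `|complex.Re (z - w : C)| <= h /\ `|complex.Im (z - w : C)| <= h.
Proof.
rewrite cReB cImB /in_sq/inrect/= !ler_norml; split.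
  move=> /andP[/andP[? ?] /andP[? ?]].
  by split; apply/andP; split; lra.
move=> [/andP[? ?] /andP[? ?]]; apply/andP; split; apply/andP; split; lra.
Qed.

Lemma sq_edge_ge w h z : 0 <= h -> sq_edge w h z -> h <= cabs (z - w : C).
Proof.
move=> h0 [_ hz].
have : h <= `|complex.Re (z - w : C)| \/ h <= `|complex.Im (z - w : C)|.
  rewrite cReB cImB.
  case/orP: hz => [/orP[/orP[/eqP->|/eqP->]|/eqP->]|/eqP->]; [left|left|right|right];
  by rewrite addrAC subrr sub0r ?normrN ler_norm ||
     by rewrite addrAC subrr add0r ler_norm.
by case=> /le_trans; apply; [exact: cabs_Re | exact: cabs_Im].
Qed.

Lemma in_sq_le w h z : in_sq w h z -> cabs (z - w : C) <= 2 * h.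
Proof.
by move=> /in_sqE[h1 h2]; apply: le_trans (cabs_le _) _; rewrite mulr_natl mulr2n lerD.
Qed.

Lemma cabs_in_sq w h z : cabs (z - w : C) <= h -> in_sq w h z.
Proof. by move=> H; apply/in_sqE; split; apply: le_trans H; [exact: cabs_Re|exact: cabs_Im]. Qed.

End Cauchy.

(** * Cauchy's formula on a square *)

Section CauchyFormula.
Variable R : realType.
Local Notation C := (Cplx R).
Implicit Types (f : C -> C) (h r : R) (z w p s : C).

(** The difference quotient of [f] at [w], completed by the value [l] at [w]. *)
Definition slope f w (l : C) : C -> C := fun z => if z == w then l else (f z - f w) / (z - w).

Lemma slope_cont f w : derivable f w 1 -> cont_at (slope f w ('D_1 f w)) w.
Proof.
move=> df e e0.
have e20 : 0 < e / 2 by rewrite divr_gt0.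
have [d d0 hd] := derive_cabsP df e20; exists d => // u ud.
rewrite /slope eqxx; case: eqVneq => [_|uw]; first by rewrite subrr cabs0.
have uw0 : u - w != 0 by rewrite subr_eq0.
have -> : (f u - f w) / (u - w) - 'D_1 f w =
   (f (w + (u - w)) - f w - 'D_1 f w * (u - w)) / (u - w).
  by rewrite addrCA subrr addr0; field.
rewrite cabsM cabsV ltr_pdivrMr ?cabs_gt0 //.
apply: le_lt_trans (hd _ ud) _; rewrite ltr_pM2r ?cabs_gt0 //; lra.
Qed.

Lemma slope_derivable f w l z : z != w -> derivable f z 1 -> derivable (slope f w l) z 1.
Proof.
move=> zw df; have zw0 : 0 < cabs (z - w) by rewrite cabs_gt0 subr_eq0.
apply: (derivable_near_eq (f := fun u => (f u - f w) * (u - w)^-1) zw0) => [u hu|].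
  rewrite /slope; case: eqVneq => // uw.
  by move: hu; rewrite uw cabs_distC ltxx.
by apply: derM; [exact: derBc|exact: derivable_invB].
Qed.

Lemma cont_at_invB w z : z != w -> cont_at (fun u : C => (u - w)^-1) z.
Proof.
move=> zw; apply: cont_atV; first by rewrite subr_eq0.
by apply: cont_atB; [exact: cont_at_id|exact: cont_at_cst].
Qed.

Lemma sq_ab w h : 0 <= h -> (complex.Re w - h <= complex.Re w + h) *
  (complex.Im w - h <= complex.Im w + h).
Proof. by move=> h0; split; lra. Qed.

(** Cauchy's theorem for the difference quotient of [f] at [s], which is continuous at
    [s].  A second exceptional point [p], where [f] is only continuous, is what the
    removable singularity theorem needs. *)
Lemma cauchy_formula f p w h s : 0 < h -> cabs (s - w) < h ->
  (forall z, in_sq w h z -> cont_at f z) ->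
  (forall z, in_sq w h z -> z <> p -> derivable f z 1) -> derivable f s 1 ->
  sq_int (fun z => f z / (z - s)) w h = f s * sq_int (fun z => (z - s)^-1) w h.
Proof.
move=> h0 sw cf df ds; have [ab cd] := sq_ab w (ltW h0).
pose k := slope f s ('D_1 f s).
have k0 : sq_int k w h = 0.
  apply: (@cauchy_goursat R k p s _ _ _ _ ab cd) => z hz.
    have [->|zs] := eqVneq z s; first exact: slope_cont.
    have zs0 : 0 < cabs (z - s) by rewrite cabs_gt0 subr_eq0.
    apply: (cont_at_eq (f := fun u => (f u - f s) * (u - s)^-1) zs0) => [u hu|].
      rewrite /k /slope; case: eqVneq => // us.
      by move: hu; rewrite us cabs_distC ltxx.
    apply: cont_atM; last exact: cont_at_invB.
    by apply: cont_atB; [exact: cf|exact: cont_at_cst].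
  by move=> zp /eqP zs; apply: slope_derivable zs (df z hz zp).
have ne z : sq_edge w h z -> z != s.
  move=> /(sq_edge_ge (ltW h0)) hz; apply: contraL sw => /eqP <-.
  by rewrite -leNgt.
have ce z : sq_edge w h z -> cont_at (fun u => (u - s)^-1) z.
  by move=> /ne; exact: cont_at_invB.
have cfe z : sq_edge w h z -> cont_at (fun u => f u / (u - s)) z.
  by move=> hz; apply: cont_atM; [apply: cf; exact: edge_inrect|exact: ce].
have E : sq_int k w h = sq_int (fun z => f z / (z - s) + (- f s) * (z - s)^-1) w h.
  apply: eq_rect_int => // z hz.
  by rewrite /k/slope (negbTE (ne _ hz)) mulrBl mulNr.
move: k0; rewrite E /sq_int rect_intD // => [|z /ce hz]; last first.
  by apply: cont_atM => //; exact: cont_at_cst.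
by rewrite rect_intZ // mulNr => /eqP; rewrite subr_eq0 => /eqP.
Qed.

Lemma cint_Im_ge a b (m : R) (g : R -> C) : a <= b -> ccont a b g ->
  (forall x, a <= x <= b -> m <= complex.Im (g x)) ->
  m * (b - a) <= complex.Im (cint a b g).
Proof.
move=> ab cg hm /=.
have <- : (\int[@lebesgue_measure R]_(x in `[a, b]) m) = m * (b - a).
  rewrite Rintegral_cst //= lebesgue_measure_itv /= lte_fin.
  by case: ltgtP ab => //= ->; rewrite subrr.
apply: le_Rintegral => //.
- apply: (@ccont_integrable_aux _ _ _ (cst m)) => x _; exact: cvg_cst.
- exact: ccont_Im.
Qed.

(** The exact value is [2 pi]; on each of the four sides the imaginary part of the
    integrand, [h / (x ^+ 2 + h ^+ 2)] up to rotation, is at least [1 / (2 h)]. *)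
Lemma winding_lb w h : 0 < h -> 4 <= complex.Im (sq_int (fun z => (z - w)^-1) w h).
Proof.
move=> h0; have [ab cd] := sq_ab w (ltW h0).
have ce z : sq_edge w h z -> cont_at (fun u => (u - w)^-1) z.
  move=> /(sq_edge_ge (ltW h0)) hz; apply: cont_at_invB; rewrite -subr_eq0 -cabs_gt0.
  exact: lt_le_trans hz.
have [c1 c2 c3 c4] := ccont_edges ab cd ce.
rewrite /sq_int /rect_int.
set w1 := complex.Re w in ab c1 c2 c3 c4 *; set w2 := complex.Im w in cd c1 c2 c3 c4 *.
set I1 := cint _ _ _; set I2 := cint _ _ _; set I3 := cint _ _ _; set I4 := cint _ _ _.
have q (x y : R) : (x +i* y : C)^-1 = (x / (x ^+ 2 + y ^+ 2)) +i* (- (y / (x ^+ 2 + y ^+ 2))) by [].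
have L (x : R) : `|x| <= h -> (2 * h)^-1 <= h / (x ^+ 2 + h ^+ 2).
  move=> hx; have x2 : x ^+ 2 <= h ^+ 2.
    by rewrite -real_normK ?num_real // ler_sqr ?nnegrE // ltW.
  have h2 : 0 < h ^+ 2 by rewrite exprn_gt0.
  have p : 0 < x ^+ 2 + h ^+ 2 by rewrite ltr_wpDl // sqr_ge0.
  rewrite ler_pdivlMr // mulrC ler_pdivrMr ?mulr_gt0 //.
  by rewrite mulrCA -expr2; lra.
have len (u : R) : (2 * h)^-1 * (u + h - (u - h)) = 1.
  have -> : u + h - (u - h) = 2 * h by ring.
  by rewrite mulVf // mulf_neq0 ?pnatr_eq0 // gt_eqF.
have B (x u : R) : u - h <= x <= u + h -> `|x - u| <= h.
  by move=> /andP[? ?]; rewrite ler_norml; apply/andP; split; lra.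
have b1 : 1 <= complex.Im I1.
  rewrite -[X in X <= _](len w1); apply: cint_Im_ge => // x /B /L /le_trans; apply.
  set X := (_ - _ : C); have -> : X = (x - w1) +i* (- h).
    by apply: complex_eq; rewrite ?cReB ?cImB /=; ring.
  by rewrite q /= sqrrN mulNr opprK.
have b3 : 1 <= complex.Im (- I3).
  rewrite -mulN1r -cintZ // -[X in X <= _](len w1); apply: cint_Im_ge => //; first exact: ccontZ.
  move=> x /B /L /le_trans; apply.
  set X := (_ - _ : C); have -> : X = (x - w1) +i* h.
    by apply: complex_eq; rewrite ?cReB ?cImB /=; ring.
  by rewrite q mulN1r /= opprK.
have b2 : 1 <= complex.Im ('i%C * I2).
  rewrite -cintZ // -[X in X <= _](len w2); apply: cint_Im_ge => //; first exact: ccontZ.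
  move=> x /B /L /le_trans; apply.
  set X := (_ - _ : C); have -> : X = h +i* (x - w2).
    by apply: complex_eq; rewrite ?cReB ?cImB /=; ring.
  rewrite q cImM /= (addrC (h ^+ 2)); lra.
have b4 : 1 <= complex.Im (- ('i%C * I4)).
  rewrite -mulNr -cintZ // -[X in X <= _](len w2); apply: cint_Im_ge => //; first exact: ccontZ.
  move=> x /B /L /le_trans; apply.
  set X := (_ - _ : C); have -> : X = (- h) +i* (x - w2).
    by apply: complex_eq; rewrite ?cReB ?cImB /=; ring.
  rewrite q cImM /= sqrrN (addrC (h ^+ 2)); lra.
rewrite !cImD; move: b1 b2 b3 b4; lra.
Qed.

Lemma winding_norm_lb w h : 0 < h -> 4 <= cabs (sq_int (fun z => (z - w)^-1) w h).
Proof.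
move=> /(winding_lb w) H; apply: le_trans H _; apply: le_trans (cabs_Im _).
exact: ler_norm.
Qed.

(** A weak maximum principle, at the centre of a square and with a constant; it serves
    all purposes of the maximum principle here. *)
Theorem cauchy_bound f w h (M : R) : 0 < h ->
  (forall z, in_sq w h z -> derivable f z 1) ->
  (forall z, sq_edge w h z -> cabs (f z) <= M) -> cabs (f w) <= 4 * M.
Proof.
move=> h0 df fM; have [ab cd] := sq_ab w (ltW h0).
have win : in_sq w h w by apply: cabs_in_sq; rewrite subrr cabs0 ltW.
have cf z : in_sq w h z -> cont_at f z.
  by move=> /df; exact: derivable_continuous.
have := @cauchy_formula f w w h w h0; rewrite subrr cabs0.
move=> /(_ h0 cf (fun z hz _ => df z hz) (df w win)) E.
have B : cabs (f w * sq_int (fun z => (z - w)^-1) w h) <= 16 * M.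
  have -> : 16 * M = 4 * (M / h) * ((complex.Re w + h - (complex.Re w - h))
                                 + (complex.Im w + h - (complex.Im w - h))).
    by field; rewrite gt_eqF.
  rewrite -E; apply: rect_int_le => // z hz.
    apply: cont_atM; first by apply: cf; exact: edge_inrect.
    apply: cont_at_invB; rewrite -subr_eq0 -cabs_gt0.
    by apply: lt_le_trans (sq_edge_ge _ hz) => //; exact: ltW.
  rewrite cabsM cabsV; apply: ler_pM; rewrite ?cabs_ge0 ?invr_ge0 ?cabs_ge0 //; first exact: fM.
  have hh := sq_edge_ge (ltW h0) hz.
  by rewrite lef_pV2 ?posrE //; apply: lt_le_trans hh.
move: B; rewrite cabsM.
have := winding_norm_lb w h0; set W := cabs (sq_int _ _ _) => W4 B.
have : cabs (f w) * 4 <= cabs (f w) * W by rewrite ler_wpM2l // cabs_ge0.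
lra.
Qed.

End CauchyFormula.

(** * Removable singularities and a uniform Taylor bound *)

Section Removable.
Variable R : realType.
Local Notation C := (Cplx R).
Implicit Types (f : C -> C) (h r : R) (z w p s : C).

(** Expand [(z - w - k)^-1] to second order in [k]: the remainder is [k ^+ 2] times a
    bounded function on the edge. *)
Lemma cauchy_transform_derivable f w h (M : R) : 0 < h ->
  (forall z, sq_edge w h z -> cont_at f z) ->
  (forall z, sq_edge w h z -> cabs (f z) <= M) ->
  derivable (fun s => sq_int (fun z => f z / (z - s)) w h) w 1.
Proof.
move=> h0 cf fM; have [ab cd] := sq_ab w (ltW h0).
have M0 : 0 <= M.
  apply: le_trans (cabs_ge0 _) (fM ((complex.Re w - h) +i* complex.Im w) _).
  split; last by rewrite eqxx.
  by apply/andP; split; apply/andP; split => /=; lra.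
apply/derivable_cabsP; exists (sq_int (fun z => f z * ((z - w)^-1 * (z - w)^-1)) w h) => e e0.
exists (Num.min (h / 2) (e * h ^+ 2 / (32 * (M + 1)))).
  by rewrite lt_min divr_gt0 //= divr_gt0 ?mulr_gt0 ?exprn_gt0 ?ltr_wpDl.
move=> k; rewrite lt_min => /andP[k1 k2].
have gw z : sq_edge w h z -> h <= cabs (z - w) by apply: sq_edge_ge; exact: ltW.
have gk z : sq_edge w h z -> h / 2 <= cabs (z - (w + k)).
  move=> /gw hz; have := cabs_lb (z - w) k; rewrite opprD addrA; lra.
have nw z : sq_edge w h z -> z != w.
  by move=> /gw hz; rewrite -subr_eq0 -cabs_gt0; lra.
have nk z : sq_edge w h z -> z != w + k.
  by move=> /gk hz; rewrite -subr_eq0 -cabs_gt0; lra.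
have c1 z : sq_edge w h z -> cont_at (fun z => f z / (z - w)) z.
  by move=> hz; apply: cont_atM; [exact: cf|apply: cont_at_invB; exact: nw].
have c2 z : sq_edge w h z -> cont_at (fun z => f z * ((z - w)^-1 * (z - w)^-1)) z.
  move=> hz; apply: cont_atM; first exact: cf.
  by apply: cont_atM; apply: cont_at_invB; exact: nw.
pose rem z := f z * ((z - w)^-1 * (z - w)^-1) * (z - (w + k))^-1.
have c3 z : sq_edge w h z -> cont_at rem z.
  by move=> hz; apply: cont_atM; [exact: c2|apply: cont_at_invB; exact: nk].
have E : sq_int (fun z => f z / (z - (w + k))) w h =
   sq_int (fun z => f z / (z - w) + (k * (f z * ((z - w)^-1 * (z - w)^-1)) + (k * k) * rem z)) w h.
  apply: eq_rect_int => // z hz; rewrite /rem.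
  have n1 : z - w != 0 by rewrite subr_eq0 nw.
  have n2 : z - w - k != 0 by rewrite -addrA -opprD subr_eq0 nk.
  have -> : z - (w + k) = z - w - k by rewrite opprD addrA.
  by field; rewrite n1 n2.
have zz z (c : C) g : cont_at g z -> cont_at (fun u : C => c * g u) z.
  by move=> cg; apply: cont_atM => //; exact: cont_at_cst.
rewrite E /sq_int rect_intD // => [|z hz]; last first.
  by apply: cont_atD; apply: zz; [exact: c2|exact: c3].
rewrite rect_intD // => [|z hz|z hz]; last 2 first.
- by apply: zz; exact: c2.
- by apply: zz; exact: c3.
rewrite !rect_intZ //; set A := rect_int _ _ _ _ _; set B := rect_int _ _ _ _ _.
set D := rect_int _ _ _ _ _.
have -> : A + (k * B + k * k * D) - A - B * k = k * k * D by ring.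
have HD : cabs D <= 4 * (M * (h^-1 * h^-1) * (h / 2)^-1) *
    ((complex.Re w + h - (complex.Re w - h)) + (complex.Im w + h - (complex.Im w - h))).
  apply: rect_int_le => // z hz; rewrite /rem !cabsM !cabsV.
  have i1 : (cabs (z - w))^-1 <= h^-1.
    by rewrite lef_pV2 ?posrE ?gw //; apply: lt_le_trans (gw _ hz).
  have i2 : (cabs (z - (w + k)))^-1 <= (h / 2)^-1.
    by rewrite lef_pV2 ?posrE ?gk ?divr_gt0 //; apply: lt_le_trans (gk _ hz); rewrite divr_gt0.
  apply: ler_pM => //; rewrite ?mulr_ge0 ?invr_ge0 ?cabs_ge0 //.
  apply: ler_pM; rewrite ?mulr_ge0 ?invr_ge0 ?cabs_ge0 //; first exact: fM.
  by apply: ler_pM; rewrite ?invr_ge0 ?cabs_ge0.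
have {}HD : cabs D <= 32 * M / h ^+ 2.
  apply: le_trans HD _; rewrite le_eqVlt; apply/orP; left; apply/eqP; field.
  by rewrite gt_eqF.
rewrite !cabsM -mulrA (mulrC (cabs k)) ler_wpM2r ?cabs_ge0 // mulrC.
apply: le_trans (ler_wpM2r (cabs_ge0 _) HD) _ => /=.
have h2 : 0 < h ^+ 2 by rewrite exprn_gt0.
rewrite mulrAC ler_pdivrMr //.
have M1 : 0 < 32 * (M + 1) by rewrite mulr_gt0 // ltr_wpDl.
move: k2; rewrite ltr_pdivlMr // => k2; apply: le_trans (ltW k2).
rewrite mulrC ler_wpM2l ?cabs_ge0 //; lra.
Qed.

Lemma cont_zero_at f w r : 0 < r -> cont_at f w ->
  (forall z, z != w -> cabs (z - w) < r -> f z = 0) -> f w = 0.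
Proof.
move=> r0 cf fz; apply/eqP; rewrite -cabs_eq0 eq_le cabs_ge0 andbT.
rewrite leNgt; apply/negP => h; have [d d0 hd] := cf _ h.
pose t := Num.min (d / 2) (r / 2).
have t0 : 0 < t by rewrite lt_min !divr_gt0.
have [t1 t2] : t <= d / 2 /\ t <= r / 2 by rewrite /t !ge_min !lexx orbT.
have E : w + t%:C - w = t%:C by rewrite addrAC subrr add0r.
have := hd (w + t%:C); rewrite fz ?E ?cabs_real ?gtr0_norm //; last 2 first.
- by rewrite -subr_eq0 E -cabs_gt0 cabs_real gtr0_norm.
- lra.
by rewrite sub0r cabsN ltxx => /(_ _) H; have : false by apply: H; lra.
Qed.

(** Near [w], the function [f] is the quotient of the Cauchy transforms of [f] and of 1
    over one fixed square, both differentiable at [w]; the second does not vanish. *)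
Theorem removable f w r : 0 < r -> cont_at f w ->
  (forall z, z != w -> cabs (z - w) < r -> derivable f z 1) -> derivable f w 1.
Proof.
move=> r0 cfw df.
have [d d0 hd] := cfw 1 ltr01.
(* A square on which [f] is bounded, by continuity at [w]. *)
pose h := Num.min (d / 4) (r / 4).
have h0 : 0 < h by rewrite lt_min !divr_gt0.
have [hd4 hr4] : h <= d / 4 /\ h <= r / 4 by rewrite /h !ge_min !lexx orbT.
have insq z : in_sq w h z -> cabs (z - w) <= 2 * h by exact: in_sq_le.
have cf z : in_sq w h z -> cont_at f z.
  move=> /insq hz; have [->//|zw] := eqVneq z w.
  by apply/derivable_continuous/df => //; lra.
have dfs z : in_sq w h z -> z <> w -> derivable f z 1.
  by move=> /insq hz /eqP zw; apply: df => //; lra.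
have fM z : sq_edge w h z -> cabs (f z) <= cabs (f w) + 1.
  move=> /edge_inrect/insq hz; have := hd z; have := cabs_lb (f z) (f w); lra.
have cfe z : sq_edge w h z -> cont_at f z.
  by move=> /edge_inrect; exact: cf.
pose W s := sq_int (fun z => 1 / (z - s)) w h.
pose P s := sq_int (fun z => f z / (z - s)) w h.
have dP : derivable P w 1 by exact: cauchy_transform_derivable fM.
have dW : derivable W w 1.
  apply: (@cauchy_transform_derivable (fun=> 1) w h 1) => // z _.
    exact: cont_at_cst.
  by rewrite cabs1.
have W1 s : W s = sq_int (fun z => (z - s)^-1) w h.
  rewrite /W; have -> // : (fun z : C => 1 / (z - s)) = (fun z => (z - s)^-1).
  by apply/funext => z; exact: mul1r.
have W0 : W w != 0.
  rewrite -cabs_gt0 W1; apply: lt_le_trans (winding_norm_lb w h0); lra.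
have CF s : s != w -> cabs (s - w) < h -> P s = f s * W s.
  move=> sw hs; have hs' : cabs (s - w) < r by lra.
  by rewrite W1; exact: (@cauchy_formula R f w w h s h0 hs cf dfs (df s sw hs')).
(* At [w] itself the formula only holds by continuity. *)
have CFw : P w = f w * W w.
  apply/eqP; rewrite -subr_eq0; apply/eqP.
  apply: (@cont_zero_at (fun s => P s - f s * W s) w h) => //.
    apply: cont_atB; first exact: derivable_continuous.
    by apply: cont_atM => //; exact: derivable_continuous.
  by move=> z zw hz; rewrite CF // subrr.
have cW := derivable_continuous dW.
have Wp : 0 < cabs (W w) by rewrite cabs_gt0.
have [d1 d10 hd1] := cW _ Wp.
have m0 : 0 < Num.min d1 h by rewrite lt_min d10.
apply: (derivable_near_eq (f := fun s => P s * (W s)^-1) m0) => [u|]; last first.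
  exact: (derM dP (derV W0 dW)).
rewrite lt_min => /andP[u1 u2].
have Wu : W u != 0.
  apply/negP => /eqP E; have := hd1 u u1; rewrite E sub0r cabsN ltxx //.
have [->|uw] := eqVneq u w; first by rewrite CFw mulfK.
by rewrite CF // mulfK.
Qed.

(** At [w] itself this is the derivative. *)
Definition dquot f w := slope f w ('D_1 f w).

Lemma dquot_derivable f w z r : 0 < r ->
  (forall u, cabs (u - w) < r -> derivable f u 1) -> derivable f z 1 ->
  derivable (dquot f w) z 1.
Proof.
move=> r0 df dz; have [->|zw] := eqVneq z w; last exact: slope_derivable.
apply: (removable r0); first by apply/slope_cont/df; rewrite subrr cabs0.
by move=> u uw hu; exact: (slope_derivable uw (df u hu)).
Qed.

(** Away from [w] the quotient is trivially bounded; near [w] apply [cauchy_bound] on a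
    square whose edge stays away from [w]. *)
Lemma dquot_bound f w r (M : R) : 0 < r ->
  (forall u, cabs (u - w) <= r -> derivable f u 1) ->
  (forall u, cabs (u - w) <= r -> cabs (f u) <= M) ->
  forall u, cabs (u - w) <= r -> cabs (dquot f w u) <= 96 * M / r.
Proof.
move=> r0 df fM.
have fw : cabs (f w) <= M by apply: fM; rewrite subrr cabs0 ltW.
have M0 : 0 <= M by apply: le_trans fw; exact: cabs_ge0.
have B (e : R) u : 0 < e -> e <= cabs (u - w) <= r -> cabs (dquot f w u) <= 2 * M / e.
  move=> e0 /andP[h1 h2]; have := fM u h2 => fu.
  have uw : u != w by rewrite -subr_eq0 -cabs_gt0; exact: lt_le_trans h1.
  rewrite /dquot/slope (negbTE uw) cabsM cabsV.
  apply: ler_pM; rewrite ?cabs_ge0 ?invr_ge0 ?cabs_ge0 //.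
    by apply: le_trans (cabsB _ _) _; lra.
  by rewrite lef_pV2 ?posrE //; apply: lt_le_trans h1.
move=> u hu; have [hs|hs] := lerP (cabs (u - w)) (r / 4); last first.
  apply: le_trans (B (r / 4) u _ _) _; rewrite ?divr_gt0 //.
    by rewrite (ltW hs) hu.
  rewrite invf_div mulrA ler_wpM2r ?invr_ge0 ?(ltW r0) //; lra.
have h0 : 0 < r / 3 by rewrite divr_gt0.
have tri z : cabs (z - w) <= cabs (z - u) + cabs (u - w).
  by rewrite -[z - w](subrKA u) cabsD.
have -> : 96 * M / r = 4 * (2 * M / (r / 12)) by field; rewrite gt_eqF.
apply: (cauchy_bound h0) => z hz.
  have hzr : cabs (z - w) <= r.
    by apply: le_trans (tri z) _; have := in_sq_le hz; lra.
  exact: (dquot_derivable r0 (fun v hv => df v (ltW hv)) (df z hzr)).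
apply: B; first by rewrite divr_gt0.
have := in_sq_le (edge_inrect hz); have := sq_edge_ge (ltW h0) hz.
have := tri z; have := cabs_lb (z - u) (w - u).
rewrite opprB addrA subrK [cabs (w - u)]cabs_distC => t1 t2 t3 t4.
by apply/andP; split; lra.
Qed.

Lemma dquotE f w u : f u = f w + (u - w) * dquot f w u.
Proof.
rewrite /dquot/slope; case: eqVneq => [->|uw]; first by rewrite subrr mul0r addr0.
by rewrite mulrCA mulfV ?subr_eq0 // mulr1 addrC subrK.
Qed.

(** Two successive difference quotients; that the constants depend on [f] through [M]
    only is what makes it possible to differentiate series term by term. *)
Theorem taylor_bound f w r (M : R) : 0 < r ->
  (forall u, cabs (u - w) <= r -> derivable f u 1) ->
  (forall u, cabs (u - w) <= r -> cabs (f u) <= M) ->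
  cabs ('D_1 f w) <= 96 * M / r /\
  forall k : C, cabs k <= r ->
    cabs (f (w + k) - f w - 'D_1 f w * k) <= 96 * (96 * M / r) / r * cabs k ^+ 2.
Proof.
move=> r0 df fM; have B := dquot_bound r0 df fM.
have qw : dquot f w w = 'D_1 f w by rewrite /dquot/slope eqxx.
have Bw : cabs ('D_1 f w) <= 96 * M / r.
  by rewrite -qw; apply: B; rewrite subrr cabs0 ltW.
split=> // k hk.
have dq u : cabs (u - w) <= r -> derivable (dquot f w) u 1.
  by move=> hu; exact: (dquot_derivable r0 (fun v hv => df v (ltW hv)) (df u hu)).
have B2 := dquot_bound r0 dq B.
have E : w + k - w = k by rewrite addrAC subrr add0r.
have -> : f (w + k) - f w - 'D_1 f w * k = k * k * dquot (dquot f w) w (w + k).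
  by rewrite [f (w + k)](dquotE f w) [dquot f w (w + k)](dquotE _ w) qw E; ring.
by rewrite !cabsM -expr2 mulrC ler_wpM2r ?sqr_ge0 //; apply: B2; rewrite E.
Qed.

End Removable.

(** * Complex series and Weierstrass' theorem *)

Section Conj.
Variable R : realType.
Local Notation C := (Cplx R).
Implicit Types (z w : C).
Lemma cJD z w : (z + w : C)^*%C = (z^*%C : C) + (w^*%C : C) :> C.
Proof. exact: (rmorphD (@conjc R)). Qed.
Lemma cJB z w : (z - w : C)^*%C = (z^*%C : C) - (w^*%C : C) :> C.
Proof. exact: (rmorphB (@conjc R)). Qed.
Lemma cJM z w : (z * w : C)^*%C = (z^*%C : C) * (w^*%C : C) :> C.
Proof. exact: (rmorphM (@conjc R)). Qed.
Lemma cJV z : (z^-1 : C)^*%C = (z^*%C : C)^-1 :> C. Proof. exact: conjc_inv. Qed.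
Lemma cJK z : (z^*%C)^*%C = z. Proof. exact: conjcK. Qed.
Lemma cJ_eq0 z : (z^*%C == 0 :> C) = (z == 0). Proof. exact: conjc_eq0. Qed.
End Conj.

Section Csum.
Variable R : realType.
Local Notation C := (Cplx R).
Implicit Types (u v : nat -> C) (B e r : R).

(** Weights with telescoping sums, used as a universal yardstick for absolute
    convergence. *)
Definition tele (n : nat) : R := (n.+1%:R * n.+2%:R)^-1.

Lemma tele_gt0 n : 0 < tele n.
Proof. by rewrite invr_gt0 mulr_gt0 ?ltr0n. Qed.

Lemma tele_ge0 n : 0 <= tele n. Proof. exact: ltW (tele_gt0 n). Qed.

Lemma sum_tele n : \sum_(i < n) tele i = 1 - n.+1%:R^-1.
Proof.
elim: n => [|n IH]; first by rewrite big_ord0 invr1 subrr.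
rewrite big_ord_recr /= IH /tele.
have n1 : n.+1%:R != 0 :> R by rewrite pnatr_eq0.
have n2 : n.+2%:R != 0 :> R by rewrite pnatr_eq0.
have -> : n.+2%:R = n.+1%:R + 1 :> R by rewrite [in LHS]mulrSr.
rewrite [n.+2%:R]mulrSr in n2.
move: (n.+1%:R : R) n1 n2 => a a0 a1.
by field; rewrite a0 a1.
Qed.

Lemma sum_tele_le1 n : \sum_(i < n) tele i <= 1.
Proof. by rewrite sum_tele gerBl invr_ge0 ler0n. Qed.

Lemma tele_le1 n : tele n <= 1.
Proof.
rewrite invf_le1 ?mulr_gt0 ?ltr0n // -natrM ler1n //.
Qed.

Definition tele_summable u := exists B, forall n, cabs (u n) <= B * tele n.

(** Taken componentwise; the limits exist for a [tele_summable] sequence. *)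
Definition csum u : C :=
  (limn (series (fun n => complex.Re (u n)))) +i*
  (limn (series (fun n => complex.Im (u n)))).

Lemma cvg_series_tele (x : nat -> R) B : (forall n, `|x n| <= B * tele n) -> cvgn (series x).
Proof.
move=> hx; apply: normed_cvg.
have B0 : 0 <= B.
  have := le_trans (normr_ge0 _) (hx 0%N); rewrite pmulr_lge0 ?tele_gt0 //.
apply: nondecreasing_is_cvgn.
  apply/nondecreasing_seqP => n.
  rewrite [X in _ <= X](_ : _ = series (fun k => `|x k|) n + `|x n|) ?lerDl //.
  exact: (seriesSr (fun k => `|x k|)).
exists B => _ [n _ <-]; rewrite -[leLHS]/(series (fun k => `|x k|) n) /series /= big_mkord.
apply: le_trans (_ : \sum_(i < n) B * tele i <= _); first by apply: ler_sum => i _; exact: hx.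
by rewrite -mulr_sumr ler_piMr // sum_tele_le1.
Qed.

Lemma Re_sum n u : complex.Re (\sum_(i < n) u i) = \sum_(i < n) complex.Re (u i).
Proof. by elim: n => [|n IH]; rewrite ?big_ord0 // !big_ord_recr /= cReD IH. Qed.
Lemma Im_sum n u : complex.Im (\sum_(i < n) u i) = \sum_(i < n) complex.Im (u i).
Proof. by elim: n => [|n IH]; rewrite ?big_ord0 // !big_ord_recr /= cImD IH. Qed.

Lemma cabs_sum n u : cabs (\sum_(i < n) u i) <= \sum_(i < n) cabs (u i).
Proof.
elim: n => [|n IH]; first by rewrite !big_ord0 cabs0.
by rewrite !big_ord_recr /=; apply: le_trans (cabsD _ _) _; rewrite lerD2r.
Qed.

Lemma csum_cvg u : tele_summable u -> forall e, 0 < e ->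
  exists N, forall n, (N <= n)%N -> cabs (\sum_(i < n) u i - csum u) <= e.
Proof.
move=> [B hB] e e0.
have cR : cvgn (series (fun n => complex.Re (u n))).
  by apply: (@cvg_series_tele _ B) => n; apply: le_trans (hB n); exact: cabs_Re.
have cI : cvgn (series (fun n => complex.Im (u n))).
  by apply: (@cvg_series_tele _ B) => n; apply: le_trans (hB n); exact: cabs_Im.
have e20 : 0 < e / 2 by rewrite divr_gt0.
have /cvgrPdist_le/(_ _ e20)[N1 _ h1] := cR.
have /cvgrPdist_le/(_ _ e20)[N2 _ h2] := cI.
exists (maxn N1 N2) => n; rewrite geq_max => /andP[n1 n2].
apply: le_trans (cabs_le _) _; rewrite cReB cImB Re_sum Im_sum.
have := h1 n n1; have := h2 n n2; rewrite /series /= !big_mkord.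
rewrite [`|limn _ - _|]distrC => H1; rewrite distrC => H2.
by rewrite [leRHS](splitr e) lerD.
Qed.

(** Every estimate on a series is obtained from one on its late partial sums. *)
Lemma csum_dist u (L : C) B N : tele_summable u ->
  (forall n, (N <= n)%N -> cabs (\sum_(i < n) u i - L) <= B) ->
  cabs (csum u - L) <= B.
Proof.
move=> su h; apply/ler_addgt0Pr => e e0; have [N1 h1] := csum_cvg su e0.
pose n := maxn N N1.
have k2 := h n (leq_maxl _ _); have := h1 n (leq_maxr _ _).
rewrite [X in X <= _]cabs_distC => k1; 
have -> : csum u - L = (csum u - \sum_(i < n) u i) + (\sum_(i < n) u i - L) :> C.
  by ring.
by apply: le_trans (cabsD _ _) _; rewrite addrC lerD.
Qed.

Lemma csum_unique u (L : C) : tele_summable u ->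
  (forall e, 0 < e -> exists N, forall n, (N <= n)%N -> cabs (\sum_(i < n) u i - L) <= e) ->
  csum u = L.
Proof.
move=> su h; apply/eqP; rewrite -subr_eq0 -cabs_eq0 eq_le cabs_ge0 andbT.
apply/ler_addgt0Pr => e e0; rewrite add0r; have [N hN] := h e e0.
exact: csum_dist hN.
Qed.

Lemma csum_le u B : (forall n, cabs (u n) <= B * tele n) -> cabs (csum u) <= B.
Proof.
move=> hB; rewrite -[csum u]subr0; apply: (csum_dist (N := 0%N)); first by exists B.
move=> n _; rewrite subr0; apply: le_trans (cabs_sum _ _) _.
have B0 : 0 <= B.
  have := le_trans (cabs_ge0 _) (hB 0%N); rewrite pmulr_lge0 ?tele_gt0 //.
apply: le_trans (_ : \sum_(i < n) B * tele i <= _); first by apply: ler_sum => i _; exact: hB.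
by rewrite -mulr_sumr ler_piMr // sum_tele_le1.
Qed.

Lemma tele_summableD u v (k : C) : tele_summable u -> tele_summable v ->
  tele_summable (fun n => k * u n + v n).
Proof.
move=> [B hB] [B' hB']; exists (cabs k * B + B') => n.
apply: le_trans (cabsD _ _) _; rewrite mulrDl lerD // cabsM -mulrA.
by rewrite ler_wpM2l ?cabs_ge0.
Qed.

Lemma csum_lin u v (k : C) : tele_summable u -> tele_summable v ->
  csum (fun n => k * u n + v n) = k * csum u + csum v.
Proof.
move=> su sv; apply: csum_unique => [|e e0]; first exact: tele_summableD.
have k0 : 0 < cabs k + 1 by rewrite ltr_wpDl // cabs_ge0.
have e20 : 0 < e / 2 by rewrite divr_gt0.
have [N1 h1] := csum_cvg su (divr_gt0 e20 k0); have [N2 h2] := csum_cvg sv e20.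
exists (maxn N1 N2) => n; rewrite geq_max => /andP[n1 n2].
have -> : \sum_(i < n) (k * u i + v i) - (k * csum u + csum v) =
   k * (\sum_(i < n) u i - csum u) + (\sum_(i < n) v i - csum v).
  by rewrite big_split /= -mulr_sumr; ring.
apply: le_trans (cabsD _ _) _; rewrite [leRHS](splitr e) lerD ?h2 //.
rewrite cabsM; apply: le_trans (_ : (cabs k + 1) * cabs (\sum_(i < n) u i - csum u) <= _).
  by rewrite ler_wpM2r ?cabs_ge0 // lerDl.
by rewrite mulrC -ler_pdivlMr // h1.
Qed.

Lemma tele_summable0 : tele_summable (fun=> 0).
Proof. by exists 0 => n; rewrite cabs0 mul0r. Qed.

Lemma csum0 : csum (fun=> 0) = 0.
Proof.
apply: csum_unique => [|e e0]; first exact: tele_summable0.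
by exists 0%N => n _; rewrite big1 // subr0 cabs0 ltW.
Qed.

Lemma csumZ u (k : C) : tele_summable u -> csum (fun n => k * u n) = k * csum u.
Proof.
move=> su; have := csum_lin k su tele_summable0; rewrite csum0 addr0 => <-.
by congr csum; apply/funext => n; rewrite addr0.
Qed.

Lemma conj_sum n u : (\sum_(i < n) u i : C)^*%C = \sum_(i < n) ((u i)^*%C : C) :> C.
Proof.
elim: n => [|n IH]; first by rewrite !big_ord0 conjc0.
by rewrite !big_ord_recr cJD; congr (_ + _); exact: IH.
Qed.

Lemma tele_summableJ u : tele_summable u -> tele_summable (fun n => (u n)^*%C).
Proof. by move=> [B hB]; exists B => n; rewrite cabsJ. Qed.

Lemma csumJ u : tele_summable u -> csum (fun n => (u n)^*%C) = (csum u)^*%C.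
Proof.
move=> su; apply: csum_unique => [|e e0]; first exact: tele_summableJ.
have [N hN] := csum_cvg su e0; exists N => n /hN.
by rewrite -(conj_sum n u) -cJB cabsJ.
Qed.

Lemma csum_split u N : tele_summable u -> tele_summable (fun n => u (N + n)%N) ->
  csum u = \sum_(i < N) u i + csum (fun n => u (N + n)%N).
Proof.
move=> su sv; apply: csum_unique => // e e0; have [N1 h1] := csum_cvg sv e0.
exists (N + N1)%N => n hn; have /subnKC E : (N <= n)%N by apply: leq_trans hn; exact: leq_addr.
rewrite -E big_split_ord /= opprD addrACA subrr add0r; apply: h1.
by rewrite -(leq_add2l N) E.
Qed.

Lemma tele_summable_eventually u N B :
  (forall n, (N <= n)%N -> cabs (u n) <= B * tele n) -> tele_summable u.
Proof.
move=> hB; exists (`|B| + \sum_(i < N) (cabs (u i) / tele i)) => n.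
have S0 k : 0 <= \sum_(i < k) (cabs (u i) / tele i).
  by apply: sumr_ge0 => i _; rewrite divr_ge0 ?cabs_ge0 ?tele_ge0.
case: (leqP N n) => hn.
  apply: le_trans (hB n hn) _; rewrite ler_wpM2r ?tele_ge0 //.
  by apply: le_trans (ler_norm _) _; rewrite lerDl.
rewrite -ler_pdivrMr ?tele_gt0 //.
apply: le_trans (_ : \sum_(i < N) (cabs (u i) / tele i) <= _); last by rewrite lerDr.
rewrite (bigD1 (Ordinal hn)) //= lerDl; apply: sumr_ge0 => i _.
by rewrite divr_ge0 ?cabs_ge0 ?tele_ge0.
Qed.

(** By [taylor_bound] the first-order remainder of the term number [n] is at most a
    constant times [tele n * |k| ^ 2], so these remainders add up to [O (|k| ^ 2)]. *)
Theorem weierstrass (f : nat -> C -> C) (z : C) r B : 0 < r ->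
  (forall n (v : C), cabs (v - z) <= r -> derivable (f n) v 1) ->
  (forall n (v : C), cabs (v - z) <= r -> cabs (f n v) <= B * tele n) ->
  derivable (fun v : C => csum (fun n => f n v)) z 1.
Proof.
move=> r0 df fB.
have T n := taylor_bound r0 (df n) (fB n).
have B0 : 0 <= B.
  have := le_trans (cabs_ge0 _) (fB 0%N z _); rewrite subrr cabs0 => /(_ (ltW r0)).
  by rewrite pmulr_lge0 ?tele_gt0.
have sz (v : C) : cabs (v - z) <= r -> tele_summable (fun n => f n v).
  by move=> hv; exists B => n; exact: fB.
have sD : tele_summable (fun n => 'D_1 (f n) z).
  by exists (96 * B / r) => n; have [h _] := T n; apply: le_trans h _; rewrite mulrA mulrAC.
pose K := 96 * (96 * B / r) / r.
have K0 : 0 <= K by rewrite /K !(divr_ge0, mulr_ge0) // ltW.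
apply/derivable_cabsP; exists (csum (fun n => 'D_1 (f n) z)) => e e0.
exists (Num.min r (e / (K + 1))); first by rewrite lt_min r0 divr_gt0 // ltr_wpDl.
move=> k; rewrite lt_min => /andP[kr ke].
have zk : cabs (z + k - z) <= r by rewrite addrAC subrr add0r ltW.
have zz : cabs (z - z) <= r by rewrite subrr cabs0 ltW.
have E : csum (fun n => f n (z + k)) - csum (fun n => f n z) - csum (fun n => 'D_1 (f n) z) * k =
   csum (fun n => f n (z + k) - f n z - 'D_1 (f n) z * k).
  have S1 := tele_summableD (-1) (sz _ zz) (sz _ zk).

  transitivity (csum (fun n => - k * 'D_1 (f n) z + (-1 * f n z + f n (z + k)))).
    by rewrite (csum_lin (- k) sD S1) (csum_lin _ (sz _ zz) (sz _ zk)); ring.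
  by congr csum; apply/funext => n; ring.
rewrite E; apply: le_trans (csum_le (B := K * cabs k ^+ 2) _) _.
  move=> n; have [_ /(_ k (ltW kr)) h] := T n; apply: le_trans h _.
  by rewrite le_eqVlt /K; apply/orP; left; apply/eqP; field; rewrite gt_eqF.
rewrite expr2 mulrA ler_wpM2r ?cabs_ge0 //.
apply: le_trans (_ : (K + 1) * cabs k <= _); first by rewrite ler_wpM2r ?cabs_ge0 // lerDl.
by rewrite mulrC -ler_pdivlMr ?ltr_wpDl // ltW.
Qed.

End Csum.

(** * Integrals of Lorentzians *)

Section Lorentz.
Variable R : realType.
Local Notation mu := (@lebesgue_measure R).
Implicit Types (u c x : R).

(** The integral of a nonnegative function is a supremum over the simple functions
    below it, so monotonicity holds without measurability. *)
Lemma ge0_integral_mono (f g : R -> \bar R) :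
  (forall x, (0 <= f x)%E) -> (forall x, (f x <= g x)%E) ->
  (\int[mu]_x f x <= \int[mu]_x g x)%E.
Proof.
move=> f0 fg; have g0 x : (0 <= g x)%E by apply: le_trans (fg x).
rewrite !ge0_integralTE //; apply: le_ereal_sup => _ [h /= hf <-].
by exists h => // x; exact: le_trans (hf x) (fg x).
Qed.

Lemma oneDsqrV_ge0 x : 0 <= (oneDsqr x)^-1.
Proof. by rewrite invr_ge0 (le_trans ler01) // oneDsqr_ge1. Qed.

Lemma integralT_oneDsqr : (\int[mu]_x ((oneDsqr x)^-1)%:E = (pi : R)%:E)%E.
Proof.
rewrite (ge0_symfun_integralT (f := fun x => (oneDsqr x)^-1)) //=.
- have -> : [set x : R | 0 <= x] = `[0, +oo[%classic.
    by apply/seteqP; split => x /=; rewrite in_itv /= andbT.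
  by rewrite integral0y_oneDsqr -EFinM mulrCA mulfV ?mulr1.
- exact: continuous_oneDsqrV.
- by move=> x /=; rewrite /oneDsqr sqrrN.
Qed.

Lemma integral_lorentz u c : 0 < c ->
  (\int[mu]_x (((x - u) ^+ 2 + c ^+ 2)^-1)%:E = (pi / c)%:E)%E.
Proof.
move=> c0; pose F x := (x - u) / c.
have dF x : derivable F x 1.
  apply: derivableM; last exact: derivable_cst.
  by apply: derivableB; [exact: derivable_id|exact: derivable_cst].
have F' : derive1 F = cst c^-1.
  apply/funext => x; rewrite derive1Mr; last first.
    by apply: derivableB; [exact: derivable_id|exact: derivable_cst].
  by rewrite derive1E deriveB ?derive_id ?derive_cst ?subr0 ?mul1r.
have G0 x : 0 <= c^-1 * (oneDsqr x)^-1.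
  by rewrite mulr_ge0 ?oneDsqrV_ge0 // invr_ge0 ltW.
have cG : continuous (fun x : R => c^-1 * (oneDsqr x)^-1).
  by move=> x; apply: cvgM; [exact: cvg_cst|exact: continuous_oneDsqrV].
have H := @increasing_ge0_integration_by_substitutionT R F (fun x => c^-1 * (oneDsqr x)^-1).
transitivity (\int[mu]_x (c^-1 * (oneDsqr x)^-1)%:E)%E; last first.
  under eq_integral do rewrite EFinM.
  rewrite ge0_integralZl_EFin //=.
  - by rewrite integralT_oneDsqr -EFinM mulrC.
  - by apply/measurable_EFinP; apply: continuous_measurable_fun; exact: continuous_oneDsqrV.
  - by rewrite invr_ge0 ltW.
have h1 : {homo F : x y / x < y}.
  by move=> x y xy; rewrite /F ltr_pM2r ?invr_gt0 // ltrD2r.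
have h2 : continuous (derive1 F) by rewrite F' => x; exact: cvg_cst.
have h3 : cvg (derive1 F x @[x --> -oo]) by rewrite F'; exact: is_cvg_cst.
have h4 : cvg (derive1 F x @[x --> +oo]) by rewrite F'; exact: is_cvg_cst.
have h5 : F x @[x --> -oo] --> -oo.
  apply/cvgrNyPle => A; near=> x.
  rewrite /F ler_pdivrMr // lerBlDr; near: x; apply: nbhs_ninfty_le; exact: num_real.
have h6 : F x @[x --> +oo] --> +oo.
  apply/cvgryPge => A; near=> x.
  rewrite /F ler_pdivlMr // lerBrDr; near: x; apply: nbhs_pinfty_ge; exact: num_real.
rewrite (H h1 h2 h3 h4 dF h5 h6 cG G0).
apply: eq_integral => x _; rewrite F'; congr EFin; rewrite !fctE /= /oneDsqr /F.
have -> : (x - u) ^+ 2 + c ^+ 2 = c * c * (1 + ((x - u) / c) ^+ 2).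
  by field; rewrite gt_eqF.
by rewrite !invfM; ring.
Unshelve. all: by end_near.
Qed.

End Lorentz.

(** * A square-integrable majorant for lacunary sums *)

Section L2.
Variable R : realType.
Local Notation C := (Cplx R).
Local Notation mu := (@lebesgue_measure R).

Lemma sqrD_le (a b : R) : (a + b) ^+ 2 <= 2 * a ^+ 2 + 2 * b ^+ 2.
Proof. have := sqr_ge0 (a - b); rewrite sqrrB !sqrrD; lra. Qed.

(** A substitute for the Cauchy-Schwarz inequality with weights [2 ^- i], by iterating
    [(a + b) ^+ 2 <= 2 * a ^+ 2 + 2 * b ^+ 2]. *)
Lemma sq_sum_le (x : nat -> R) N :
  (\sum_(i < N) x i) ^+ 2 <= \sum_(i < N) 2 ^+ i.+1 * x i ^+ 2.
Proof.
elim: N x => [|N IH] x; first by rewrite !big_ord0 expr0n.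
rewrite !big_ord_recl /=; apply: le_trans (sqrD_le _ _) _.
rewrite expr1 lerD2l; apply: le_trans (ler_wpM2l _ (IH (fun i => x i.+1))) _ => //.
by rewrite mulr_sumr; apply: ler_sum => i _; rewrite mulrA -exprS.
Qed.

(** An index that is alone in satisfying [P] need not pay the exponential weight. *)
Lemma sq_sum_exc (P : nat -> bool) (x : nat -> R) N :
  (forall i j, P i -> P j -> i = j) ->
  (\sum_(i < N) x i) ^+ 2 <=
  \sum_(i < N) (if P i then 2 * x i ^+ 2 else 2 ^+ i.+2 * x i ^+ 2).
Proof.
move=> uP.
pose x' i := if P i then 0 else x i; pose x1 i := if P i then x i else 0.
have -> : \sum_(i < N) x i = \sum_(i < N) x1 i + \sum_(i < N) x' i.
  rewrite -big_split /=; apply: eq_bigr => i _; rewrite /x1 /x'.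
  by case: ifP; rewrite ?addr0 ?add0r.
have H1 : (\sum_(i < N) x1 i) ^+ 2 <= \sum_(i < N) x1 i ^+ 2.
  have [[i0 Pi0]|nP] := pselect (exists i : 'I_N, P i).
    rewrite (bigD1 i0) //= big1 => [|i ni]; last first.
      by rewrite /x1; case: ifP => // Pi; case/eqP: ni; apply/val_inj/uP.
    by rewrite addr0 (bigD1 i0) //= lerDl sumr_ge0 // => i _; exact: sqr_ge0.
  rewrite big1 ?expr0n ?sumr_ge0 // => [i _|i _]; first exact: sqr_ge0.
  by rewrite /x1; case: ifP => // Pi; case: nP; exists i.
apply: le_trans (sqrD_le _ _) _.
apply: le_trans (lerD (ler_wpM2l _ H1) (ler_wpM2l _ (sq_sum_le x' N))) _ => //.
rewrite !mulr_sumr -big_split /=; apply: ler_sum => i _.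
rewrite /x1 /x'; case: ifP => _; first by rewrite expr0n /= !mulr0 addr0.
by rewrite expr0n mulr0 add0r mulrA -exprS.
Qed.

Variables (w : nat -> C) (delta : R).
Hypothesis delta0 : 0 < delta.
Hypothesis w_im : forall n, delta <= complex.Im (w n).
Hypothesis w_lac : forall n, 2 * cabs (w n) <= cabs (w n.+1).
Hypothesis w_big : forall n, 2 ^+ (n + 7) <= tele R n * cabs (w n).

(** The first summand accounts for points [z] near [conj (w n)], the second one, whose
    integral is tiny since [|w n|] is huge, for all other points. *)
Definition lorentz_term n (x : R) : R :=
  16 * tele R n * ((x - complex.Re (w n)) ^+ 2 + delta ^+ 2)^-1 +
  2 ^+ (n + 5) * ((x - complex.Re (w n)) ^+ 2 + (cabs (w n) / 4) ^+ 2)^-1.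

Lemma w_pos n : 0 < cabs (w n).
Proof. have := le_trans (w_im n) (le_trans (ler_norm _) (cabs_Im (w n))); exact: lt_le_trans. Qed.

Lemma lorentz_term_ge0 n x : 0 <= lorentz_term n x.
Proof.
rewrite /lorentz_term addr_ge0 // mulr_ge0 ?exprn_ge0 ?invr_ge0 ?addr_ge0 ?sqr_ge0 //.
by rewrite mulr_ge0 ?tele_ge0.
Qed.

Lemma w_lac_lt m n : (m < n)%N -> 2 * cabs (w m) <= cabs (w n).
Proof.
elim: n => // n IH; rewrite ltnS leq_eqVlt => /predU1P[->|/IH h]; first exact: w_lac.
by apply: le_trans (w_lac n); apply: le_trans h _; have := w_pos n; lra.
Qed.

(** The discs of radius [|w n| / 4] around the [conj (w n)] are disjoint by
    lacunarity. *)
Lemma near_unique (z : C) i j : cabs (z - (w i)^*%C) < cabs (w i) / 4 ->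
  cabs (z - (w j)^*%C) < cabs (w j) / 4 -> i = j.
Proof.
have H m n : (m < n)%N -> cabs (z - (w m)^*%C) < cabs (w m) / 4 ->
  cabs (z - (w n)^*%C) < cabs (w n) / 4 -> False.
  move=> /w_lac_lt h h1 h2.
  have E : (w n)^*%C - (w m)^*%C = (z - (w m)^*%C) - (z - (w n)^*%C) :> C by ring.
  have := cabs_lb ((w n)^*%C) ((w m)^*%C); rewrite E !cabsJ.
  have := cabsB (z - (w m)^*%C) (z - (w n)^*%C).
  have := w_pos m; move: h h1 h2; lra.
by move=> h1 h2; case: (ltngtP i j) => // /H; [move=> /(_ h1 h2)|move=> /(_ h2 h1)].
Qed.

Lemma far_sq (x : R) (D L : R) : 0 < L -> L <= D -> x ^+ 2 <= D ^+ 2 ->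
  (D^-1) ^+ 2 <= 2 * (x ^+ 2 + L ^+ 2)^-1.
Proof.
move=> L0 LD xD; have D0 := lt_le_trans L0 LD.
have LD2 : L ^+ 2 <= D ^+ 2 by rewrite ler_sqr ?nnegrE // ltW.
have D2 : 0 < D ^+ 2 by rewrite exprn_gt0.
have p : 0 < x ^+ 2 + L ^+ 2 by rewrite ltr_wpDl ?sqr_ge0 // exprn_gt0.
rewrite exprVn -[2](invrK) -invfM lef_pV2 ?posrE ?mulr_gt0 ?invr_gt0 //; lra.
Qed.

(** Almost orthogonality in a pointwise form: at any [z] at most one of the terms is
    near, and all far terms can afford an exponential weight. *)
Lemma weighted_sum_sq (M : R) (c : nat -> R) (z : C) N : 0 <= complex.Im z ->
  (forall n, 0 <= c n <= 2 * M / n.+1%:R) ->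
  (\sum_(i < N) c i * (cabs (z - (w i)^*%C))^-1) ^+ 2 <=
  M ^+ 2 * \sum_(i < N) lorentz_term i (complex.Re z).
Proof.
move=> z0 hc.
have M0 : 0 <= M by have /andP[h1 h2] := hc 0%N; move: (le_trans h1 h2); rewrite divr1; lra.
pose P i := cabs (z - (w i)^*%C) < cabs (w i) / 4.
have uP i j : P i -> P j -> i = j by exact: near_unique.
apply: le_trans (@sq_sum_exc P (fun i => c i * (cabs (z - (w i)^*%C))^-1) N uP) _.
rewrite mulr_sumr; apply: ler_sum => i _.
have /andP[c0 c1] := hc i.
have tw0 := tele_ge0 R i.
have DE : cabs (z - (w i)^*%C) ^+ 2 =
  (complex.Re z - complex.Re (w i)) ^+ 2 + (complex.Im z + complex.Im (w i)) ^+ 2.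
  by rewrite cabs_sqr cReB cImB cReJ cImJ opprK.
have vz : delta ^+ 2 <= (complex.Im z + complex.Im (w i)) ^+ 2.
  by have d0 := delta0; rewrite ler_sqr ?nnegrE; have := w_im i; lra.
have d2 : 0 < delta ^+ 2 by rewrite exprn_gt0.
have := w_pos i => wp.
case: ifP => [Pi|/negbT]; last first.
  rewrite -leNgt => far; rewrite /lorentz_term mulrDr; apply: ler_wpDl.
    by rewrite !mulr_ge0 ?sqr_ge0 ?invr_ge0 ?addr_ge0 ?sqr_ge0.
  have L0 : 0 < cabs (w i) / 4 by rewrite divr_gt0.
  have := far_sq (x := complex.Re z - complex.Re (w i)) L0 far.
  rewrite DE lerDl sqr_ge0 => /(_ isT) F.
  have cM : c i <= 2 * M.
    apply: le_trans c1 _; rewrite ler_pdivrMr ?ltr0n // ler_peMr ?mulr_ge0 //.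
    by rewrite ler1n.
  have c2 : c i ^+ 2 <= 4 * M ^+ 2.
    have -> : 4 * M ^+ 2 = (2 * M) ^+ 2 by ring.
    by rewrite ler_sqr ?nnegrE ?mulr_ge0.
  rewrite exprMn.
  have -> : 2 ^+ (i + 5) = 2 ^+ i.+2 * 8 :> R.
    by rewrite -[i.+2]addn2 !exprD -!mulrA; congr (_ * _); ring.
  have Q := ler_pM (sqr_ge0 _) (sqr_ge0 _) c2 F.
  have p2 : 0 <= 2 ^+ i.+2 :> R by rewrite exprn_ge0.
  apply: le_trans (ler_wpM2l p2 Q) _; rewrite le_eqVlt; apply/orP; left; apply/eqP; ring.
rewrite /lorentz_term mulrDr; apply: ler_wpDr.
  by rewrite !mulr_ge0 ?sqr_ge0 ?exprn_ge0 ?invr_ge0 ?addr_ge0 ?sqr_ge0.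
have c2 : c i ^+ 2 <= 8 * M ^+ 2 * tele R i.
  apply: le_trans (_ : (2 * M / i.+1%:R) ^+ 2 <= _).
    by rewrite ler_sqr ?nnegrE // (le_trans c0).
  rewrite /tele expr_div_n exprMn.
  have a0 : (0 : R) < i.+1%:R by rewrite ltr0n.
  have a1 : (1 : R) <= i.+1%:R by rewrite ler1n.
  have -> : i.+2%:R = i.+1%:R + 1 :> R by rewrite [in LHS]mulrSr.
  move: (i.+1%:R : R) a0 a1 => a a0 a1.
  rewrite ler_pdivrMr ?exprn_gt0 //.
  have b0 : 0 < a * (a + 1) by rewrite mulr_gt0 // addr_gt0.
  have -> : 8 * M ^+ 2 / (a * (a + 1)) * a ^+ 2 = M ^+ 2 * (8 * a / (a + 1)).
    by field; apply/andP; split; rewrite gt_eqF // addr_gt0.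
  have -> : 2 ^+ 2 * M ^+ 2 = M ^+ 2 * 4 by ring.
  rewrite ler_wpM2l ?sqr_ge0 // ler_pdivlMr ?addr_gt0 //; lra.
have g2 : ((cabs (z - (w i)^*%C))^-1) ^+ 2 <=
    ((complex.Re z - complex.Re (w i)) ^+ 2 + delta ^+ 2)^-1.
  have p : 0 < (complex.Re z - complex.Re (w i)) ^+ 2 + delta ^+ 2 by rewrite ltr_wpDl ?sqr_ge0.
  rewrite exprVn DE lef_pV2 ?posrE ?lerD2l //.
  by apply: lt_le_trans p _; rewrite lerD2l.
rewrite exprMn; have Q := ler_pM (sqr_ge0 _) (sqr_ge0 _) c2 g2.
apply: le_trans (ler_wpM2l _ Q) _ => //.
rewrite le_eqVlt; apply/orP; left; apply/eqP; ring.
Qed.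

Definition lorentz_sum (x : R) : \bar R := (\sum_(0 <= n <oo) (lorentz_term n x)%:E)%E.

Lemma lorentz_sum_ge x N : ((\sum_(i < N) lorentz_term i x)%:E <= lorentz_sum x)%E.
Proof.
rewrite -sumEFin -(big_mkord xpredT (fun i => (lorentz_term i x)%:E)).
by apply: nneseries_lim_ge => n _ _; rewrite lee_fin lorentz_term_ge0.
Qed.

Lemma lorentz_sum_ge0 x : (0 <= lorentz_sum x)%E.
Proof. by apply: nneseries_ge0 => n _ _; rewrite lee_fin lorentz_term_ge0. Qed.

Lemma lorentz_measurable u (k : R) : 0 < k ->
  measurable_fun setT (fun x : R => ((x - u) ^+ 2 + k ^+ 2)^-1).
Proof.
move=> k0; apply: continuous_measurable_fun => x; apply: cvgV.
  by rewrite gt_eqF // ltr_wpDl ?sqr_ge0 // exprn_gt0.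
apply: cvgD; last exact: cvg_cst.
by apply: cvgM; apply: cvgB; (exact: cvg_id || exact: cvg_cst).
Qed.

Lemma lorentz_ge0 u (k x : R) : 0 <= ((x - u) ^+ 2 + k ^+ 2)^-1.
Proof. by rewrite invr_ge0 addr_ge0 ?sqr_ge0. Qed.

Lemma integral_lorentz2 u (a b k l : R) : 0 <= a -> 0 <= b -> 0 < k -> 0 < l ->
  (\int[mu]_x (a * ((x - u) ^+ 2 + k ^+ 2)^-1 + b * ((x - u) ^+ 2 + l ^+ 2)^-1)%:E
   = (a * (pi / k) + b * (pi / l))%:E)%E.
Proof.
move=> a0 b0 k0 l0.
have mZ (c m : R) : 0 < m -> measurable_fun setT (fun x : R => (c * ((x - u) ^+ 2 + m ^+ 2)^-1)%:E).
  move=> m0; apply/measurable_EFinP; apply: measurable_funM => //; exact: lorentz_measurable.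
have I (c m : R) : 0 <= c -> 0 < m ->
    (\int[mu]_x (c * ((x - u) ^+ 2 + m ^+ 2)^-1)%:E = (c * (pi / m))%:E)%E.
  move=> c0 m0; rewrite EFinM -(integral_lorentz u m0) -ge0_integralZl_EFin //.
  - by move=> x _; rewrite lee_fin lorentz_ge0.
  - by apply/measurable_EFinP; exact: lorentz_measurable.
rewrite EFinD -!I // -ge0_integralD //.
- by move=> x _; rewrite lee_fin mulr_ge0 ?lorentz_ge0.
- exact: mZ.
- by move=> x _; rewrite lee_fin mulr_ge0 ?lorentz_ge0.
- exact: mZ.
Qed.

Lemma nneseries_tele_le (a : R) : 0 <= a ->
  (\sum_(0 <= n <oo) (a * tele R n)%:E <= a%:E)%E.
Proof.
move=> a0; apply: lime_le.
  by apply: is_cvg_nneseries => n _ _; rewrite lee_fin mulr_ge0 ?tele_ge0.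
near=> n; rewrite big_mkord sumEFin lee_fin -mulr_sumr ler_piMr // sum_tele_le1.
Unshelve. all: by end_near.
Qed.

Lemma integral_lorentz_sum : (\int[mu]_x lorentz_sum x <= ((pi : R) * (16 / delta + 1))%:E)%E.
Proof.
have L0 n : 0 < cabs (w n) / 4 by rewrite divr_gt0 // w_pos.
have mr n : measurable_fun setT (fun x => (lorentz_term n x)%:E).
  apply/measurable_EFinP; apply: measurable_funD; apply: measurable_funM => //;
    exact: lorentz_measurable.
rewrite integral_nneseries //; last by move=> n x _; rewrite lee_fin lorentz_term_ge0.
have pi0 : 0 <= (pi : R) by exact: pi_ge0.
apply: le_trans (_ : (\sum_(0 <= n <oo) ((pi * (16 / delta + 1)) * tele R n)%:E <= _)%E);
  last first.
  by apply: nneseries_tele_le; rewrite mulr_ge0 // addr_ge0 // divr_ge0 // ltW.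
apply: lee_nneseries => n _ //.
  by move=> _; apply: integral_ge0 => x _; rewrite lee_fin lorentz_term_ge0.
have t0 := tele_ge0 R n.
rewrite /lorentz_term integral_lorentz2 ?mulr_ge0 ?exprn_ge0 // lee_fin.
have wp := w_pos n.
have E1 : 16 * tele R n * (pi / delta) = pi * (16 / delta) * tele R n by ring.
have E2 : 2 ^+ (n + 5) * (pi / (cabs (w n) / 4)) = pi * (2 ^+ (n + 7) / cabs (w n)).
  have -> : 2 ^+ (n + 7) = 2 ^+ (n + 5) * 4 :> R by rewrite !exprD -mulrA; congr (_ * _); ring.
  by field; rewrite gt_eqF.
rewrite E1 E2 mulrDr mulr1 mulrDl lerD2l ler_wpM2l //.
by rewrite ler_pdivrMr // w_big.
Qed.

End L2.

(** * Reproducing kernels of a de Branges space *)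

Section Kernels.
Variable R : realType.
Local Notation C := (Cplx R).
Implicit Types (F : C -> C) (z u : C).

Lemma sharp_derivable F z : derivable F (z^*%C) 1 -> derivable (sharp F) z 1.
Proof.
move=> /derivable_cabsP[l hl]; apply/derivable_cabsP; exists (l^*%C) => e e0.
have [d d0 hd] := hl e e0; exists d => // h hh.
have := hd (h^*%C); rewrite cabsJ => /(_ hh).
by rewrite -[X in X <= _ -> _]cabsJ /sharp !cJB cJM cJK cJD.
Qed.

Lemma sharp_entire F : entire F -> entire (sharp F).
Proof. by move=> hF z _; apply: sharp_derivable; exact: hF. Qed.

Lemma entire_derivable F z : entire F -> derivable F z 1.
Proof. by move=> h; exact: h. Qed.

Variable (E : C -> C).
Hypothesis hE : hermite_biehler E.
Let Theta z : C := sharp E z / E z.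

Lemma HB_neq0 z : 0 < complex.Im z -> E z != 0.
Proof.
move=> hz; rewrite -cabs_gt0; apply: le_lt_trans (hE.2 z hz); exact: cabs_ge0.
Qed.

Lemma sharp_HB_le z : 0 <= complex.Im z -> cabs (sharp E z) <= cabs (E z).
Proof.
rewrite /sharp cabsJ le_eqVlt => /predU1P[z0|/hE.2 /ltW //].
by have -> : z^*%C = z by apply: complex_eq; rewrite ?cReJ ?cImJ -?z0 ?oppr0.
Qed.

Lemma Theta_le1 z : 0 <= complex.Im z -> cabs (Theta z) <= 1.
Proof.
move=> hz; rewrite cabsM cabsV.
have [->|E0] := eqVneq (E z) 0; first by rewrite cabs0 invr0 mulr0.
by rewrite ler_pdivrMr ?cabs_gt0 // mul1r sharp_HB_le.
Qed.

(** Up to the constant factor [conj (E w) * i / (2 * pi)] this is the reproducing kernel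
    of the de Branges space at [w]. *)
Definition rkern (w : C) : C -> C :=
  dquot (fun z => E z - (Theta w)^*%C * sharp E z) (w^*%C).

Variable w : C.
Hypothesis w0 : 0 < complex.Im w.

Lemma rkern_num_derivable z : derivable (fun z => E z - (Theta w)^*%C * sharp E z) z 1.
Proof.
apply: derB; first exact: (entire_derivable hE.1).
apply: derM; first exact: derivable_cst.
exact: (entire_derivable (sharp_entire hE.1)).
Qed.

Lemma rkern_entire : entire (rkern w).
Proof.
move=> z _; apply: (dquot_derivable ltr01) => [u _|]; exact: rkern_num_derivable.
Qed.

(** This is why the kernel is entire: its numerator vanishes at [conj w]. *)
Lemma rkern_num0 : E (w^*%C) - (Theta w)^*%C * sharp E (w^*%C) = 0.
Proof.
have Ew : (E w)^*%C != 0 by rewrite cJ_eq0 HB_neq0.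
rewrite /Theta /sharp cJK cJM cJK cJV mulfVK ?subrr //.
Qed.

Lemma rkern_off z : z != w^*%C ->
  rkern w z = (E z - (Theta w)^*%C * sharp E z) / (z - w^*%C).
Proof. by move=> zw; rewrite /rkern/dquot/slope (negbTE zw) rkern_num0 subr0. Qed.

Lemma upper_neq_conj z : 0 <= complex.Im z -> z != w^*%C.
Proof. by move=> hz; apply/eqP => zw; move: hz w0; rewrite zw cImJ; lra. Qed.

Lemma rkern_le z : 0 <= complex.Im z ->
  cabs (rkern w z) <= 2 * cabs (E z) / cabs (z - w^*%C).
Proof.
move=> hz; rewrite rkern_off ?upper_neq_conj // cabsM cabsV ler_wpM2r ?invr_ge0 ?cabs_ge0 //.
apply: le_trans (cabsB _ _) _; rewrite mulr_natl mulr2n lerD2l cabsM cabsJ.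
rewrite -[leRHS]mul1r; apply: ler_pM; rewrite ?cabs_ge0 //; last exact: sharp_HB_le.
by apply: Theta_le1; exact: ltW.
Qed.

(** With [E] divided out, this is the difference quotient of [Theta] at [w]. *)
Lemma sharp_rkern_off z : z != w ->
  sharp (rkern w) z = (sharp E z - Theta w * E z) / (z - w).
Proof.
move=> zw; rewrite /sharp rkern_off; last first.
  by apply/eqP => /(congr1 (@conjc R)); rewrite !cJK; exact/eqP.
by rewrite cJM cJV !cJB cJM /sharp !cJK.
Qed.

Lemma sharp_rkern_le_far z : 0 <= complex.Im z -> z != w ->
  cabs (sharp (rkern w) z) <= 2 * cabs (E z) / cabs (z - w).
Proof.
move=> hz zw; rewrite sharp_rkern_off // cabsM cabsV ler_wpM2r ?invr_ge0 ?cabs_ge0 //.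
apply: le_trans (cabsB _ _) _; rewrite mulr_natl mulr2n; apply: lerD; first exact: sharp_HB_le.
rewrite cabsM -[leRHS]mul1r; apply: ler_pM; rewrite ?cabs_ge0 //.
by apply: Theta_le1; exact: ltW.
Qed.

Lemma conj_dist z : cabs (z - w^*%C) <= cabs (z - w) + 2 * complex.Im w.
Proof.
have -> : z - w^*%C = (z - w) + (w - w^*%C) :> C by ring.
apply: le_trans (cabsD _ _) _; rewrite lerD2l.
have -> : w - w^*%C = 0 +i* (2 * complex.Im w).
  by apply: complex_eq; rewrite ?cReB ?cImB ?cReJ ?cImJ /=; ring.
by rewrite cabs_imag ger0_norm // mulr_ge0 // ltW.
Qed.

(** The bound [sharp_rkern_le_far] is useless near [w], where [cauchy_bound] on a square
    of half side [Im w / 4] replaces it.  (Schwarz and Pick would give the constant 2.) *)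
Lemma sharp_rkern_le z : 0 < complex.Im z ->
  cabs (sharp (rkern w) z) <= 192 * cabs (E z) / cabs (z - w^*%C).
Proof.
move=> hz; have Ez : 0 < cabs (E z) by rewrite cabs_gt0 HB_neq0.
have zc : 0 < cabs (z - w^*%C) by rewrite cabs_gt0 subr_eq0 upper_neq_conj // ltW.
have wp := w0; pose v := complex.Im w.
have cd := conj_dist z.
have [far|near] := lerP (v / 8) (cabs (z - w)).
  have zw0 : 0 < cabs (z - w) by apply: lt_le_trans far; rewrite divr_gt0.
  have zw : z != w by rewrite -subr_eq0 -cabs_gt0.
  apply: le_trans (sharp_rkern_le_far (ltW hz) zw) _.
  rewrite ler_pdivlMr // mulrAC ler_pdivrMr //.
  have -> : 192 * cabs (E z) * cabs (z - w) = cabs (E z) * (192 * cabs (z - w)) by ring.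
  have -> : 2 * cabs (E z) * cabs (z - w^*%C) = cabs (E z) * (2 * cabs (z - w^*%C)) by ring.
  rewrite ler_wpM2l ?cabs_ge0 //; move: far; rewrite /v => far; lra.
(* The square of half side [v / 4] around [z] stays in the upper half-plane, and its
   edge at distance [v / 8] from [w]. *)
have h0 : 0 < v / 4 by rewrite divr_gt0.
have imu u : in_sq z (v / 4) u -> 0 < complex.Im u.
  move=> /in_sqE[_]; rewrite cImB => h.
  have := cabs_Im (z - w); rewrite cImB => k.
  have := ler_norm (complex.Im w - complex.Im z); rewrite distrC => k2.
  have := ler_norm (complex.Im z - complex.Im u); rewrite distrC => k3.
  move: near h; rewrite /v => near h; lra.
pose Q u := sharp (rkern w) u * (E u)^-1.
have QB : cabs (Q z) <= 4 * (16 / v).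
  apply: (cauchy_bound h0) => u hu.
    apply: derM; first exact: (entire_derivable (sharp_entire rkern_entire)).
    by apply: derV; [exact: HB_neq0 (imu _ hu)|exact: (entire_derivable hE.1)].
  have ui := imu _ (edge_inrect hu).
  have uz := sq_edge_ge (ltW h0) hu.
  have uw : v / 8 <= cabs (u - w).
    have -> : u - w = (u - z) - (w - z) :> C by ring.
    have := cabs_lb (u - z) (w - z); rewrite [cabs (w - z)]cabs_distC.
    move: near uz; rewrite /v => near uz; lra.
  have v8 : 0 < v / 8 by rewrite divr_gt0.
  have uw0 := lt_le_trans v8 uw.
  have uw1 : u != w by rewrite -subr_eq0 -cabs_gt0.
  have Eu : 0 < cabs (E u) by rewrite cabs_gt0 HB_neq0.
  rewrite cabsM cabsV ler_pdivrMr //.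
  apply: le_trans (sharp_rkern_le_far (ltW ui) uw1) _.
  rewrite mulrAC ler_wpM2r ?cabs_ge0 // ler_pdivrMr // mulrAC ler_pdivlMr //.
  by move: uw; lra.
have -> : sharp (rkern w) z = Q z * E z by rewrite /Q mulfVK // HB_neq0.
rewrite cabsM [192 * _]mulrC -mulrA mulrC ler_wpM2l ?cabs_ge0 //.
apply: le_trans QB _.
rewrite ler_pdivlMr // mulrA mulrAC ler_pdivrMr //; move: near cd; rewrite /v; lra.
Qed.

End Kernels.

(** * Coefficients with tent-shaped partial sums *)

Section Tent.
Variable R : realType.
Local Notation C := (Cplx R).

(** On the dyadic block from [2 ^ k] to [2 ^ k.+1] the tent rises from 0 to [1 / 2] and
    falls back to 0, with slopes [2 ^- k]. *)
Definition tent (n : nat) : R :=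
  (minn (n - 2 ^ trunc_log 2 n) (2 ^ (trunc_log 2 n).+1 - n))%:R
    / (2 ^ trunc_log 2 n)%:R.

(** The prescribed partial sums.  The tent over the block number 0 vanishes, so the
    truncated predecessor is harmless and block [k.+1] carries [a k]. *)
Definition tent_sum (a : nat -> C) n : C := a (trunc_log 2 n).-1 * (tent n)%:C.
Definition tent_coef (a : nat -> C) n : C := tent_sum a n.+1 - tent_sum a n.

Lemma tent0 : tent 0 = 0.
Proof. by rewrite /tent sub0n min0n mul0r. Qed.

Lemma trunc_log2P n : (0 < n)%N -> (2 ^ trunc_log 2 n <= n < 2 ^ (trunc_log 2 n).+1)%N.
Proof. exact: trunc_log_bounds. Qed.

Lemma tent_bd n : 0 <= tent n <= 1.
Proof.
have p : (0 : R) < (2 ^ trunc_log 2 n)%:R by rewrite ltr0n expn_gt0.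
rewrite /tent divr_ge0 ?ler0n //= ler_pdivrMr // mul1r ler_nat.
have [->|n0] := posnP n; first by rewrite sub0n min0n.
have /andP[h1 h2] := trunc_log2P n0; apply: leq_trans (geq_minl _ _) _.
by rewrite leq_subLR addnn -mul2n -expnS ltnW.
Qed.

Lemma tent_peak k : trunc_log 2 (3 * 2 ^ k) = k.+1 /\ tent (3 * 2 ^ k) = 1 / 2.
Proof.
have E : trunc_log 2 (3 * 2 ^ k) = k.+1.
  apply: trunc_log_eq => //; rewrite !expnS.
  by rewrite leq_pmul2r ?expn_gt0 //= mulnA ltn_pmul2r ?expn_gt0.
split=> //; rewrite /tent E.
have -> : (3 * 2 ^ k - 2 ^ k.+1 = 2 ^ k)%N by rewrite expnS -mulnBl mul1n.
have -> : (2 ^ k.+2 - 3 * 2 ^ k = 2 ^ k)%N by rewrite !expnS mulnA -mulnBl mul1n.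
rewrite minnn expnS natrM.
have p : (2 ^ k)%:R != 0 :> R by rewrite pnatr_eq0 -lt0n expn_gt0.
by field.
Qed.

Lemma tent_sum_peak a k : tent_sum a (3 * 2 ^ k) = a k * (1 / 2)%:C.
Proof. by rewrite /tent_sum; have [-> ->] := tent_peak k. Qed.

Lemma tent_sum0 a : tent_sum a 0 = 0.
Proof. by rewrite /tent_sum tent0 mulr0. Qed.

Lemma sum_tent_coef a n : \sum_(i < n) tent_coef a i = tent_sum a n.
Proof.
elim: n => [|n IH]; first by rewrite big_ord0 tent_sum0.
by rewrite big_ord_recr /= IH /tent_coef addrC subrK.
Qed.

Lemma tent_sum_lin (k : C) a a' n :
  tent_sum (fun j => k * a j + a' j) n = k * tent_sum a n + tent_sum a' n.
Proof. by rewrite /tent_sum; ring. Qed.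

Lemma tent_coef_lin (k : C) a a' n :
  tent_coef (fun j => k * a j + a' j) n = k * tent_coef a n + tent_coef a' n.
Proof. by rewrite /tent_coef !tent_sum_lin; ring. Qed.

Lemma tent_sum_le a (M : R) n : (forall j, cabs (a j) <= M) -> cabs (tent_sum a n) <= M.
Proof.
move=> aM; have /andP[t0 t1] := tent_bd n.
have M0 := le_trans (cabs_ge0 _) (aM 0%N).
rewrite cabsM cabs_real ger0_norm // -[leRHS]mulr1.
by apply: ler_pM; rewrite ?cabs_ge0.
Qed.

Lemma trunc_log2S n : (0 < n)%N -> trunc_log 2 n.+1 = trunc_log 2 n \/
  (trunc_log 2 n.+1 = (trunc_log 2 n).+1 /\ n.+1 = 2 ^ (trunc_log 2 n).+1)%N.
Proof.
move=> n0; have /andP[h1 h2] := trunc_log2P n0.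
move: h2; rewrite leq_eqVlt => /predU1P[E|lt].
  by right; split => //; rewrite E trunc_expnK.
by left; apply: trunc_log_eq => //; rewrite lt andbT (leq_trans h1).
Qed.

(** Within a block the tent has slope [2 ^- k], and it vanishes where blocks meet. *)
Lemma tent_coef_le a (M : R) n : (forall j, cabs (a j) <= M) ->
  cabs (tent_coef a n) <= 2 * M / n.+1%:R.
Proof.
move=> aM; have M0 := le_trans (cabs_ge0 _) (aM 0%N).
have [->|n0] := posnP n.
  have -> : tent_coef a 0 = 0.
    by rewrite /tent_coef tent_sum0 subr0 /tent_sum /tent trunc_log1 subnn min0n mul0r mulr0.
  by rewrite cabs0 divr_ge0 ?mulr_ge0.
have /andP[h1 h2] := trunc_log2P n0.
set K := trunc_log 2 n in h1 h2.
have p : (0 : R) < (2 ^ K)%:R by rewrite ltr0n expn_gt0.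
have B : M / (2 ^ K)%:R <= 2 * M / n.+1%:R.
  rewrite ler_pdivrMr // mulrAC ler_pdivlMr ?ltr0n //.
  rewrite -mulrA mulrCA ler_wpM2l // -natrM ler_nat -expnS //.
(* The numerators of consecutive tent values differ by at most 1. *)
have N1 (x y : nat) : (x <= y.+1)%N -> (y <= x.+1)%N -> `|x%:R - y%:R : R| <= 1.
  move=> xy yx; rewrite ler_norml; apply/andP; split.
    by move: yx; rewrite -(ler_nat R) -natr1; lra.
  by move: xy; rewrite -(ler_nat R) -natr1; lra.
apply: le_trans B.
case: (trunc_log2S n0) => [E|[E1 E2]].
  rewrite /tent_coef /tent_sum E -/K -mulrBr.
  have rB (x y : R) : (x - y)%:C = x%:C - y%:C :> C by rewrite -rmorphB.
  rewrite cabsM -rB cabs_real.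
  apply: ler_pM; rewrite ?cabs_ge0 // /tent E -/K -mulrBl normrM normfV.
  rewrite [`|(2 ^ K)%:R|]gtr0_norm //; apply: ler_piMl; first by rewrite invr_ge0 ltW.
  move: h1 h2; clear -N1; move: (2 ^ K)%N (2 ^ K.+1)%N => A B h1 h2.
  by apply: N1; rewrite /minn; do 2 case: ifP; move=> ? ?; lia.
have T0 : tent n.+1 = 0.
  by rewrite /tent E1 -/K -E2 subnn min0n mul0r.
rewrite /tent_coef /tent_sum T0 mulr0 sub0r cabsN cabsM cabs_real.
have /andP[t0 t1] := tent_bd n; rewrite ger0_norm //.
apply: ler_pM; rewrite ?cabs_ge0 // /tent -/K ler_pdivrMr // mulVf ?gt_eqF //.
by rewrite -[leRHS]/(1%:R) ler_nat; apply: leq_trans (geq_minr _ _) _; rewrite -E2 subSnn.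
Qed.

End Tent.

(** * Kernels on the imaginary axis *)

Section Axis.
Variable R : realType.
Local Notation C := (Cplx R).
Variable (E : C -> C).
Hypothesis hE : hermite_biehler E.
Let Theta z : C := sharp E z / E z.
Variables (w : C) (y : R).
Hypothesis w0 : 0 < complex.Im w.
Hypothesis y1 : 1 <= y.

Let z : C := 0 +i* y.
Let zi : C := 0 +i* y + (0 +i* 1).

Lemma cabs_zi : cabs zi = y + 1.
Proof.
have -> : zi = 0 +i* (y + 1) by apply: complex_eq; rewrite ?cReD ?cImD /= ?addr0.
by rewrite cabs_imag ger0_norm // addr_ge0 // (le_trans ler01).
Qed.

Lemma axis_dist_conj : y <= cabs (z - w^*%C) /\ cabs w <= cabs (z - w^*%C).
Proof.
have hy := y1; have hw := w0.
split.
  apply: le_trans (cabs_Im _); rewrite cImB cImJ opprK /=.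
  by apply: le_trans (ler_norm _); rewrite lerDl ltW.
rewrite !cabsE ler_wsqrtr // cReB cImB cReJ cImJ opprK /= sub0r sqrrN lerD2l.
rewrite ler_sqr ?nnegrE; lra.
Qed.

Lemma axis_dist : cabs w <= y / 2 -> y / 2 <= cabs (z - w).
Proof.
move=> h; have := cabs_lb z w.
rewrite [cabs z]cabs_imag ger0_norm; last by have := y1; lra.
move: h; lra.
Qed.

Lemma axis_E : E z != 0.
Proof. by apply: (HB_neq0 hE) => /=; have := y1; lra. Qed.

Definition rkern_axis : C := zi * rkern E w z / E z.
Definition sharp_rkern_axis : C := zi * sharp (rkern E w) z / E z.

Lemma axis_ratio (D : R) : y / 2 <= D -> (y + 1) / D <= 4.
Proof. have hy := y1 => hD; rewrite ler_pdivrMr; lra. Qed.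

Lemma rkern_axis_le : cabs rkern_axis <= 2 * ((y + 1) / cabs (z - w^*%C)).
Proof.
have hz : 0 <= complex.Im z by have := y1 => /=; lra.
have E0 : 0 < cabs (E z) by rewrite cabs_gt0 axis_E.
rewrite /rkern_axis !cabsM cabsV cabs_zi ler_pdivrMr //.
have y0 : 0 <= y + 1 by have := y1; lra.
apply: le_trans (ler_wpM2l y0 (rkern_le hE w0 hz)) _.
rewrite le_eqVlt; apply/orP; left; apply/eqP; ring.
Qed.

Lemma sharp_rkern_axis_le : cabs sharp_rkern_axis <= 192 * ((y + 1) / cabs (z - w^*%C)).
Proof.
have hz : 0 < complex.Im z by have := y1 => /=; lra.
have E0 : 0 < cabs (E z) by rewrite cabs_gt0 axis_E.
rewrite /sharp_rkern_axis !cabsM cabsV cabs_zi ler_pdivrMr //.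
have y0 : 0 <= y + 1 by have := y1; lra.
apply: le_trans (ler_wpM2l y0 (sharp_rkern_le hE w0 hz)) _.
rewrite le_eqVlt; apply/orP; left; apply/eqP; ring.
Qed.

Lemma ratio_any : (y + 1) / cabs (z - w^*%C) <= 4.
Proof. apply: axis_ratio; have [h _] := axis_dist_conj; have := y1; lra. Qed.

Lemma ratio_above e : y + 1 <= e * cabs w -> (y + 1) / cabs (z - w^*%C) <= e.
Proof.
move=> h; have [d1 d2] := axis_dist_conj; have hy := y1.
have D0 : 0 < cabs (z - w^*%C) by lra.
have w00 : 0 < cabs w.
  have hw := w0; apply: lt_le_trans hw _; apply: le_trans (cabs_Im _); exact: ler_norm.
have : 0 < e * cabs w by apply: lt_le_trans h; lra.
rewrite pmulr_lgt0 // => /ltW e0.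
by rewrite ler_pdivrMr //; apply: le_trans h _; rewrite ler_wpM2l.
Qed.

Lemma Theta_axis_le1 : cabs (Theta z) <= 1.
Proof. by apply: (Theta_le1 hE) => /=; have := y1; lra. Qed.

(** Far above [w] the normalized kernel is 1 up to [|w| / y] and [|Theta w|]. *)
Lemma rkern_axis_below e : 1 + cabs w <= e * y -> cabs (Theta w) <= e ->
  cabs (rkern_axis - 1) <= 3 * e.
Proof.
move=> h1 h2; have [d1 d2] := axis_dist_conj; have hy := y1.
have hz : 0 <= complex.Im z by rewrite /=; lra.
have zw := upper_neq_conj w0 hz.
have zw0 : z - w^*%C != 0 by rewrite subr_eq0.
have E0 := axis_E.
have -> : rkern_axis - 1 = ((0 +i* 1) + w^*%C) / (z - w^*%C) -
     ((Theta w)^*%C * Theta z) * (zi / (z - w^*%C)).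
  rewrite /rkern_axis rkern_off // {1}/Theta /zi -/z.
  rewrite -[(sharp E w / E w)^*%C]/((Theta w)^*%C) /Theta.
  have Ew : (E w)^*%C != 0 by rewrite cJ_eq0 (HB_neq0 hE w0).
  by field; apply/and3P; split; [exact: zw0|exact: E0|exact: Ew].
have D0 : 0 < cabs (z - w^*%C) by lra.
have e0 : 0 <= e.
  have : 0 < e * y by have := cabs_ge0 w; lra.
  by rewrite pmulr_lgt0 => [/ltW//|]; lra.
have -> : 3 * e = e + 2 * e by ring.
apply: le_trans (cabsB _ _) _; apply: lerD.
  rewrite cabsM cabsV ler_pdivrMr //.
  apply: le_trans (cabsD _ _) _; rewrite cabs_imag normr1 cabsJ.
  by apply: le_trans h1 _; rewrite ler_wpM2l.
rewrite cabsM [cabs (_ * Theta z)]cabsM [cabs (zi / _)]cabsM cabsV cabs_zi cabsJ mulrC.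
apply: ler_pM.
- by rewrite mulr_ge0 ?invr_ge0 ?cabs_ge0 //; lra.
- by rewrite mulr_ge0 ?cabs_ge0.
- by rewrite ler_pdivrMr //; lra.
- rewrite -[leRHS]mulr1; apply: ler_pM; rewrite ?cabs_ge0 //; exact: Theta_axis_le1.
Qed.

Lemma sharp_rkern_axis_below e : e <= 1 / 2 -> 1 + cabs w <= e * y -> cabs (Theta w) <= e ->
  cabs (sharp_rkern_axis - Theta z) <= 6 * e.
Proof.
move=> e2 h1 h2; have hy := y1.
have d1 : y / 2 <= cabs (z - w).
  apply: axis_dist; have := cabs_ge0 w.
  have : e * y <= 1 / 2 * y by rewrite ler_wpM2r //; lra.
  move: h1; lra.
have D0 : 0 < cabs (z - w) by lra.
have zw : z != w by rewrite -subr_eq0 -cabs_gt0.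
have zw0 : z - w != 0 by rewrite subr_eq0.
have E0 := axis_E.
have -> : sharp_rkern_axis - Theta z = Theta z * (((0 +i* 1) + w) / (z - w)) -
     Theta w * (zi / (z - w)).
  rewrite /sharp_rkern_axis (sharp_rkern_off hE w0) // /zi -/z.
  rewrite -[(sharp E w / E w)]/(Theta w) /Theta.
  have Ew : E w != 0 by exact: (HB_neq0 hE w0).
  by field; apply/and3P; split.
have e0 : 0 <= e.
  have : 0 < e * y by have := cabs_ge0 w; lra.
  by rewrite pmulr_lgt0 => [/ltW//|]; lra.
have -> : 6 * e = 2 * e + e * 4 by ring.
apply: le_trans (cabsB _ _) _; apply: lerD.
  rewrite cabsM [cabs ((_ + w) / _)]cabsM cabsV -[leRHS]mul1r; apply: ler_pM; rewrite ?cabs_ge0 //.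
  - by rewrite mulr_ge0 ?invr_ge0 ?cabs_ge0.
  - exact: Theta_axis_le1.
  rewrite ler_pdivrMr //; apply: le_trans (cabsD _ _) _; rewrite cabs_imag normr1.
  apply: le_trans h1 _; have : e * (y / 2) <= e * cabs (z - w) by rewrite ler_wpM2l.
  lra.
rewrite cabsM [cabs (zi / _)]cabsM cabsV cabs_zi; apply: ler_pM; rewrite ?cabs_ge0 //.
- by rewrite mulr_ge0 ?invr_ge0 ?cabs_ge0 //; lra.
- exact: axis_ratio.
Qed.

End Axis.

Section Abel.
Variable R : realType.
Local Notation C := (Cplx R).

(** If the factors [A n] switch from [l] to 0 at the index [N], the series is
    [l] times the [N]-th partial sum of [c], up to summable errors and one exceptional
    term. *)
Lemma abel_bound (A c : nat -> C) (l : C) N (e X B : R) : 0 <= X ->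
  (forall n, cabs (A n - (if (n < N)%N then l else 0)) <=
             e * tele R n + (if n == N then X else 0)) ->
  (forall n, cabs (c n) <= B) ->
  tele_summable (fun n => c n * A n) /\
  cabs (csum (fun n => c n * A n) - l * \sum_(i < N) c i) <= B * (e + X).
Proof.
move=> X0 hA hc.
have B0 : 0 <= B by apply: le_trans (hc 0%N); exact: cabs_ge0.
have S : tele_summable (fun n => c n * A n).
  apply: (@tele_summable_eventually _ _ N.+1 (B * e)) => n hn.
  have := hA n; rewrite ltnNge (ltnW hn) /= gtn_eqF // addr0 subr0 => h.
  by rewrite cabsM -mulrA; apply: ler_pM; rewrite ?cabs_ge0.
have e0 : 0 <= e.
  have := hA N.+1; rewrite gtn_eqF // addr0 => /(le_trans (cabs_ge0 _)).
  by rewrite pmulr_lge0 // tele_gt0.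
split=> //; apply: (csum_dist (N := N)) => // n hn.
have -> : \sum_(i < n) c i * A i - l * \sum_(i < N) c i =
   \sum_(i < n) (c i * (A i - (if (i < N)%N then l else 0))) :> C.
  have -> : l * \sum_(i < N) c i = \sum_(i < n) (c i * (if (i < N)%N then l else 0)) :> C.
    rewrite (big_ord_widen n c hn) mulr_sumr [in RHS](bigID (fun i : 'I_n => (i < N)%N)) /=.
    rewrite [X in _ = _ + X]big1 ?addr0 => [|i /negbTE ->]; last by rewrite mulr0.
    by apply: eq_bigr => i ->; rewrite mulrC.
  by rewrite -sumrB; apply: eq_bigr => i _; rewrite mulrBr.
apply: le_trans (cabs_sum n (fun i => c i * (A i - (if (i < N)%N then l else 0)))) _.
apply: le_trans (_ : \sum_(i < n) (B * (e * tele R i + (if i == N :> nat then X else 0))) <= _).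
  by apply: ler_sum => i _; rewrite cabsM; apply: ler_pM; rewrite ?cabs_ge0.
rewrite -mulr_sumr ler_wpM2l // big_split /= lerD //.
  by rewrite -mulr_sumr ler_piMr // sum_tele_le1.
have [Nn|nN] := ltnP N n.
  rewrite (bigD1 (Ordinal Nn)) //= eqxx big1 ?addr0 // => i ni.
  by rewrite ifN //; apply: contra ni => /eqP h; apply/eqP/val_inj.
by rewrite big1 // => i _; rewrite ifN // ltn_eqF // (leq_trans (ltn_ord i)).
Qed.

End Abel.

(** * The synthesis operator *)

Section Operator.
Variable R : realType.
Local Notation C := (Cplx R).
Local Notation mu := (@lebesgue_measure R).
Variable (E : C -> C).
Hypothesis hE : hermite_biehler E.
Let Theta z : C := sharp E z / E z.
Variables (w : nat -> C) (delta eta : R).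
Hypothesis delta0 : 0 < delta.
Hypothesis eta0 : 0 < eta.
Hypothesis eta8 : eta <= 1 / 8.
Hypothesis w_im : forall n, delta <= complex.Im (w n).
Hypothesis w_Theta : forall n, cabs (Theta (w n)) <= eta * tele R n.

(** Above this height on the imaginary axis the kernel at [w n] is close to its limit. *)
Definition height n : R := (1 + cabs (w n)) / (eta * tele R n).

Hypothesis w_step : forall n, height n + 1 <= eta * tele R n.+1 * cabs (w n.+1).
Hypothesis w_big : forall n, 2 ^+ (n + 7) <= tele R n * cabs (w n).

Lemma w_im0 n : 0 < complex.Im (w n).
Proof. exact: lt_le_trans delta0 (w_im n). Qed.

Lemma etw_gt0 n : 0 < eta * tele R n.
Proof. by rewrite mulr_gt0 ?tele_gt0 ?eta0. Qed.

Lemma etw_le n : eta * tele R n <= 1 / 8.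
Proof.
apply: le_trans eta8; rewrite ler_piMr ?tele_le1 //; exact: ltW eta0.
Qed.

Lemma height_ge n : 8 * (1 + cabs (w n)) <= height n.
Proof.
rewrite ler_pdivlMr ?etw_gt0 //; have := etw_le n.
have r0 := cabs_ge0 (w n); have p : 0 < 1 + cabs (w n) by lra.
move=> h; rewrite mulrAC ler_piMl //; first exact: ltW.
lra.
Qed.

Lemma height_ge1 n : 1 <= height n.
Proof. have := height_ge n; have := cabs_ge0 (w n); lra. Qed.

Lemma w_step_le n : height n + 1 <= cabs (w n.+1).
Proof.
apply: le_trans (w_step n) _; rewrite ler_piMl ?cabs_ge0 //.
by apply: le_trans (etw_le _) _; lra.
Qed.

Lemma w_lacunary n : 2 * cabs (w n) <= cabs (w n.+1).
Proof. have := w_step_le n; have := height_ge n; have := cabs_ge0 (w n); lra. Qed.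

Lemma height_mono m n : (m <= n)%N -> height m <= height n.
Proof.
elim: n => [|n IH]; first by rewrite leqn0 => /eqP ->.
rewrite leq_eqVlt => /predU1P[->//|]; rewrite ltnS => /IH h.
have := w_step_le n; have := height_ge n.+1; have := cabs_ge0 (w n.+1); lra.
Qed.

Lemma w_below n y : height n <= y -> 1 + cabs (w n) <= eta * tele R n * y.
Proof. by rewrite /height ler_pdivrMr ?etw_gt0 // mulrC. Qed.

Lemma w_above m n y : y <= height m -> (m < n)%N -> y + 1 <= eta * tele R n * cabs (w n).
Proof.
case: n => // n hy; rewrite ltnS => /height_mono h.
apply: le_trans (w_step n); lra.
Qed.

Lemma w_ge_nat n : n%:R <= cabs (w n).
Proof.
apply: le_trans (_ : tele R n * cabs (w n) <= _); last by rewrite ler_piMl ?tele_le1 // cabs_ge0.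
apply: le_trans (w_big n); rewrite -natrX ler_nat.
apply: leq_trans (leq_addr 7 n) _; exact/ltnW/ltn_expl.
Qed.

Lemma w_escape (x : R) : exists N, forall n, (N <= n)%N -> x <= cabs (w n).
Proof.
exists (Num.bound `|x|) => n hn; apply: le_trans (w_ge_nat n).
apply: le_trans (ler_norm _) _; apply: le_trans (ltW (archi_boundP (normr_ge0 x))) _.
by rewrite ler_nat.
Qed.

(** At a given height the kernels before [N] are in their upper regime and those after
    [N] in their lower one; only the kernel at [w N] can be in between. *)
Lemma index_at (y : R) : exists N, y <= height N /\ forall n, (n < N)%N -> height n <= y.
Proof.
have ex : exists n, y <= height n.
  have [N hN] := w_escape y; exists N; apply: le_trans (hN N (leqnn _)) _.
  have := height_ge N; have := cabs_ge0 (w N); lra.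
pose P n := y <= height n; have exP : exists n, P n by [].
exists (ex_minn exP); case: ex_minnP => N PN minN; split=> // n nN.
by rewrite leNgt; apply/negP => /ltW /minN; rewrite leqNgt nN.
Qed.

Definition rkern_seq n := rkern E (w n).

Lemma rkern_seq_entire n : entire (rkern_seq n).
Proof. exact: rkern_entire hE (w n). Qed.

(** Valid in the whole plane: it makes the series converge locally uniformly. *)
Lemma rkern_seq_tail (v : C) (r B : R) n : cabs v <= r -> 2 * r + 1 <= cabs (w n) ->
  cabs (E v) <= B -> cabs (sharp E v) <= B -> cabs (rkern_seq n v) <= 4 * B * tele R n.
Proof.
move=> hv hw hB hB'; have B0 := le_trans (cabs_ge0 _) hB.
have d : cabs (w n) / 2 <= cabs (v - (w n)^*%C).
  by rewrite cabs_distC; have := cabs_lb ((w n)^*%C) v; rewrite cabsJ; lra.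
have r0 : 0 < cabs (w n) by have := cabs_ge0 v; lra.
have vw : v != (w n)^*%C by rewrite -subr_eq0 -cabs_gt0; lra.
rewrite /rkern_seq (rkern_off hE (w_im0 n)) // cabsM cabsV.
have T : cabs (E v - (Theta (w n))^*%C * sharp E v) <= 2 * B.
  apply: le_trans (cabsB _ _) _; rewrite mulr_natl mulr2n lerD // cabsM cabsJ -[leRHS]mul1r.
  by apply: ler_pM; rewrite ?cabs_ge0 //; apply: (Theta_le1 hE); exact/ltW/w_im0.
have I : (cabs (v - (w n)^*%C))^-1 <= 2 * tele R n.
  apply: le_trans (_ : (cabs (w n) / 2)^-1 <= _).
    by rewrite lef_pV2 ?posrE //; lra.
  rewrite invf_div ler_pdivrMr // -mulrA -[leLHS]mulr1 ler_wpM2l //.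
  by apply: le_trans (w_big n); rewrite -natrX ler1n expn_gt0.
have -> : 4 * B * tele R n = (2 * B) * (2 * tele R n) by ring.
by apply: ler_pM; rewrite ?invr_ge0 ?cabs_ge0.
Qed.

Section Coef.
Variables (a : nat -> C) (M : R).
Hypothesis aM : forall j, cabs (a j) <= M.

Let M0 : 0 <= M. Proof. exact: le_trans (cabs_ge0 _) (aM 0%N). Qed.

Lemma tent_coef_bd n : cabs (tent_coef a n) <= 2 * M.
Proof.
apply: le_trans (tent_coef_le n aM) _; rewrite ler_pdivrMr ?ltr0n // ler_peMr ?mulr_ge0 ?M0 //.
by rewrite ler1n.
Qed.

Lemma synth_summable v : tele_summable (fun n => tent_coef a n * rkern_seq n v).
Proof.
have [N hN] := w_escape (2 * cabs v + 1).
pose B := cabs (E v) + cabs (sharp E v).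
apply: (@tele_summable_eventually _ _ N (2 * M * (4 * B))) => n /hN h.
rewrite cabsM -mulrA; apply: ler_pM; rewrite ?cabs_ge0 ?tent_coef_bd //.
by apply: rkern_seq_tail h _ _ => //; rewrite /B ?lerDl ?lerDr cabs_ge0.
Qed.

Definition synth : C -> C := fun v => csum (fun n => tent_coef a n * rkern_seq n v).

Lemma synth_entire : entire synth.
Proof.
move=> z _.
have cE := derivable_continuous (entire_derivable (z := z) hE.1).
have cS := derivable_continuous (entire_derivable (z := z) (sharp_entire hE.1)).
have [d1 d10 h1] := cE 1 ltr01; have [d2 d20 h2] := cS 1 ltr01.
pose d := Num.min (d1 / 2) (d2 / 2).
have d0 : 0 < d by rewrite lt_min !divr_gt0.
have [dd1 dd2] : d <= d1 / 2 /\ d <= d2 / 2 by rewrite /d !ge_min !lexx orbT.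
pose B := cabs (E z) + cabs (sharp E z) + 1.
have EB v : cabs (v - z) <= d -> cabs (E v) <= B.
  move=> hv; have := h1 v; have := cabs_lb (E v) (E z); have := cabs_ge0 (sharp E z).
  rewrite /B; lra.
have SB v : cabs (v - z) <= d -> cabs (sharp E v) <= B.
  move=> hv; have := h2 v; have := cabs_lb (sharp E v) (sharp E z); have := cabs_ge0 (E z).
  rewrite /B; lra.
have [N hN] := w_escape (2 * (cabs z + d) + 1).
pose tl n (v : C) := tent_coef a (N + n)%N * rkern_seq (N + n)%N v.
(* The finitely many first terms are entire; the others are uniformly small near [z]. *)
have vz v : cabs (v - z) <= d -> cabs v <= cabs z + d.
  by move=> hv; have := cabs_lb v z; lra.
have tlB n v : cabs (v - z) <= d -> cabs (tl n v) <= 2 * M * (4 * B) * tele R n.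
  move=> hv; rewrite cabsM -mulrA; apply: ler_pM; rewrite ?cabs_ge0 ?tent_coef_bd //.
  apply: le_trans (rkern_seq_tail (vz v hv) (hN _ (leq_addr _ _)) (EB v hv) (SB v hv)) _.
  rewrite ler_wpM2l //; first by rewrite mulr_ge0 // /B !addr_ge0 ?cabs_ge0.
  rewrite /tele lef_pV2 ?posrE ?mulr_gt0 ?ltr0n // -!natrM ler_nat.
  by apply: leq_mul; rewrite ?ltnS leq_addl.
have dtl : derivable (fun v : C => csum (fun n => tl n v)) z 1.
  apply: (@weierstrass _ tl z d _ d0) tlB => n v _.
  by apply: derM; [exact: derivable_cst|exact: (entire_derivable (@rkern_seq_entire _))].
have dfin k : derivable (fun v : C => \sum_(i < k) tent_coef a i * rkern_seq i v) z 1.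
  elim: k => [|k IH].
    have -> : (fun v : C => \sum_(i < 0) tent_coef a i * rkern_seq i v) = (fun=> 0).
      by apply/funext => v; rewrite big_ord0.
    exact: derivable_cst.
  have -> : (fun v : C => \sum_(i < k.+1) tent_coef a i * rkern_seq i v) =
    (fun v => \sum_(i < k) tent_coef a i * rkern_seq i v + tent_coef a k * rkern_seq k v).
    by apply/funext => v; rewrite big_ord_recr.
  apply: (derD IH).
  by apply: derM; [exact: derivable_cst|exact: (entire_derivable (@rkern_seq_entire _))].
apply: (derivable_near_eq d0 _ (derD (dfin N) dtl)) => v hv.
rewrite /synth (@csum_split _ _ N (synth_summable v)) //.
by exists (2 * M * (4 * B)) => n; apply: tlB; exact: ltW.
Qed.

Lemma sharp_synth v : sharp synth v = csum (fun n => (tent_coef a n)^*%C * sharp (rkern_seq n) v).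
Proof.
rewrite /sharp /synth -csumJ; last exact: synth_summable.
by congr csum; apply/funext => n; rewrite cJM.
Qed.

Lemma sharp_synth_summable v : tele_summable (fun n => (tent_coef a n)^*%C * sharp (rkern_seq n) v).
Proof.
have -> : (fun n => (tent_coef a n)^*%C * sharp (rkern_seq n) v) =
  (fun n => (tent_coef a n * rkern_seq n (v^*%C))^*%C) by apply/funext => n; rewrite cJM.
exact/tele_summableJ/synth_summable.
Qed.

(** Both the series of kernels and its [sharp] obey this bound, with
    [K = 2] and [K = 192]; the integrable right-hand side depends on [Re z] only, which
    yields the bound over all horizontal lines at once. *)
Lemma L2_pointwise (u : nat -> C) (K : R) (z : C) : 0 <= complex.Im z -> 0 <= K ->
  tele_summable u ->
  (forall n, cabs (u n) <= cabs (tent_coef a n) * (K * cabs (E z) / cabs (z - (w n)^*%C))) ->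
  (((cabs (csum u / E z)) ^+ 2)%:E <= ((K * M) ^+ 2)%:E * lorentz_sum w delta (complex.Re z))%E.
Proof.
move=> hz K0 su hu.
have [Ez|Ez] := eqVneq (E z) 0.
  rewrite Ez invr0 mulr0 cabs0 expr0n /=; apply: mule_ge0; first by rewrite lee_fin sqr_ge0.
  exact: lorentz_sum_ge0.
have Ez0 : 0 < cabs (E z) by rewrite cabs_gt0.
have part n : (cabs (\sum_(i < n) u i) / cabs (E z)) ^+ 2 <=
    (K * M) ^+ 2 * \sum_(i < n) lorentz_term w delta i (complex.Re z).
  have := weighted_sum_sq delta0 w_im w_lacunary (M := M) (c := fun n => cabs (tent_coef a n)) n hz.
  move=> /(_ (fun k => introT andP (conj (cabs_ge0 _) (tent_coef_le k aM)))) h.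
  rewrite [(K * M) ^+ 2]exprMn -mulrA; apply: le_trans (ler_wpM2l (sqr_ge0 K) h).
  rewrite -exprMn ler_sqr ?nnegrE; last 2 first.
  - by rewrite divr_ge0 ?cabs_ge0.
  - by rewrite mulr_ge0 // sumr_ge0 // => i _; rewrite mulr_ge0 ?invr_ge0 ?cabs_ge0.
  rewrite ler_pdivrMr //; apply: le_trans (cabs_sum _ _) _.
  rewrite mulr_sumr mulr_suml; apply: ler_sum => i _; apply: le_trans (hu i) _.
  rewrite le_eqVlt; apply/orP; left; apply/eqP; ring.
have lim (g : R) : 0 <= g -> (forall n, (cabs (\sum_(i < n) u i) / cabs (E z)) ^+ 2 <= g ^+ 2) ->
    (cabs (csum u / E z)) ^+ 2 <= g ^+ 2.
  move=> g0 hg; rewrite ler_sqr ?nnegrE ?cabs_ge0 // cabsM cabsV ler_pdivrMr //.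
  rewrite -[csum u]subr0; apply: (csum_dist (N := 0%N)) => // n _; rewrite subr0.
  by rewrite -ler_pdivrMr // -(@ler_pXn2r R 2) ?nnegrE ?divr_ge0 ?cabs_ge0.
have G0 := lorentz_sum_ge0 w delta (complex.Re z).
(* The majorant may be infinite, and then [0 * +oo = 0] must be treated apart. *)
have [KM0|KM0] := eqVneq (K * M) 0.
  rewrite KM0 expr0n mul0e lee_fin; have := @lim 0 (lexx _); rewrite expr0n; apply=> n.
  by have := part n; rewrite KM0 expr0n mul0r.
have KMp : 0 < (K * M) ^+ 2 by rewrite lt_neqAle sqr_ge0 andbT eq_sym expf_neq0.
case GE : (lorentz_sum w delta (complex.Re z)) G0 => [g| |] // G0; last first.
  by rewrite gt0_muley ?lte_fin // leey.
rewrite -EFinM lee_fin; rewrite lee_fin in G0.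
have g0 : 0 <= (K * M) ^+ 2 * g by rewrite mulr_ge0 // ltW.
rewrite -[leRHS]sqr_sqrtr //; apply: lim; first exact: sqrtr_ge0.
move=> n; rewrite sqr_sqrtr //; apply: le_trans (part n) _; rewrite ler_wpM2l ?(ltW KMp) //.
by have := @lorentz_sum_ge R w delta (complex.Re z) n; rewrite GE lee_fin.
Qed.

Lemma synth_L2 z : 0 <= complex.Im z ->
  (((cabs (synth z / E z)) ^+ 2)%:E <= ((2 * M) ^+ 2)%:E * lorentz_sum w delta (complex.Re z))%E.
Proof.
move=> hz; apply: L2_pointwise => //; first exact: synth_summable.
by move=> n; rewrite cabsM ler_wpM2l ?cabs_ge0 //; exact: (rkern_le hE (w_im0 n) hz).
Qed.

Lemma sharp_synth_L2 z : 0 < complex.Im z ->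
  (((cabs (sharp synth z / E z)) ^+ 2)%:E <=
    ((192 * M) ^+ 2)%:E * lorentz_sum w delta (complex.Re z))%E.
Proof.
move=> hz; rewrite sharp_synth; apply: L2_pointwise => //; first exact: ltW.
  exact: sharp_synth_summable.
by move=> n; rewrite cabsM cabsJ ler_wpM2l ?cabs_ge0 //; exact: (sharp_rkern_le hE (w_im0 n) hz).
Qed.

Definition lorentz_mass : R := pi * (16 / delta + 1).

Lemma lorentz_sum_measurable : measurable_fun setT (lorentz_sum w delta).
Proof.
apply: ge0_emeasurable_sum => [n x _ _|n _]; first by rewrite lee_fin lorentz_term_ge0.
have L0 : 0 < cabs (w n) / 4 by rewrite divr_gt0 // (w_pos delta0 w_im).
apply/measurable_EFinP; apply: measurable_funD; apply: measurable_funM => //;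
    exact: lorentz_measurable.
Qed.

Lemma integral_le_mass (g : R -> R) (k : R) : 0 <= k -> (forall x, 0 <= g x) ->
  (forall x, ((g x)%:E <= k%:E * lorentz_sum w delta x)%E) ->
  (\int[mu]_x (g x)%:E <= (k * lorentz_mass)%:E)%E.
Proof.
move=> k0 g0 hg.
apply: le_trans (ge0_integral_mono (g := fun x => (k%:E * lorentz_sum w delta x)%E) _ _) _ => //.
rewrite ge0_integralZl_EFin //.
- rewrite EFinM; apply: lee_wpmul2l; first by rewrite lee_fin.
  exact: (integral_lorentz_sum delta0 w_im w_big).
- by move=> x _; exact: lorentz_sum_ge0.
- exact: lorentz_sum_measurable.
Qed.

Lemma hardy2_of_L2 (F : C -> C) (k : R) : entire F -> 0 <= k ->
  (forall z, 0 < complex.Im z ->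
     (((cabs (F z / E z)) ^+ 2)%:E <= k%:E * lorentz_sum w delta (complex.Re z))%E) ->
  hardy2 (fun z => F z / E z).
Proof.
move=> eF k0 hF; split.
  move=> z hz; apply: derM; first exact: (entire_derivable eF).
  by apply: derV; [exact: (HB_neq0 hE hz)|exact: (entire_derivable hE.1)].
apply: le_lt_trans (_ : _ <= (k * lorentz_mass)%:E)%E (ltry _).
apply: ge_ereal_sup => _ [y /= y0 <-].
apply: integral_le_mass => // x; first exact: sqr_ge0.
by have := hF (x +i* y); apply.
Qed.

Lemma synth_deBranges : deBranges E synth.
Proof.
split; first exact: synth_entire.
  by apply: (hardy2_of_L2 synth_entire (sqr_ge0 (2 * M))) => z /ltW; exact: synth_L2.
apply: (hardy2_of_L2 (sharp_entire synth_entire) (sqr_ge0 (192 * M))) => z.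
exact: sharp_synth_L2.
Qed.

Lemma synth_norm : deBranges_norm E synth <= 2 * Num.sqrt lorentz_mass * M.
Proof.
have -> : 2 * Num.sqrt lorentz_mass * M = Num.sqrt ((2 * M) ^+ 2 * lorentz_mass).
  by rewrite [in RHS]sqrtrM ?sqr_ge0 // sqrtr_sqr ger0_norm ?mulr_ge0 //; ring.
apply: ler_wsqrtr; rewrite /Rintegral.
have I : (\int[mu]_x ((cabs (synth x%:C / E x%:C)) ^+ 2)%:E <= ((2 * M) ^+ 2 * lorentz_mass)%:E)%E.
  apply: integral_le_mass => [|x|x]; [exact: sqr_ge0|exact: sqr_ge0|].
  by have := @synth_L2 x%:C (lexx _).
have I0 : (0 <= \int[mu]_x ((cabs (synth x%:C / E x%:C)) ^+ 2)%:E)%E.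
  by apply: integral_ge0 => x _; rewrite lee_fin sqr_ge0.
rewrite -lee_fin fineK //; apply/fin_numPlt; rewrite (lt_le_trans _ I0) ?ltNy0 //=.
exact: le_lt_trans I (ltry _).
Qed.

Section AxisSynth.
Variable y : R.
Hypothesis y1 : 1 <= y.
Let z : C := 0 +i* y.
Let zi : C := 0 +i* y + (0 +i* 1).

Lemma synth_axisE : zi * synth z / E z = csum (fun n => tent_coef a n * rkern_axis E (w n) y).
Proof.
have -> : zi * synth z / E z = (zi / E z) * synth z by ring.
rewrite -csumZ; last exact: synth_summable.
by congr csum; apply/funext => n; rewrite /rkern_axis /rkern_seq -/z -/zi; ring.
Qed.

Lemma sharp_synth_axisE : zi * sharp synth z / E z =
  csum (fun n => (tent_coef a n)^*%C * sharp_rkern_axis E (w n) y).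
Proof.
have -> : zi * sharp synth z / E z = (zi / E z) * sharp synth z by ring.
rewrite sharp_synth -csumZ; last exact: sharp_synth_summable.
by congr csum; apply/funext => n; rewrite /sharp_rkern_axis /rkern_seq -/z -/zi; ring.
Qed.

Lemma synth_axis N (X : R) : 0 <= X -> (forall n, (n < N)%N -> height n <= y) ->
  (forall n, (N < n)%N -> y + 1 <= eta * tele R n * cabs (w n)) ->
  cabs (rkern_axis E (w N) y) <= 3 * (eta * tele R N) + X ->
  cabs (zi * synth z / E z - tent_sum a N) <= 2 * M * (3 * eta + X).
Proof.
move=> X0 hb ha hN; rewrite synth_axisE -(sum_tent_coef a N) -[\sum_(i < N) _]mul1r.
apply: (abel_bound (A := fun n => rkern_axis E (w n) y) X0 _ tent_coef_bd).2 => n.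
have e0 := ltW (etw_gt0 n).
case: (ltngtP n N) => [nN|nN|->].
- rewrite addr0 -mulrA.
  exact: (rkern_axis_below hE (w_im0 n) y1 (w_below (hb n nN)) (w_Theta n)).
- rewrite addr0 subr0 -mulrA.
  apply: le_trans (rkern_axis_le hE (w_im0 n) y1) _.
  have := ratio_above (w_im0 n) y1 (ha n nN); lra.
- by rewrite subr0 -mulrA.
Qed.

Lemma sharp_synth_axis N (X : R) : 0 <= X -> (forall n, (n < N)%N -> height n <= y) ->
  (forall n, (N < n)%N -> y + 1 <= eta * tele R n * cabs (w n)) ->
  cabs (sharp_rkern_axis E (w N) y) <= X ->
  cabs (zi * sharp synth z / E z - Theta z * \sum_(i < N) (tent_coef a i)^*%C)
    <= 2 * M * (192 * eta + X).
Proof.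
move=> X0 hb ha hN; rewrite sharp_synth_axisE.
apply: (abel_bound (A := fun n => sharp_rkern_axis E (w n) y)
  (c := fun n => (tent_coef a n)^*%C) X0 _ _).2 => n; last first.
  by rewrite cabsJ tent_coef_bd.
have e0 := ltW (etw_gt0 n).
case: (ltngtP n N) => [nN|nN|->].
- rewrite addr0 -mulrA.
  have e2 : eta * tele R n <= 1 / 2 by have := etw_le n; lra.
  have := sharp_rkern_axis_below hE (w_im0 n) y1 e2 (w_below (hb n nN)) (w_Theta n).
  by move=> /le_trans; apply; lra.
- rewrite addr0 subr0 -mulrA.
  apply: le_trans (sharp_rkern_axis_le hE (w_im0 n) y1) _.
  have := ratio_above (w_im0 n) y1 (ha n nN); lra.
- rewrite subr0; apply: le_trans hN _.
  by rewrite lerDr mulr_ge0 ?tele_ge0 // mulr_ge0 // ltW.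
Qed.

Lemma synth_axis_bound : cabs (zi * synth z / E z) <= 2000 * M /\
  cabs (zi * sharp synth z / E z) <= 2000 * M.
Proof.
have [N [yN hb]] := index_at y.
have ha n : (N < n)%N -> y + 1 <= eta * tele R n * cabs (w n).
  exact: w_above.
have r4 := ratio_any (w_im0 N) y1.
have eN := ltW (etw_gt0 N); have e8 := eta8; have e0 := eta0; have m0 := M0.
have X8 : cabs (rkern_axis E (w N) y) <= 3 * (eta * tele R N) + 8.
  apply: le_trans (rkern_axis_le hE (w_im0 N) y1) _; move: r4; lra.
have X768 : cabs (sharp_rkern_axis E (w N) y) <= 768.
  apply: le_trans (sharp_rkern_axis_le hE (w_im0 N) y1) _; move: r4; lra.
have eM : eta * M <= 1 / 8 * M by rewrite ler_wpM2r.
have bM := tent_sum_le N aM.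
split.
  have := synth_axis (ler0n _ 8) hb ha X8.
  have := cabs_lb (zi * synth z / E z) (tent_sum a N); move: bM eM; lra.
have := sharp_synth_axis (ler0n _ 768) hb ha X768.
set S := \sum_(i < N) _.
have SM : cabs (Theta z * S) <= M.
  have -> : S = (tent_sum a N)^*%C by rewrite -sum_tent_coef conj_sum.
  rewrite cabsM cabsJ -[leRHS]mul1r; apply: ler_pM; rewrite ?cabs_ge0 //.
  exact: (Theta_axis_le1 hE y1).
have := cabs_lb (zi * sharp synth z / E z) (Theta z * S); move: SM eM; lra.
Qed.

End AxisSynth.

(** At the height where the kernels up to [p] have just been switched on, no kernel is
    in between, and the sum is the partial sum of the coefficients. *)
Lemma synth_peak p (y := height p) :
  cabs ((0 +i* y + (0 +i* 1)) * synth (0 +i* y) / E (0 +i* y) - tent_sum a p.+1) <= 6 * eta * M.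
Proof.
have y1 := height_ge1 p.
have ha n : (p < n)%N -> y + 1 <= eta * tele R n * cabs (w n) by exact: w_above.
have := @synth_axis y y1 p.+1 0 (lexx _) => H.
have -> : 6 * eta * M = 2 * M * (3 * eta + 0) by ring.
apply: H => [n|n hn|]; first by rewrite ltnS; exact: height_mono.
  by apply: ha; exact: ltnW.
apply: le_trans (rkern_axis_le hE (w_im0 _) y1) _.
have := ratio_above (w_im0 p.+1) y1 (ha _ (ltnSn p)).
have := ltW (etw_gt0 p.+1); lra.
Qed.

End Coef.
End Operator.

(** * Existence of the synthesis operator *)

Section Package.
Variable R : realType.
Local Notation C := (Cplx R).
Variable (E : C -> C).
Hypothesis hE : hermite_biehler E.
Let Theta z : C := sharp E z / E z.

(** Each [w n.+1] is chosen in terms of [w n] only, by dependent choice. *)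
Lemma exists_lacunary (delta eta : R) : 0 < delta -> 0 < eta ->
  (forall B e : R, 0 < e ->
     exists z, [/\ delta <= complex.Im z, B <= cabs z & cabs (Theta z) <= e]) ->
  exists w : nat -> C, [/\ forall n, delta <= complex.Im (w n),
    forall n, cabs (Theta (w n)) <= eta * tele R n,
    forall n, height w eta n + 1 <= eta * tele R n.+1 * cabs (w n.+1) &
    forall n, 2 ^+ (n + 7) <= tele R n * cabs (w n)].
Proof.
move=> d0 e0 H.
have [pk hpk] : {pk : R * R -> C & forall p, 0 < p.2 ->
   [/\ delta <= complex.Im (pk p), p.1 <= cabs (pk p) & cabs (Theta (pk p)) <= p.2]}.
  apply: (@choice _ _ (fun p z => 0 < p.2 ->
     [/\ delta <= complex.Im z, p.1 <= cabs z & cabs (Theta z) <= p.2])) => p.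
  have [p0|p0] := ltrP 0 p.2; first by have [z hz] := H p.1 p.2 p0; exists z.
  by exists 0.
pose bnd n (prev : C) : R := 2 ^+ (n.+1 + 7) / tele R n.+1 +
   ((1 + cabs prev) / (eta * tele R n) + 1) / (eta * tele R n.+1).
pose w := fix w n := if n is m.+1 then pk (bnd m (w m), eta * tele R m.+1)
                     else pk (2 ^+ 7 / tele R 0, eta * tele R 0).
have ep n : 0 < eta * tele R n by rewrite mulr_gt0 ?tele_gt0.
have wS n : w n.+1 = pk (bnd n (w n), eta * tele R n.+1) by [].
exists w; split.
- case=> [|n]; first by have [] := hpk (2 ^+ 7 / tele R 0, eta * tele R 0) (ep 0%N).
  by rewrite wS; have [] := hpk (bnd n (w n), eta * tele R n.+1) (ep _).
- case=> [|n]; first by have [] := hpk (2 ^+ 7 / tele R 0, eta * tele R 0) (ep 0%N).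
  by rewrite wS; have [] := hpk (bnd n (w n), eta * tele R n.+1) (ep _).
- move=> n; rewrite wS; have [_ /= h _] := hpk (bnd n (w n), eta * tele R n.+1) (ep _).
  rewrite [leRHS]mulrC -ler_pdivrMr ?ep //; apply: le_trans h.
  by rewrite /bnd /height lerDr divr_ge0 ?exprn_ge0 ?tele_ge0.
- case=> [|n].
    have [_ /= h _] := hpk (2 ^+ 7 / tele R 0, eta * tele R 0) (ep 0%N).
    by rewrite mulrC -ler_pdivrMr ?tele_gt0.
  rewrite wS; have [_ /= h _] := hpk (bnd n (w n), eta * tele R n.+1) (ep _).
  rewrite [leRHS]mulrC -ler_pdivrMr ?tele_gt0 //; apply: le_trans h.
  rewrite /bnd lerDl divr_ge0 ?(ltW (ep _)) // addr_ge0 // divr_ge0 ?(ltW (ep _)) //.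
  by rewrite addr_ge0 ?cabs_ge0.
Qed.

(** Normalized so that [|axis_eval y F| <= c] says that [|F| <= c * m] at [i y]. *)
Definition axis_eval (y : R) (F : C -> C) : C :=
  (0 +i* y + (0 +i* 1)) * F (0 +i* y) / E (0 +i* y).

Definition bounded_seq (a : nat -> C) := exists M : R, forall n, cabs (a n) <= M.

(** All that the geometry of the majorant space needs to know about the kernels. *)
Lemma exists_synthesis (delta : R) : 0 < delta ->
  (forall B e : R, 0 < e ->
     exists z, [/\ delta <= complex.Im z, B <= cabs z & cabs (Theta z) <= e]) ->
  exists (T : (nat -> C) -> (C -> C)) (K : R) (y : nat -> R),
  [/\ forall k, 1 <= y k,
      forall (c : C) a a', bounded_seq a -> bounded_seq a' ->
        T (fun j => c * a j + a' j) = (fun v => c * T a v + T a' v),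
      forall a (M : R), (forall j, cabs (a j) <= M) ->
        [/\ deBranges E (T a), deBranges_norm E (T a) <= K * M &
            forall t, 1 <= t -> cabs (axis_eval t (T a)) <= K * M /\
                                cabs (axis_eval t (sharp (T a))) <= K * M],
      (0 <= K) &
      forall a (M : R), (forall j, cabs (a j) <= M) ->
        forall k, cabs (axis_eval (y k) (T a) - a k * (1 / 2)%:C) <= M / 16].
Proof.
move=> d0 H; pose eta : R := 1 / 100.
have e0 : 0 < eta by rewrite /eta; lra.
have e8 : eta <= 1 / 8 by rewrite /eta; lra.
have [w [w_im w_Th w_step w_big]] := exists_lacunary d0 e0 H.
pose T a := synth E w a.
pose K : R := 2 * Num.sqrt (lorentz_mass delta) + 2000.
have s0 : 0 <= Num.sqrt (lorentz_mass delta) by exact: sqrtr_ge0.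
exists T, K, (fun k => height w eta (3 * 2 ^ k).-1); split.
- move=> k; exact: height_ge1.
- move=> c a a' [M hM] [M' hM']; apply/funext => v.
  have S1 := synth_summable hE d0 w_im w_big hM v.
  have S2 := synth_summable hE d0 w_im w_big hM' v.
  rewrite /T /synth -(csum_lin c S1 S2); congr csum; apply/funext => n.
  by rewrite tent_coef_lin; ring.
- move=> a M hM; have M0 := le_trans (cabs_ge0 _) (hM 0%N); split.
  + exact: (synth_deBranges hE d0 e0 e8 w_im w_step w_big hM).
  + apply: le_trans (synth_norm hE d0 e0 e8 w_im w_step w_big hM) _.
    by rewrite ler_wpM2r // /K; lra.
  + move=> t t1.
    have [h1 h2] := synth_axis_bound hE d0 e0 e8 w_im w_Th w_step w_big hM t1.
    have KM : 2000 * M <= K * M by rewrite ler_wpM2r // /K; lra.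
    by split; apply: le_trans KM.
- by rewrite /K; lra.
- move=> a M hM k; have M0 := le_trans (cabs_ge0 _) (hM 0%N).
  have := synth_peak hE d0 e0 e8 w_im w_Th w_step w_big hM (3 * 2 ^ k).-1.
  have -> : (3 * 2 ^ k).-1.+1 = (3 * 2 ^ k)%N by rewrite prednK // muln_gt0 expn_gt0.
  rewrite tent_sum_peak => /le_trans; apply.
  have : 6 * (1 / 100) * M <= 1 / 16 * M by rewrite ler_wpM2r //; lra.
  by rewrite /eta; lra.
Qed.

End Package.

(** * Limits along an ultrafilter *)

Section Ulim.
Variable R : realType.
Local Notation C := (Cplx R).
Variable U : set_system nat.
Hypothesis UU : UltraFilter U.
Hypothesis Uoo : \oo `<=` U.

Let UF : ProperFilter U. Proof. exact: ultra_proper. Qed.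

(** A cluster point of a bounded sequence is its limit along an ultrafilter. *)
Lemma ultra_cluster (x : nat -> R) (B : R) : (forall n, `|x n| <= B) ->
  exists p, forall e, 0 < e -> U [set n | `|x n - p| < e].
Proof.
move=> xB.
have [|p [_ hp]] := @segment_compact R (- B) B (x @ U) _.
  rewrite /fmap /=; apply: filterS (filterT : U setT) => n _ /=.
  by rewrite in_itv /= -ler_norml.
exists p => e e0.
have [//|UC] := in_ultra_setVsetC [set n | `|x n - p| < e] UU.
have : (x @ U) (~` ball p e).
  rewrite /fmap /=; apply: filterS UC => n /= h k; apply: h.
  by rewrite distrC.
move=> /hp /(_ (nbhsx_ballx p e e0))[q [h1 h2]]; by case: (h1 h2).
Qed.

Definition ulim_at (u : nat -> C) (L : C) :=
  forall e : R, 0 < e -> U [set n | cabs (u n - L) < e].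

Definition ulim (u : nat -> C) : C := xget 0 [set L | ulim_at u L].

Lemma ulimP u : bounded_seq u -> ulim_at u (ulim u).
Proof.
move=> [B hB]; rewrite /ulim; apply: (@xgetPex _ 0 [set L | ulim_at u L]).
have [p hp] : exists p, forall e, 0 < e -> U [set n | `|complex.Re (u n) - p| < e].
  by apply: (@ultra_cluster _ B) => n; apply: le_trans (hB n); exact: cabs_Re.
have [q hq] : exists p, forall e, 0 < e -> U [set n | `|complex.Im (u n) - p| < e].
  by apply: (@ultra_cluster _ B) => n; apply: le_trans (hB n); exact: cabs_Im.
exists (p +i* q) => e e0; have e20 : 0 < e / 2 by rewrite divr_gt0.
apply: filterS (filterI (hp _ e20) (hq _ e20)) => n /= [h1 h2].
by apply: le_lt_trans (cabs_le _) _; rewrite cReB cImB /= [ltRHS](splitr e) ltrD.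
Qed.

Lemma ulim_dist u (c : C) (N : nat) (B : R) : bounded_seq u ->
  (forall n, (N <= n)%N -> cabs (u n - c) <= B) -> cabs (ulim u - c) <= B.
Proof.
move=> bu h; apply/ler_addgt0Pr => e e0.
have UN : U [set n | (N <= n)%N] by apply: Uoo; exists N.
have [n [/= h1 h2]] := filter_ex (filterI (ulimP bu e0) UN).
have -> : ulim u - c = (u n - c) - (u n - ulim u) :> C by ring.
by apply: le_trans (cabsB _ _) _; rewrite lerD ?h // ltW.
Qed.

Lemma bounded_lin u v (a : C) : bounded_seq u -> bounded_seq v ->
  bounded_seq (fun n => a * u n + v n).
Proof.
move=> [B hB] [B' hB']; exists (cabs a * B + B') => n.
apply: le_trans (cabsD _ _) _; rewrite lerD // cabsM ler_wpM2l ?cabs_ge0 //.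
Qed.

Lemma ulim_lin u v (a : C) : bounded_seq u -> bounded_seq v ->
  ulim (fun n => a * u n + v n) = a * ulim u + ulim v.
Proof.
move=> bu bv; apply/eqP; rewrite -subr_eq0 -cabs_eq0 eq_le cabs_ge0 andbT.
apply/ler_addgt0Pr => e e0; rewrite add0r.
have a0 : 0 < cabs a + 1 by rewrite ltr_wpDl ?cabs_ge0.
have e3 : 0 < e / 3 by rewrite divr_gt0.
have e4 : 0 < e / 3 / (cabs a + 1) by rewrite divr_gt0.
have [n [/= h1 [h2 h3]]] := filter_ex (filterI (ulimP (bounded_lin a bu bv) e3)
   (filterI (ulimP bu e4) (ulimP bv e3))).
have -> : ulim (fun n => a * u n + v n) - (a * ulim u + ulim v) =
  (a * (u n - ulim u) + (v n - ulim v)) -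
  (a * u n + v n - ulim (fun n => a * u n + v n)) :> C by ring.
apply: le_trans (cabsB _ _) _.
have k1 : cabs (a * (u n - ulim u)) <= e / 3.
  rewrite cabsM; apply: le_trans (_ : (cabs a + 1) * cabs (u n - ulim u) <= _).
    by rewrite ler_wpM2r ?cabs_ge0 // lerDl.
  by rewrite mulrC -ler_pdivlMr // ltW.
have k2 := cabsD (a * (u n - ulim u)) (v n - ulim v).
move: k1 k2 h1 h3; lra.
Qed.

End Ulim.

(** * From the synthesis operator to the geometry of the majorant space *)

Section Embedding.
Variable R : realType.
Local Notation C := (Cplx R).
Variable (E : C -> C).
Hypothesis hE : hermite_biehler E.
Let D : set C := [set 0 +i* y | y in [set y : R | 1 <= y]].
Let m : C -> R := fun z => cabs (E z) / cabs (z + (0 +i* 1)).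
Local Notation X := (majorant_space E D m).

Implicit Types F G : C -> C.

Definition axis_majorized (F : C -> C) (c : R) := forall t : R, 1 <= t ->
  cabs (axis_eval E t F) <= c /\ cabs (axis_eval E t (sharp F)) <= c.

Lemma majorizedP F c : majorized D m F c <-> axis_majorized F c.
Proof.
have key t G : 1 <= t -> (cabs (G (0 +i* t)) <= c * m (0 +i* t)) = (cabs (axis_eval E t G) <= c).
  move=> t1; have E0 : 0 < cabs (E (0 +i* t)) by rewrite cabs_gt0 axis_E.
  have z0 : 0 < cabs (0 +i* t + (0 +i* 1)) by rewrite cabs_zi //; lra.
  rewrite /axis_eval /m !cabsM cabsV ler_pdivrMr //.
  by rewrite mulrA ler_pdivlMr // mulrC.
split=> h.
  move=> t t1; have [h1 h2] := h (0 +i* t) (ex_intro2 _ _ t t1 erefl).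
  by rewrite -!key.
move=> _ [t /= t1 <-]; have [h1 h2] := h t t1.
by split; rewrite key.
Qed.

Lemma axis_eval_lin t (c : C) F G :
  axis_eval E t (c *: F + G) = c * axis_eval E t F + axis_eval E t G.
Proof. by rewrite /axis_eval -[(c *: F + G) _]/(c * F _ + G _); ring. Qed.

Lemma sharp_sub F G : sharp (F - G : C -> C) = sharp F - sharp G.
Proof. by apply/funext => z; rewrite /sharp -[(F - G) _]/(F _ - G _) cJB. Qed.

Lemma axis_evalB t F G : axis_eval E t (F - G) = axis_eval E t F - axis_eval E t G.
Proof. by rewrite /axis_eval -[(F - G) _]/(F _ - G _); ring. Qed.

Lemma axis_majorizedB F G c d : axis_majorized F c -> axis_majorized G d ->
  axis_majorized (F - G) (c + d).
Proof.
move=> hF hG t t1; have [f1 f2] := hF t t1; have [g1 g2] := hG t t1.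
by rewrite sharp_sub !axis_evalB; split; apply: le_trans (cabsB _ _) _; rewrite lerD.
Qed.

Let mset F := [set c : R | 0 <= c /\ majorized D m F c].

Lemma mset_lb F : has_lbound (mset F).
Proof. by exists 0 => c []. Qed.

(** Only the part of the norm that comes from the majorant is involved, so this also
    applies to differences of elements of the space without any triangle inequality for
    the Hilbert norm. *)
Lemma axis_eval_le F c t : 0 <= c -> axis_majorized F c -> 1 <= t ->
  cabs (axis_eval E t F) <= majorant_norm E D m F.
Proof.
move=> c0 hF t1; apply: le_trans (_ : inf (mset F) <= _); last first.
  by rewrite /majorant_norm le_max lexx orbT.
apply/ler_addgt0Pr => e e0.
have hi : has_inf (mset F).
  by split; [exists c; split => //; exact/majorizedP|exact: mset_lb].
have [d [d0 /majorizedP hd] /ltW de] := inf_adherent e0 hi.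
by apply: le_trans de; have [] := hd t t1.
Qed.

Lemma majorant_norm_le F c : deBranges_norm E F <= c -> 0 <= c -> axis_majorized F c ->
  majorant_norm E D m F <= c.
Proof.
move=> h1 c0 hF; rewrite /majorant_norm ge_max h1 /=.
by apply: (ge_inf (mset_lb F)); split => //; exact/majorizedP.
Qed.

Lemma majorant_norm_ge0 F : 0 <= majorant_norm E D m F.
Proof. by rewrite /majorant_norm le_max sqrtr_ge0. Qed.

Lemma majorant_spaceP F : @ns_set R X F -> exists2 c, 0 <= c & axis_majorized F c.
Proof. by move=> [_ [c c0 /majorizedP hc]]; exists c => //; exact: ltW. Qed.

Lemma linfty_le (a : nat -> C) : @ns_set R (linfty R) a ->
  forall n, cabs (a n) <= @ns_norm R (linfty R) a.
Proof.
move=> [M hM] n; apply: ub_le_sup; last by exists n.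
by exists M => _ [k _ <-].
Qed.

Lemma linfty_sup (a : nat -> C) (M : R) : (forall n, cabs (a n) <= M) ->
  @ns_norm R (linfty R) a <= M.
Proof.
move=> hM; apply: ge_sup => [|_ [k _ <-]]; last exact: hM.
by exists (cabs (a 0%N)); exists 0%N.
Qed.

Variables (T : (nat -> C) -> (C -> C)) (K : R) (y : nat -> R).
Hypothesis y1 : forall k, 1 <= y k.
Hypothesis T_lin : forall (c : C) a a', bounded_seq a -> bounded_seq a' ->
  T (fun j => c * a j + a' j) = (fun v => c * T a v + T a' v).
Hypothesis T_in : forall a (M : R), (forall j, cabs (a j) <= M) ->
  [/\ deBranges E (T a), deBranges_norm E (T a) <= K * M & axis_majorized (T a) (K * M)].
Hypothesis K0 : 0 <= K.
Hypothesis T_peak : forall a (M : R), (forall j, cabs (a j) <= M) ->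
  forall k, cabs (axis_eval E (y k) (T a) - a k * (1 / 2)%:C) <= M / 16.

Let psi k F : C := axis_eval E (y k) F.

Lemma psi_le k F : @ns_set R X F -> cabs (psi k F) <= @ns_norm R X F.
Proof. by move=> /majorant_spaceP[c c0 hc]; exact: axis_eval_le hc (y1 k). Qed.

Lemma T_set a : bounded_seq a -> @ns_set R X (T a).
Proof.
move=> [M hM]; have M0 := le_trans (cabs_ge0 _) (hM 0%N).
have [h1 h2 h3] := T_in hM; split=> //; exists (K * M + 1).
  by rewrite ltr_wpDl // mulr_ge0.
apply/majorizedP => t t1; have [k1 k2] := h3 t t1.
by split; apply: le_trans (_ : K * M <= _) => //; rewrite lerDl.
Qed.

Lemma T_norm a (M : R) : (forall j, cabs (a j) <= M) -> @ns_norm R X (T a) <= K * M.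
Proof.
move=> hM; have M0 := le_trans (cabs_ge0 _) (hM 0%N).
by have [h1 h2 h3] := T_in hM; apply: majorant_norm_le => //; rewrite mulr_ge0.
Qed.

(** From below: [|a k| / 2] exceeds [|psi k (T a)|], hence the norm of [T a], by at most a
    sixteenth of the norm of [a]. *)
Lemma T_embedding : @bicontinuous_embedding R (linfty R) X T.
Proof.
split; first split; first split.
- exact: T_set.
- move=> c a a' ba ba'; exact: T_lin.
- by exists K => a ba; apply: T_norm; exact: linfty_le.
exists (7 / 16); first by rewrite divr_gt0.
move=> a ba; set S := ns_norm a; have Sle := linfty_le ba.
have h : S <= 2 * @ns_norm R X (T a) + S / 8.
  apply: linfty_sup => k; have := T_peak Sle k; have := psi_le k (T_set ba).
  rewrite /psi; set p := axis_eval _ _ _ => p1 p2.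
  have := cabs_lb (a k * (1 / 2)%:C) p; rewrite cabs_distC cabsM cabs_real ger0_norm ?divr_ge0 //.
  by move: p1 p2; rewrite -/S; lra.
lra.
Qed.

(** Diagonal argument: choose [a k] in [{0, 1}] so that [psi k (T a)] is far from
    [psi k s] for the element [s] with number [k] of a countable dense set. *)
Lemma T_nonseparable : ~ separable X.
Proof.
move=> [S [cS SX dS]]; have /countable_injP[f finj] := cS.
pose P k := exists s, [/\ S s, f s = k & 1 / 4 <= cabs (psi k s)].
pose a k : C := if `[< P k >] then 0 else 1.
have a1 k : cabs (a k) <= 1 by rewrite /a; case: ifP; rewrite ?cabs0 ?cabs1.
have ba : bounded_seq a by exists 1.
have e0 : (0 : R) < 1 / 16 by rewrite divr_gt0.
have [s Ss ds] := dS (T a) (T_set ba) _ e0.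
have [c c0 hc] := majorant_spaceP (SX _ Ss).
have [c' c'0 hc'] := majorant_spaceP (T_set ba).
have := axis_eval_le (addr_ge0 c'0 c0) (axis_majorizedB hc' hc) (y1 (f s)).
rewrite axis_evalB => h1.
have := T_peak a1 (f s); rewrite -[axis_eval _ _ (T a)]/(psi (f s) (T a)) => h2.
have {}h1 : cabs (psi (f s) (T a) - psi (f s) s) < 1 / 16 by apply: le_lt_trans ds.
have half : cabs ((1 / 2)%:C : C) = 1 / 2 by rewrite cabs_real ger0_norm ?divr_ge0.
have [/asboolP Pk|nP] := boolP `[< P (f s) >].
  have [s' [Ss' fs' h3]] := Pk.
  have E1 : s' = s by apply: finj; rewrite ?inE.
  move: h2; rewrite /a asboolT // mul0r subr0 => h2; rewrite E1 in h3.
  have := cabs_lb (psi (f s) s) (psi (f s) (T a)).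
  rewrite cabs_distC; move: h1 h2 h3; lra.
have h3 : cabs (psi (f s) s) < 1 / 4.
  rewrite ltNge; apply: contra nP => h; apply/asboolP; exists s; split => //.
move: h2; rewrite /a (negbTE nP) mul1r => h2.
have := cabs_lb ((1 / 2)%:C : C) (psi (f s) (T a)); rewrite half cabs_distC => k1.
have := cabs_lb (psi (f s) (T a)) (psi (f s) s); move: h1 h2 h3 k1; lra.
Qed.

Lemma dual_le (phi : (C -> C) -> C) F : @ns_set R (dual X) phi ->
  @ns_set R X F -> @ns_norm R X F <= 1 -> cabs (phi F) <= @ns_norm R (dual X) phi.
Proof.
move=> [_ [L hL]] hF nF; apply: ub_le_sup; last by exists F.
exists `|L| => _ [G [hG nG] <-]; apply: le_trans (hL G hG) _.
apply: le_trans (ler_norm _) _; rewrite normrM ler_piMr //.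
by rewrite ger0_norm // majorant_norm_ge0.
Qed.

Lemma dual_psi k : @ns_set R (dual X) (psi k).
Proof.
split; first by split => // a F G _ _; exact: axis_eval_lin.
by exists 1 => F hF; rewrite mul1r; exact: psi_le.
Qed.

Let step n : nat -> C := fun j => if (j < n)%N then 1 else 0.

Let step_le n j : cabs (step n j) <= 1.
Proof. by rewrite /step; case: ifP; rewrite ?cabs0 ?cabs1. Qed.

Let step_bd n : bounded_seq (step n). Proof. by exists 1. Qed.

(** Scaling inside [T] replaces the homogeneity of the norm of the majorant space. *)
Lemma dual_step (phi : (C -> C) -> C) n : @ns_set R (dual X) phi ->
  cabs (phi (T (step n))) <= (K + 2) * @ns_norm R (dual X) phi.
Proof.
move=> hphi; pose k : C := (K + 1)%:C.
have K1 : 0 < K + 1 by rewrite ltr_wpDl.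
have ck : cabs k = K + 1 by rewrite cabs_real gtr0_norm.
have k0 : k != 0 by rewrite -cabs_gt0 ck.
pose b j : C := k^-1 * step n j.
have bM j : cabs (b j) <= (K + 1)^-1.
  by rewrite cabsM cabsV ck; apply: ler_piMr; [rewrite invr_ge0 ltW|exact: step_le].
have z0 (j : nat) : cabs (0 : C) <= 0 by rewrite cabs0.
have bb : bounded_seq b by exists (K + 1)^-1.
have bz : bounded_seq (fun=> 0 : C) by exists 0.
have E1 : T (step n) = k *: T b + T (fun=> 0).
  have := T_lin k bb bz; rewrite (_ : (fun j => k * b j + 0) = step n) //.
  by apply/funext => j; rewrite addr0 /b mulrA mulfV // mul1r.
have n1 : @ns_norm R X (T b) <= 1.
  apply: le_trans (T_norm bM) _; by rewrite ler_pdivrMr // mul1r lerDl.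
have n2 : @ns_norm R X (T (fun=> 0)) <= 1.
  by apply: le_trans (T_norm z0) _; rewrite mulr0.
have [[_ lphi] _] := hphi.
rewrite E1 lphi; [|exact: T_set|exact: T_set].
have d1 := dual_le hphi (T_set bb) n1; have d2 := dual_le hphi (T_set bz) n2.
apply: le_trans (cabsD _ _) _.
have -> : cabs (k *: phi (T b)) = cabs k * cabs (phi (T b)) by rewrite -cabsM.
rewrite ck (_ : (K + 2) * _ = (K + 1) * @ns_norm R (dual X) phi + @ns_norm R (dual X) phi).
  by apply: lerD => //; rewrite ler_wpM2l // ltW.
by rewrite (_ : K + 2 = K + 1 + 1) ?mulrDl ?mul1r // -addrA.
Qed.

(** Let [x n = T (step n)], the image of the indicator of the first [n] integers, and
    let [L phi] be the limit of [phi (x n)] along an ultrafilter.  If [L] were evaluation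
    at [x], then [psi k x] would be close to [1 / 2] for all [k], and so would be
    [phi x] for the limit [phi] of the [psi k].  But [phi (x n)] is close to 0 for all [n],
    as [psi k (x n)] is close to 0 for [k >= n], so [L phi] is close to 0. *)
Lemma T_nonreflexive : ~ reflexive_space X.
Proof.
have [U [UU Uoo]] := ultraFilterLemma eventually_filter.
pose lm := ulim U (R := R).
have lm_lin := ulim_lin UU (R := R); have lm_dist := ulim_dist UU Uoo (R := R).
pose L (phi : (C -> C) -> C) : C := lm (fun n => phi (T (step n))).
have bphi (phi : (C -> C) -> C) : @ns_set R (dual X) phi -> bounded_seq (fun n => phi (T (step n))).
  by move=> hphi; exists ((K + 2) * @ns_norm R (dual X) phi) => n; exact: dual_step.
have hL : @ns_set R (dual (dual X)) L.
  split.
    by split => // a phi chi hphi hchi; apply: lm_lin; exact: bphi.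
  exists (K + 2) => phi hphi; rewrite -[L phi]subr0.
  by apply: (lm_dist _ _ 0%N) => [|n _]; [exact: bphi|rewrite subr0; exact: dual_step].
move=> /(_ L hL)[x hx hLx].
have bpsi F : @ns_set R X F -> bounded_seq (fun k => psi k F).
  by move=> hF; exists (@ns_norm R X F) => k; exact: psi_le.
pose phi F : C := lm (fun k => psi k F).
have hphi : @ns_set R (dual X) phi.
  split.
    split => // a F G hF hG; rewrite /phi -lm_lin; [|exact: bpsi|exact: bpsi].
    by congr lm; apply/funext => k; exact: axis_eval_lin.
  exists 1 => F hF; rewrite mul1r -[phi F]subr0.
  by apply: (lm_dist _ _ 0%N) => [|k _]; [exact: bpsi|rewrite subr0; exact: psi_le].
have peak n k := T_peak (step_le n) k.
have px k : cabs (psi k x - (1 / 2)%:C) <= 1 / 16.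
  rewrite -(hLx _ (dual_psi k)); apply: (lm_dist _ _ k.+1); first exact/bphi/dual_psi.
  by move=> n kn; have := peak n k; rewrite /step kn mul1r.
have h1 : cabs (phi x - (1 / 2)%:C) <= 1 / 16.
  by apply: (lm_dist _ _ 0%N) => [|k _]; [exact: bpsi|exact: px].
have h2 : cabs (L phi - 0) <= 1 / 16.
  apply: (lm_dist _ _ 0%N) => [|n _]; first exact: bphi.
  apply: (lm_dist _ _ n) => [|k nk]; first exact/bpsi/T_set.
  by have := peak n k; rewrite /step ltnNge nk mul0r.
move: h1 h2; rewrite (hLx _ hphi) subr0 => h1 h2.
have := cabs_lb ((1 / 2)%:C : C) (phi x); rewrite cabs_distC cabs_real ger0_norm ?divr_ge0 //.
by move: h1 h2; lra.
Qed.

End Embedding.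

(** * Where Theta becomes small *)

Section Conditions.
Variable R : realType.
Local Notation C := (Cplx R).

Definition small_at_infinity (f : C -> C) (delta : R) := forall B e : R, 0 < e ->
  exists z, [/\ delta <= complex.Im z, B <= cabs z & cabs (f z) <= e].

Lemma within_cinfty (delta M : R) :
  within [set z : C | delta <= complex.Im z] (@cinfty_nbhs R)
    [set z : C | delta <= complex.Im z /\ M < cabs z].
Proof. by exists M => // z /= Mz hz. Qed.

Lemma limf_einf_0P (f : C -> C) (delta : R) :
  limf_einf (fun z : C => (cabs (f z))%:E)
    (within [set z | delta <= complex.Im z] (@cinfty_nbhs R)) = 0%E <->
  small_at_infinity f delta.
Proof.
rewrite limf_einfE; split.
  move=> h B e e0; apply: contrapT => H.
  pose V : set C := [set z : C | delta <= complex.Im z /\ B < cabs z].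
  have : (e%:E <= ereal_inf [set (cabs (f z))%:E | z in V])%E.
    apply: le_ereal_inf_tmp => _ [z [z1 z2] <-]; rewrite lee_fin leNgt; apply/negP => /ltW fz.
    by apply: H; exists z; split => //; exact: ltW.
  have : (ereal_inf [set (cabs (f z))%:E | z in V] <= 0)%E.
    rewrite -h; apply: ereal_sup_ubound; exists V => //; exact: within_cinfty.
  by move=> h1 h2; have := le_trans h2 h1; rewrite lee_fin leNgt e0.
move=> h; apply/eqP; rewrite eq_le; apply/andP; split.
  apply: ge_ereal_sup => _ [V [M _ hM] <-]; apply/lee_addgt0Pr => e e0; rewrite add0e.
  have [z [z1 z2 z3]] := h (M + 1) e e0.
  apply: le_trans (_ : ((cabs (f z))%:E <= _)%E); last by rewrite lee_fin.
  apply: ereal_inf_lbound; exists z => //; apply: hM => //=.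
  by apply: lt_le_trans z2; rewrite ltrDl.
apply: le_trans (_ : (ereal_inf [set (cabs (f z))%:E | z in setT] <= _)%E).
  by apply: le_ereal_inf_tmp => _ [z _ <-]; rewrite lee_fin cabs_ge0.
by apply: ereal_sup_ubound; exists setT => //; exists 0.
Qed.

Lemma mean_type_small (f : C -> C) : (mean_type f < 0)%E -> small_at_infinity f 1.
Proof.
move=> /ereal_inf_lt[_ [V [M [_ hM]] <-]] hV B e e0.
have [c [c0 hc]] : exists c : R, c < 0 /\ (ereal_sup [set ((y^-1)%:E *
    lne (cabs (f (0 +i* y)))%:E)%E | y in V] <= c%:E)%E.
  move: hV; case: (ereal_sup _) => [r| |] //.
    by rewrite lte_fin => r0; exists r.
  by move=> _; exists (-1); rewrite ltrN10 leNye.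
pose y : R := `|M| + `|B| + 1 + `|ln e / c|.
have [y1 [yM [yB yc]]] : 1 <= y /\ M < y /\ B <= y /\ ln e / c <= y.
  have := ler_norm M; have := ler_norm B; have := ler_norm (ln e / c).
  have := normr_ge0 M; have := normr_ge0 B; have := normr_ge0 (ln e / c).
  by rewrite /y => *; do 3 (split; first lra); lra.
exists (0 +i* y); split; [exact: y1|by rewrite cabs_imag (le_trans yB) ?ler_norm|].
have y0 : 0 < y by lra.
have [->|fz] := eqVneq (cabs (f (0 +i* y))) 0; first exact: ltW.
have fp : 0 < cabs (f (0 +i* y)) by rewrite lt_neqAle eq_sym fz cabs_ge0.
have : (((y^-1)%:E * lne (cabs (f (0 +i* y)))%:E) <= c%:E)%E.
  by apply: le_trans hc; apply: ereal_sup_ubound; exists y => //; exact: hM.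
rewrite lne_EFin // -EFinM lee_fin mulrC ler_pdivrMr // => h.
rewrite -ler_ln ?posrE //; apply: le_trans h _.
by rewrite mulrC -ler_ndivrMr.
Qed.

Lemma zeros_listing_zero (f : C -> C) (w : nat -> C) n : zeros_listing f w -> f (w n) = 0.
Proof.
move=> [hw /(_ _ (hw n)) [k [[g [_ _ hg]] hk]]].
have := nbhs_singleton hg; rewrite subrr => ->.
case: k hk {hg} => [|k] hk; last by rewrite expr0n mul0r.
move: hk; rewrite II0 card_eq0 => /eqP /seteqP[h _].
by have := h n erefl.
Qed.

Lemma finite_nat_bound (A : set nat) k : (A #= `I_k)%card -> exists N, forall n, A n -> (n < N)%N.
Proof.
move=> hA; have : finite_set A by exists k.
move=> /finite_seqP[s ->]; exists (\max_(i <- s) i).+1 => n /= ns.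
by rewrite ltnS; apply: leq_bigmax_seq.
Qed.

Lemma zeros_isolated (f : C -> C) z k : zero_order f z k ->
  exists2 d : R, 0 < d & forall u, u != z -> cabs (u - z) < d -> f u != 0.
Proof.
move=> [g [dg gz hg]].
have cg := derivable_continuous (nbhs_singleton dg).
have gz0 : 0 < cabs (g z) by rewrite cabs_gt0.
have [d1 d10 h1] := cg _ gz0.
have [d2 d20 h2] := (near_cabsP _ _).1 hg.
exists (Num.min d1 d2); first by rewrite lt_min d10.
move=> u uz; rewrite lt_min => /andP[u1 u2]; rewrite (h2 u u2).
rewrite mulf_neq0 ?expf_neq0 ?subr_eq0 //.
by apply/negP => /eqP E; have := h1 u u1; rewrite E sub0r cabsN ltxx.
Qed.

(** Otherwise infinitely many listed zeros lie in a bounded part of the half-plane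
    [Im z >= delta]; along an ultrafilter they converge to a point [L] of it.  As the zeros
    are isolated, these zeros equal [L], which is thus listed infinitely often, against the
    finite order of [L]. *)
Lemma zeros_small (f : C -> C) (w : nat -> C) : zeros_listing f w ->
  (0 < limn_esup (fun n => (complex.Im (w n))%:E))%E ->
  exists2 delta : R, 0 < delta & small_at_infinity f delta.
Proof.
move=> hw hl.
have [delta [d0 hd]] : exists delta : R, 0 < delta /\
    (delta%:E < limn_esup (fun n => (complex.Im (w n))%:E))%E.
  case: (limn_esup _) hl => [r| |] //.
    by rewrite lte_fin => r0; exists (r / 2); rewrite lte_fin; split; lra.
  by move=> _; exists 1; rewrite ltr01 ltry.
have often N : exists n, (N <= n)%N /\ delta < complex.Im (w n).
  have : (delta%:E < ereal_sup [set (complex.Im (w n))%:E | n in [set n | (N <= n)%N]])%E.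
    apply: lt_le_trans hd _; apply: ereal_inf_lbound; exists [set n | (N <= n)%N] => //.
    by exists N.
  by move=> /ereal_sup_gt[_ [n hn <-]]; rewrite lte_fin => h; exists n.
exists delta => // B e e0; apply: contrapT => H.
have bd n : delta < complex.Im (w n) -> cabs (w n) < B.
  move=> hn; rewrite ltNge; apply/negP => Bn; apply: H; exists (w n).
  by rewrite (ltW hn) Bn (zeros_listing_zero n hw) cabs0 ltW.
have [g hg] := choice often.
have [U [UU Uoo]] := ultraFilterLemma eventually_filter.
have bw : bounded_seq (fun k => w (g k)) by exists B => k; apply/ltW/bd; have [] := hg k.
have UP := ulimP UU bw; set L := ulim U _ in UP.
have Limim : delta <= complex.Im L.
  apply/ler_addgt0Pr => r r0; have [k /= hk] := @filter_ex _ U (@ultra_proper _ _ UU) _ (UP r r0).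
  have [_ gk] := hg k; have := cabs_Im (w (g k) - L); rewrite cImB.
  have := ler_norm (complex.Im (w (g k)) - complex.Im L).
  move: hk gk; lra.
have [_ /(_ L (lt_le_trans d0 Limim))[k [zk ck]]] := hw.
have [d dpos hdist] := zeros_isolated zk.
have [N hN] := finite_nat_bound ck.
have UN : U [set n | (N <= n)%N] by apply: Uoo; exists N.
have UF := @ultra_proper _ _ UU.
have [n [/= n1 n2]] := filter_ex (filterI (UP d dpos) UN).
have wL : w (g n) = L.
  apply/eqP; apply/negPn/negP => ne; have := hdist _ ne n1.
  by rewrite (zeros_listing_zero _ hw) eqxx.
have [gn _] := hg n; have := hN _ wL.
by rewrite ltnNge (leq_trans n2 gn).
Qed.

End Conditions.

Theorem theorem3p2 (R : realType) (E : Cplx R -> Cplx R)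
    (hE : hermite_biehler E)
    (hreal : forall x : R, exists F, deBranges E F /\ F x%:C != 0)
    (hdim : infinite_dim (deBranges E)) :
  let Theta : Cplx R -> Cplx R := fun z => sharp E z / E z in
  let D : set (Cplx R) := [set 0 +i* y | y in [set y : R | 1 <= y]] in
  let m : Cplx R -> R := fun z => cabs (E z) / cabs (z + (0 +i* 1)) in
  let cond_i :=
    (mean_type Theta < 0)%E \/
    exists w : nat -> Cplx R, zeros_listing Theta w /\
      (0 < limn_esup (fun n => (complex.Im (w n))%:E))%E in
  let cond_ii :=
    exists2 delta : R, 0 < delta &
      limf_einf (fun z : Cplx R => (cabs (Theta z))%:E)
        (within [set z | delta <= complex.Im z] (@cinfty_nbhs R)) = 0%E in
  let cond_iii :=
    [/\ exists T : (nat -> Cplx R) -> (Cplx R -> Cplx R),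
          @bicontinuous_embedding R (linfty R) (majorant_space E D m) T,
        ~ separable (majorant_space E D m) &
        ~ reflexive_space (majorant_space E D m)] in
  (cond_i -> cond_ii) /\ (cond_ii -> cond_iii).
Proof.
move=> Theta D m cond_i cond_ii cond_iii; split.
  move=> [/mean_type_small h|[w [hw hl]]].
    by exists 1 => //; exact/limf_einf_0P.
  have [delta d0 h] := zeros_small hw hl.
  by exists delta => //; exact/limf_einf_0P.
move=> [delta d0 /limf_einf_0P h].
have [T [K [y [y1 T_lin T_in K0 T_peak]]]] := exists_synthesis hE d0 h.
split.
- by exists T; exact: (T_embedding hE y1 T_lin T_in K0 T_peak).
- exact: (T_nonseparable hE y1 T_in K0 T_peak).
- exact: (T_nonreflexive hE y1 T_lin T_in K0 T_peak).
Qed.
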